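(* Let $\phi=(f_0:f_1:f_2):\mathbb{P}^1\to\mathbb{P}^2$ be a generically $1$-to-$1$ parametrization of a plane curve $\mathcal{C}$ of degree $d\geq 2$ over $\mathbb{C}$. For each singular point $P=(p_0:p_1:p_2)$ of $\mathcal{C}$, let $L_P(u,v,w)=p_0u+p_1v+p_2w$ be an equation of the line in $(\mathbb{P}^2)^\vee$ corresponding to $P$, and let $F^\vee(u,v,w)$ be an irreducible equation of the dual curve $\mathcal{C}^\vee$ of $\mathcal{C}$. Then the discriminant (with respect to $(s,t)$) of the polynomial $uf_0+vf_1+wf_2$ admits the following factorization into irreducible polynomials: $$\mathrm{Disc}(uf_0+vf_1+wf_2)=c\cdot F^\vee\cdot\prod_{P}L_P^{\,m_P-r_P}\in\mathbb{C}[u,v,w],$$ where $c\in\mathbb{C}\setminus\{0\}$ and the product runs over all singular points $P$ of $\mathcal{C}$.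
   Context: Here $f_0,f_1,f_2\in\mathbb{C}[s,t]$ are homogeneous polynomials of the same degree $d$ with $\gcd(f_0,f_1,f_2)=1$, $\phi(s:t)=(f_0(s,t):f_1(s,t):f_2(s,t))$ has image $\mathcal{C}$, and generically $1$-to-$1$ means that $\phi^{-1}(P)$ is a single point for generic $P\in\mathcal{C}$ (so $\phi$ is the normalization of $\mathcal{C}$ and $\deg\mathcal{C}=d$). For a singular point $P\in\mathcal{C}$, $m_P$ denotes the multiplicity of the singularity $(\mathcal{C},P)$ and $r_P$ the number of branches of $\mathcal{C}$ at $P$. $(\mathbb{P}^2)^\vee$ is the dual projective plane, the point $(u:v:w)$ corresponding to the line $ux+vy+wz=0$ in $\mathbb{P}^2$. The dual curve $\mathcal{C}^\vee\subset(\mathbb{P}^2)^\vee$ is the closure of the set of tangent lines to $\mathcal{C}$ at its smooth points. $\mathrm{Disc}$ is the discriminant of a binary form of degree $d$ in the homogeneous variables $(s,t)$; it is homogeneous of degree $2(d-1)$ in the coefficients of the form. *)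

(* Defs.v *)
From HB Require Import structures.
From mathcomp Require Import all_boot all_order all_algebra.
From mathcomp Require Import complex reals.
From mathcomp Require Import freeg mpoly.

Set Implicit Arguments.
Unset Strict Implicit.
Unset Printing Implicit Defensive.

Import GRing.Theory.
Local Open Scope ring_scope.

Definition irreducible_elt (A : idomainType) (p : A) : Prop :=
  [/\ p != 0, p \isn't a GRing.unit
    & forall a b : A, p = a * b -> a \is a GRing.unit \/ b \is a GRing.unit].

(* gcd(f_i) = 1 *)
Definition coprime_family (A : idomainType) (I : Type) (f : I -> A) : Prop :=
  forall h : A, (forall i, exists g, f i = g * h) -> h \is a GRing.unit.

Section BinaryForms.
Variable A : comUnitRingType.

(* The coefficient of s^(n-k) t^k in a binary form of degree n, where
   s = 'X_0 and t = 'X_1. *)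
Definition bcoef (n : nat) (G : {mpoly A[2]}) (k : nat) : A :=
  G@_[multinom (if (i : nat) == 0 then n - k else k) | i < 2].

(* Sylvester matrix of binary forms G, H of (formal) degrees m and n: the rows
   are the coordinates of s^(n-1-i) t^i G and s^(m-1-i) t^i H in the monomial
   basis of the forms of degree m + n - 1.  The degrees are those of the forms,
   so vanishing extreme coefficients are allowed (unlike in Sylvester_mx). *)
Definition form_sylvester (m n : nat) (G H : {mpoly A[2]}) : 'M[A]_(n + m) :=
  col_mx
    (\matrix_(i < n, j < n + m)
       if (i <= j <= i + m)%N then bcoef m G (j - i) else 0)
    (\matrix_(i < m, j < n + m)
       if (i <= j <= i + n)%N then bcoef n H (j - i) else 0).

Definition form_resultant (m n : nat) (G H : {mpoly A[2]}) : A :=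
  \det (form_sylvester m n G H).

(* Normalized so that a form a_0 * \prod_i (s - x_i t) of degree d has
   discriminant a_0^(2d-2) * \prod_(i < j) (x_i - x_j)^2. *)
Definition form_disc (d : nat) (G : {mpoly A[2]}) : A :=
  (-1) ^+ 'C(d, 2) * ((d ^ (d - 2))%:R)^-1 *
    form_resultant d.-1 d.-1 (mderiv 0 G) (mderiv 1 G).

End BinaryForms.

(* Points of P^n are represented by nonzero row vectors, up to proj_eq. *)
Section ProjectivePlane.
Variable K : fieldType.

Definition proj_eq (n : nat) (x y : 'rV[K]_n) : Prop :=
  exists2 k : K, k != 0 & y = k *: x.

Definition evalv (n : nat) (G : {mpoly K[n]}) (x : 'rV[K]_n) : K :=
  G.@[fun i => x 0 i].

Definition gradv (n : nat) (G : {mpoly K[n]}) (x : 'rV[K]_n) : 'rV[K]_n :=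
  \row_i evalv (mderiv i G) x.

Definition zariski_closure (Z : 'rV[K]_3 -> Prop) (Q : 'rV[K]_3) : Prop :=
  Q != 0 /\
  forall (e : nat) (G : {mpoly K[3]}), G \is e.-homog ->
    (forall P, Z P -> evalv G P = 0) -> evalv G Q = 0.

Definition irreducible_equation (Z : 'rV[K]_3 -> Prop) (F : {mpoly K[3]}) :
    Prop :=
  [/\ exists e : nat, F \is e.-homog, irreducible_elt F
    & forall P, P != 0 -> (evalv F P = 0 <-> Z P)].

Definition param (f : 'I_3 -> {mpoly K[2]}) (x : 'rV[K]_2) : 'rV[K]_3 :=
  \row_i evalv (f i) x.

Definition fiber (f : 'I_3 -> {mpoly K[2]}) (P : 'rV[K]_3) (x : 'rV[K]_2) :
    Prop :=
  x != 0 /\ proj_eq (param f x) P.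

Definition image_curve (f : 'I_3 -> {mpoly K[2]}) (P : 'rV[K]_3) : Prop :=
  P != 0 /\ exists x, fiber f P x.

(* The fibre is a single point over a nonempty Zariski-open subset of the
   (irreducible) image. *)
Definition generically_one_to_one (f : 'I_3 -> {mpoly K[2]}) : Prop :=
  exists (e : nat) (G : {mpoly K[3]}),
    [/\ G \is e.-homog,
        exists2 P, image_curve f P & evalv G P != 0
      & forall P, image_curve f P -> evalv G P != 0 ->
          forall x y, fiber f P x -> fiber f P y -> proj_eq x y].

(* From here on F is an irreducible equation of the curve. *)

Definition smooth_point (F : {mpoly K[3]}) (P : 'rV[K]_3) : Prop :=
  [/\ P != 0, evalv F P = 0 & gradv F P != 0].

Definition singular_point (F : {mpoly K[3]}) (P : 'rV[K]_3) : Prop :=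
  [/\ P != 0, evalv F P = 0 & gradv F P = 0].

(* The tangent line at P is the point of the dual plane with coordinates the
   gradient of F at P. *)
Definition dual_curve (F : {mpoly K[3]}) : 'rV[K]_3 -> Prop :=
  zariski_closure
    (fun Q => exists2 P, smooth_point F P & proj_eq (gradv F P) Q).

Definition dual_line (P : 'rV[K]_3) : {mpoly K[3]} := \sum_i P 0 i *: 'X_i.

(* The equation of the germ at P in the affine chart x_i = 1, with coordinates
   centred at P, where i is a coordinate with P 0 i != 0. *)
Definition germ_chart (F : {mpoly K[3]}) (P : 'rV[K]_3) (i : 'I_3) :
    {mpoly K[2]} :=
  F \mPo [tuple (P 0 j / P 0 i)%:MP
                + (if unlift i j is Some k then 'X_k else 0) | j < 3].

Definition germ (F : {mpoly K[3]}) (P : 'rV[K]_3) : {mpoly K[2]} :=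
  if [pick i | P 0 i != 0] is Some i then germ_chart F P i else 0.

(* Lowest degree of a monomial of g. *)
Definition order_at0 (g : {mpoly K[2]}) : nat :=
  \big[minn/msize g]_(m <- msupp g) mdeg m.

Definition multiplicity (F : {mpoly K[3]}) (P : 'rV[K]_3) : nat :=
  order_at0 (germ F P).

End ProjectivePlane.

(* Branches of a plane germ g = 0 at the origin: classes, up to invertible
   reparametrization, of primitive formal parametrizations.  A power series
   sum_n (a n) T^n is given by its coefficients a : nat -> K; since series
   below are substituted only when this makes the T^n coefficient depend on
   finitely many terms, it is computed on truncations. *)
Section Branches.
Variable K : fieldType.

Definition series_trunc (a : nat -> K) (n : nat) : {poly K} :=
  \poly_(k < n.+1) a k.

(* a(h(T)), for h without constant term *)
Definition series_comp (a h : nat -> K) (n : nat) : K :=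
  (series_trunc a n \Po series_trunc h n)`_n.

Definition reparam (c : 'I_2 -> nat -> K) (h : nat -> K) : 'I_2 -> nat -> K :=
  fun i => series_comp (c i) h.

Definition on_germ (g : {mpoly K[2]}) (c : 'I_2 -> nat -> K) : Prop :=
  (forall i, c i 0%N = 0) /\
  forall n, (mmap polyC (fun i => series_trunc (c i) n) g)`_n = 0.

(* c is not obtained by substituting a series of order > 1 (in particular c is
   not constant). *)
Definition primitive_param (c : 'I_2 -> nat -> K) : Prop :=
  forall (c' : 'I_2 -> nat -> K) (h : nat -> K), h 0%N = 0 ->
    (forall i n, c i n = reparam c' h i n) -> h 1%N != 0.

Definition branch_equiv (c c' : 'I_2 -> nat -> K) : Prop :=
  exists h : nat -> K,
    [/\ h 0%N = 0, h 1%N != 0 & forall i n, c i n = reparam c' h i n].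

Definition is_branch (g : {mpoly K[2]}) (c : 'I_2 -> nat -> K) : Prop :=
  on_germ g c /\ primitive_param c.

Definition germ_nb_branches (g : {mpoly K[2]}) (r : nat) : Prop :=
  exists b : 'I_r -> 'I_2 -> nat -> K,
    [/\ forall k, is_branch g (b k),
        forall k l, branch_equiv (b k) (b l) -> k = l
      & forall c, is_branch g c -> exists k, branch_equiv c (b k)].

Definition nb_branches (F : {mpoly K[3]}) (P : 'rV[K]_3) (r : nat) : Prop :=
  germ_nb_branches (germ F P) r.

(* S lists each singular point of the curve F = 0 exactly once, by one vector
   of homogeneous coordinates. *)
Definition singular_points (F : {mpoly K[3]}) (S : seq 'rV[K]_3) : Prop :=
  [/\ uniq S, forall P, P \in S -> singular_point F P,
      {in S &, forall P Q, proj_eq P Q -> P = Q}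
    & forall P, singular_point F P -> exists2 Q, Q \in S & proj_eq P Q].

(* u f_0 + v f_1 + w f_2, as a form in (s, t) over K[u, v, w] *)
Definition generic_combination (f : 'I_3 -> {mpoly K[2]}) :
    {mpoly {mpoly K[3]}[2]} :=
  \sum_i 'X_i *: map_mpoly (@mpolyC 3 K) (f i).

End Branches.

(* Main.v *)
Require Import Defs.
From HB Require Import structures.
From mathcomp Require Import all_boot all_order all_algebra.
From mathcomp Require Import complex reals boolp.
From mathcomp Require Import freeg mpoly.
From mathcomp Require Import ring zify.

Set Implicit Arguments.
Unset Strict Implicit.
Unset Printing Implicit Defensive.

Import GRing.Theory Num.Theory.
Local Open Scope ring_scope.

(* Let f_s x f_t = h psi be the cross product of the partial derivatives of f,
   where h is the gcd of its coordinates; psi parametrizes the dual curve.  The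
   discriminant of a member a + e b of a pencil of forms is, up to a constant,
   the product of the values of a + e b at the roots of the Jacobian of a and b.
   For a = u.f and b = u'.f this Jacobian is (u x u').(f_s x f_t): each root x of
   h contributes the linear factor of the point f(x), and the roots of
   (u x u').psi contribute the dual equation, by biduality.
   A parameter o over P contributes 1 + ord_o h to the multiplicity of the curve
   at P.  The curve having a rational inverse, every formal arc on it lifts to
   the projective line, so that the branches at P are the parameters over P.
   Hence m_P - r_P is the number of roots x of h with f(x) = P. *)

(** Divisibility between ternary forms is established on lines of a fixed direction [q]. There a
    form becomes a polynomial in the line parameter whose leading coefficient is a form in the base
    point. If it has distinct roots over a dense set of base points and a second form vanishes at
    them, pseudo-division makes it divide the second form times a power of that leading coefficient,
    and irreducibility does the rest. This one device identifies the equation of the curve on a line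
    with the product over the points of the curve there, determines the ideal of the curve, and
    identifies the last factor of the discriminant with the dual equation. Generic injectivity
    enters as a finite set [B] of parameters outside which the map is injective: general sections
    avoid [B], so their distinct roots give distinct points, and each equation occurs with exponent
    one. The rational inverse, and the elimination that lets arcs lift through it, come from
    dimension counts on the curve. *)

Lemma rmorph_mmap (n : nat) (R S T : nzRingType) (phi : {rmorphism S -> T})
    (g : R -> S) (h : 'I_n -> S) (p : {mpoly R[n]}) :
  phi (mmap g h p) = mmap (phi \o g) (phi \o h) p.
Proof.
rewrite /mmap rmorph_sum /=; apply: eq_bigr => m _.
rewrite rmorphM /= /mmap1 rmorph_prod; congr (_ * _).
by apply: eq_bigr => i _; rewrite rmorphXn.
Qed.

Lemma eq_mmap (n : nat) (R S : nzRingType) (g g' : R -> S) (h h' : 'I_n -> S)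
    (p : {mpoly R[n]}) :
  g =1 g' -> h =1 h' -> mmap g h p = mmap g' h' p.
Proof.
move=> eg eh; rewrite /mmap; apply: eq_bigr => m _; rewrite eg.
by congr (_ * _); apply: mmap1_eq.
Qed.

Lemma mpoly_alg_ind (n : nat) (R : nzRingType) (P : {mpoly R[n]} -> Prop) :
  (forall c, P c%:MP) -> (forall i, P 'X_i) ->
  (forall p q, P p -> P q -> P (p + q)) ->
  (forall p q, P p -> P q -> P (p * q)) -> forall p, P p.
Proof.
move=> PC PX PD PM; elim/mpolyind => [|c m p _ _ Pp]; first exact: (PC 0).
apply: PD => //; rewrite -mul_mpolyC; apply: (PM _ _ (PC c)).
rewrite mpolyXE_id; apply: big_ind => [||i _]; [exact: (PC 1)|exact: PM|].
elim: (m i) => [|k IH]; first exact: (PC 1).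
by rewrite exprS; apply: (PM _ _ (PX i)).
Qed.

(** * Identity principle, linear forms and homogeneous polynomials *)

Section Univariate.
Variable K : numFieldType.

Lemma poly_vanish (p : {poly K}) : (forall x, p.[x] = 0) -> p = 0.
Proof.
move=> p0; apply/eqP; apply: contraT => nz.
have := @max_poly_roots _ p [seq i%:R | i <- iota 0 (size p)] nz.
rewrite size_map size_iota ltnn => H; apply: H.
  by apply/allP => x _; apply/rootP.
by rewrite map_inj_uniq ?iota_uniq // => i j /eqP; rewrite eqr_nat => /eqP.
Qed.

Lemma poly_vanish_cofinite (s : seq K) (p : {poly K}) :
  (forall x, x \notin s -> p.[x] = 0) -> p = 0.
Proof.
move=> p0; have : p * \prod_(a <- s) ('X - a%:P) = 0.
  apply: poly_vanish => x; rewrite hornerM.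
  have [xs|/p0->] := boolP (x \in s); last by rewrite mul0r.
  by rewrite [X in _ * X](rootP _) ?mulr0 // root_prod_XsubC.
move/eqP; rewrite mulf_eq0 => /orP[/eqP//|].
by rewrite (negbTE (monic_neq0 (monic_prod_XsubC _ _ _))).
Qed.

Lemma exists_notin (s : seq K) : exists x : K, x \notin s.
Proof.
have [/allP H|/allPn[i _ iP]] :=
  boolP (all (fun i => i%:R \in s) (iota 0 (size s).+1)); last by exists i%:R.
have: (size [seq (i%:R : K) | i <- iota 0 (size s).+1] <= size s)%N.
  apply: uniq_leq_size.
    by rewrite map_inj_uniq ?iota_uniq // => i j /eqP; rewrite eqr_nat => /eqP.
  by move=> x /mapP[i /H iP ->].
by rewrite size_map size_iota ltnn.
Qed.

End Univariate.

(* Kronecker's substitution x_i := x^(B^i) reduces this to one variable. *)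
Lemma mpoly_vanish (K : numFieldType) (n : nat) (p : {mpoly K[n]}) :
  (forall v, p.@[v] = 0) -> p = 0.
Proof.
move=> p0; set B := msize p.
pose kap (m : 'X_{1..n}) := (\sum_(i < n) m i * B ^ i)%N.
have kap_inj : {in msupp p &, injective kap}.
  have digits (k : nat) (u v : 'I_k -> nat) : (forall i, u i < B)%N ->
      (forall i, v i < B)%N ->
      (\sum_(i < k) u i * B ^ i = \sum_(i < k) v i * B ^ i)%N -> u =1 v.
    elim: k u v => [|k IH] u v uB vB E i; first by case: i.
    have B0 : (0 < B)%N by apply: leq_ltn_trans (uB ord0).
    move: E; rewrite !big_ord_recl /= !expn0 !muln1.
    rewrite (eq_bigr (fun i : 'I_k => u (fintype.lift ord0 i) * B ^ i * B)%N);
      last first.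
      by move=> j _; rewrite /bump /= add1n expnSr mulnA.
    rewrite [in RHS](eq_bigr (fun i : 'I_k =>
      v (fintype.lift ord0 i) * B ^ i * B)%N); last first.
      by move=> j _; rewrite /bump /= add1n expnSr mulnA.
    rewrite -!big_distrl /= => E.
    have E0 : u ord0 = v ord0.
      by have := congr1 (modn^~ B) E; rewrite /= ![(_ + _ * _)%N]addnC !modnMDl
                 !modn_small.
    have E1 := congr1 (divn^~ B) E; rewrite /= ![(_ + _ * _)%N]addnC in E1.
    rewrite !divnMDl // !divn_small // !addn0 in E1.
    have [j ->|->//] := unliftP ord0 i.
    exact: (IH _ _ (fun _ => uB _) (fun _ => vB _) E1 j).
  move=> m m' mp mp' E; apply/mnmP => i.
  have bnd (m0 : 'X_{1..n}) : m0 \in msupp p -> forall i, (m0 i < B)%N.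
    move=> m0p j; apply: leq_ltn_trans (msize_mdeg_lt m0p).
    by rewrite mdegE (bigD1 j) //= leq_addr.
  exact: (digits n m m' (bnd _ mp) (bnd _ mp') E i).
have q0 : \sum_(m <- msupp p) p@_m *: 'X^(kap m) = 0 :> {poly K}.
  apply: poly_vanish => x; rewrite horner_sum -[RHS](p0 (fun i =>
    x ^+ (B ^ i))).
  rewrite mevalE; apply: eq_bigr => m _; rewrite hornerZ hornerXn;
    congr (_ * _).
  rewrite /kap; elim/big_rec2: _ => [|i a b _ <-]; first by rewrite expr0.
  by rewrite exprD mulnC exprM.
apply/mpolyP => m; rewrite mcoeff0.
have [mp|/memN_msupp_eq0//] := boolP (m \in msupp p).
have := congr1 (fun q : {poly K} => q`_(kap m)) q0.
rewrite coef_sum coef0 (bigD1_seq m) ?msupp_uniq //= coefZ coefXn eqxx mulr1.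
rewrite big1_seq ?addr0 // => m' /andP[ne m'p].
rewrite coefZ coefXn; case: eqP => [/kap_inj E|_]; last by rewrite mulr0.
by rewrite E ?eqxx in ne.
Qed.

Lemma mpoly_funext (K : numFieldType) (n : nat) (p q : {mpoly K[n]}) :
  (forall v, p.@[v] = q.@[v]) -> p = q.
Proof.
move=> E; apply/eqP; rewrite -subr_eq0; apply/eqP/mpoly_vanish => v.
by rewrite mevalB E subrr.
Qed.

Section LinearForms.
Variables (K : numFieldType) (n : nat).
Implicit Types (a : 'I_n -> K) (G : {mpoly K[n]}).

Definition linf a : {mpoly K[n]} := \sum_i a i *: 'X_i.

Lemma meval_linf a v : (linf a).@[v] = \sum_i a i * v i.
Proof.
by rewrite /linf raddf_sum /=; apply: eq_bigr => i _; rewrite mevalZ mevalXU.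
Qed.

Lemma linf_neq0 a i : a i != 0 -> linf a != 0.
Proof.
move=> ai; apply: contra ai => /eqP/(congr1 (meval (fun j => (j == i)%:R))).
rewrite meval_linf meval0 (bigD1 i) //= eqxx mulr1 big1 ?addr0 => [->//|j ne].
by rewrite (negbTE ne) mulr0.
Qed.

(** Replacing X_i by X_i - (a i)^-1 [linf a] changes a polynomial by a multiple of [linf a] only.
    The result takes at [v] the value of [G] at the projection of [v] onto the hyperplane along the
    i-th axis, so here it is zero. *)
Lemma linf_dvd a i G : a i != 0 ->
  (forall v, \sum_j a j * v j = 0 -> G.@[v] = 0) -> exists Q, G = linf a * Q.
Proof.
move=> ai van.
pose sg j : {mpoly K[n]} :=
  if j == i then 'X_i - (a i)^-1 *: linf a else 'X_j.
have main (H : {mpoly K[n]}) :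
    exists Q, H - mmap (@mpolyC n K) sg H = linf a * Q.
  elim/mpoly_alg_ind: H => [c|j|p q [Qp Ep] [Qq Eq]|p q [Qp Ep] [Qq Eq]].
  - by exists 0; rewrite mmapC subrr mulr0.
  - rewrite mmapX mmap1U /sg; case: eqP => [->|_].
      by exists (a i)^-1%:MP; rewrite opprB addrC subrK -mul_mpolyC mulrC.
    by exists 0; rewrite subrr mulr0.
  - by exists (Qp + Qq); rewrite mmapD mulrDr -Ep -Eq; ring.
  exists (Qp * q + mmap (@mpolyC n K) sg p * Qq).
  rewrite rmorphM /= mulrDr [_ * (mmap _ _ _ * _)]mulrCA -Eq mulrA -Ep; ring.
have [Q HQ] := main G; exists Q; rewrite -HQ.
suff -> : mmap (@mpolyC n K) sg G = 0 by rewrite subr0.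
apply: mpoly_vanish => v; rewrite (rmorph_mmap (meval v)) /=.
have -> : mmap (meval v \o @mpolyC n K) (meval v \o sg) G =
          G.@[fun j => (sg j).@[v]].
  by apply: eq_mmap => // c /=; rewrite mevalC.
apply: van; rewrite (bigD1 i) //= {1}/sg eqxx mevalB mevalZ mevalXU meval_linf.
rewrite mulrBr mulVKf // (bigD1 i) //= opprD addrA subrr add0r addrC.
rewrite (eq_bigr (fun j => a j * v j)) ?subrr // => j ne.
by rewrite /sg (negbTE ne) mevalXU.
Qed.

(** The substitution [sp], induced by the projection [sg] onto the hyperplane, is a ring morphism
    into a domain that kills G H, hence one of the factors. That factor vanishes on the hyperplane,
    where [sg] is the identity. *)
Lemma linf_prime a i G H Q : a i != 0 -> G * H = linf a * Q ->
  (exists G', G = linf a * G') \/ (exists H', H = linf a * H').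
Proof.
move=> ai E.
pose sg v j : K := if j == i then v i - (a i)^-1 * \sum_k a k * v k else v j.
pose sp j : {mpoly K[n]} :=
  if j == i then 'X_i - (a i)^-1 *: linf a else 'X_j.
have spE v j : (sp j).@[v] = sg v j.
  rewrite /sp /sg; case: ifP => _; rewrite ?mevalXU //.
  by rewrite mevalB mevalZ mevalXU meval_linf.
have cE (P : {mpoly K[n]}) v :
    (mmap (@mpolyC n K) sp P).@[v] = P.@[sg v].
  by rewrite (rmorph_mmap (meval v)) /=; apply: eq_mmap => [c|j] /=;
     rewrite ?mevalC ?spE.
have sgz v : \sum_k a k * sg v k = 0.
  rewrite (bigD1 i) //= {1}/sg eqxx mulrBr mulVKf // (bigD1 i) //= opprD.
  rewrite addrA subrr add0r addrC.
  by rewrite (eq_bigr (fun j => a j * v j)) ?subrr // => j ne;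
    rewrite /sg (negbTE ne).
have sgid v : \sum_k a k * v k = 0 -> sg v =1 v.
  by move=> v0 j; rewrite /sg v0 mulr0 subr0; case: eqP => [->|].
have: mmap (@mpolyC n K) sp G * mmap (@mpolyC n K) sp H = 0.
  rewrite -rmorphM E; apply: mpoly_vanish => v.
  by rewrite cE mevalM meval_linf sgz mul0r.
move/eqP; rewrite mulf_eq0 => /orP[] /eqP Z; [left|right];
  apply: (linf_dvd ai) => v v0; rewrite -(meval_eq _ (sgid v v0)) -cE Z meval0
    //.
Qed.

End LinearForms.

Section Homogeneous.
Variables (K : fieldType) (n : nat).
Implicit Types (G L Q : {mpoly K[n]}).

(** Multiplication by [L] shifts homogeneous components by [k], so the component of [Q] of degree j
    is zero as soon as k + j differs from d. If d < k then [Q] is zero, and the truncated difference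
    is harmless. *)
Lemma dhomog_divl d k L Q : L != 0 -> L \is k.-homog -> L * Q \is d.-homog ->
  Q \is (d - k).-homog.
Proof.
move=> L0 Lh LQh; have piM e : pihomog mdeg (k + e) (L * Q) = L * pihomog mdeg e
  Q.
  have [N QN] : exists N, (msize Q <= N)%N by exists (msize Q).
  rewrite {1}(pihomog_partitionE QN) big_distrr raddf_sum /=.
  have comp j : pihomog mdeg (k + e) (L * pihomog mdeg j Q) =
      if (j == e :> nat) then L * pihomog mdeg e Q else 0.
    have Ljh : L * pihomog mdeg j Q \is (k + j).-homog by rewrite dhomogM
      ?pihomogP.
    case: eqP => [<-|/eqP ne]; first by rewrite pihomog_dE.
    by rewrite (@pihomog_ne0 _ _ _ (k + j)%N) // eqn_add2l.
  under eq_bigr do rewrite comp.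
  have [eN|Ne] := ltnP e N.
    rewrite (bigD1 (Ordinal eN)) //= eqxx big1 ?addr0 // => j ne.
    by case: eqP => // E; case/eqP: ne; apply: val_inj.
  rewrite big1 => [|j _]; last by case: eqP => // E;
    rewrite -E leqNgt ltn_ord in Ne.
  rewrite pihomogE big1_seq ?mulr0 // => m /andP[/eqP dm mQ].
  by have := leq_trans (msize_mdeg_lt mQ) QN; rewrite /= dm ltnNge Ne.
have [N QN] : exists N, (msize Q <= N)%N by exists (msize Q).
rewrite (pihomog_partitionE QN); apply: rpred_sum => j _.
have [->|ne] := eqVneq (nat_of_ord j) (d - k)%N; first exact: pihomogP.
have [lt|ge] := ltnP d k; last first.
  have dkj : d != (k + j)%N.
    by apply: contra ne => /eqP->; rewrite addKn.
  have := piM j; rewrite (@pihomog_ne0 _ _ _ d) // => /esym/eqP.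
  by rewrite mulf_eq0 (negbTE L0) => /eqP->; rewrite rpred0.
have := piM j; rewrite (@pihomog_ne0 _ _ _ d) //; last first.
  by rewrite ltn_eqF // (leq_trans lt) ?leq_addr.
by move=> /esym/eqP; rewrite mulf_eq0 (negbTE L0) => /eqP->; rewrite rpred0.
Qed.

Lemma euler_homog d G : G \is d.-homog -> \sum_i 'X_i * mderiv i G = d%:R *: G.
Proof.
move=> Gh; rewrite {2}(mpolyE G) scaler_sumr.
transitivity (\sum_(m <- msupp G) \sum_i (m i)%:R *: (G@_m *: 'X_[m])).
  rewrite exchange_big; apply: eq_bigr => i _ /=.
  rewrite {1}(mpolyE G) raddf_sum big_distrr; apply: eq_bigr => m _ /=.
  rewrite mderivZ mderivX -!scalerAr scalerA [in RHS]scalerA mulrC.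
  have [->|mi] := eqVneq (m i) 0%N; first by rewrite !mul0r !scale0r.
  by rewrite -mpolyXD addmC submK // lep1mP.
apply: eq_big_seq => m mG; rewrite -scaler_suml -natr_sum; congr (_%:R *: _).
by rewrite -mdegE (dhomog_mf Gh mG).
Qed.

Lemma meval_homog d G l v : G \is d.-homog ->
  G.@[fun i => l * v i] = l ^+ d * G.@[v].
Proof.
move=> Gh; rewrite !mevalE big_distrr /=; apply: eq_big_seq => m mG.
rewrite mulrCA; congr (_ * _); under eq_bigr do rewrite exprMn.
rewrite big_split /=; congr (_ * _).
by rewrite prodrXr -mdegE (dhomog_mf Gh mG).
Qed.

Lemma dhomog_mderiv d i G : G \is d.-homog -> mderiv i G \is d.-1.-homog.
Proof.
move=> Gh; apply/dhomogP => m; rewrite mcoeff_msupp mcoeff_deriv => nz.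
have : G@_(m + U_(i)) != 0 by apply: contra nz => /eqP->; rewrite mul0rn.
rewrite -mcoeff_msupp => /(dhomog_mf Gh) /=.
by rewrite mdegD mdeg1 addn1 => <-.
Qed.

End Homogeneous.

Lemma mderivXU (n : nat) (R : nzRingType) (i j : 'I_n) :
  mderiv i ('X_j : {mpoly R[n]}) = (i == j)%:R.
Proof.
rewrite mderivX mnm1E eq_sym; case: eqP => [->|_]; last by rewrite scale0r.
rewrite (_ : U_(j) - U_(j) = 0)%MM ?mpolyX0 ?scale1r //.
by apply/mnmP => l; rewrite mnmBE mnm0E subnn.
Qed.

Lemma mderiv_mmap (K : comNzRingType) (n k : nat) (h : 'I_n -> {mpoly K[k]}) j
    (G : {mpoly K[n]}) :
  mderiv j (mmap (@mpolyC k K) h G) =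
  \sum_i mmap (@mpolyC k K) h (mderiv i G) * mderiv j (h i).
Proof.
elim/mpoly_alg_ind: G => [c|i|p q Ep Eq|p q Ep Eq].
- rewrite mmapC mderivC big1 // => i _.
  by rewrite mderivC mmap0 mul0r.
- rewrite mmapX mmap1U (bigD1 i) //= mderivXU eqxx rmorph1 mul1r big1 ?addr0 //.
  by move=> l ne; rewrite mderivXU (negbTE ne) mmap0 mul0r.
- rewrite mmapD mderivD Ep Eq -big_split; apply: eq_bigr => l _ /=.
  by rewrite mderivD mmapD mulrDl.
rewrite rmorphM /= mderivM Ep Eq big_distrl big_distrr -big_split.
apply: eq_bigr => l _ /=; rewrite mderivM mmapD !rmorphM /=; ring.
Qed.

Definition pt2 (A : Type) (s t : A) (i : 'I_2) : A := if i == 0 then s else t.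

(** * Binary forms, resultants and discriminants *)

Section BinaryEval.
Variable A : comNzRingType.
Implicit Types (G H : {mpoly A[2]}).

Definition bev G (s t : A) : A := G.@[pt2 s t].

Lemma bevD G H s t : bev (G + H) s t = bev G s t + bev H s t.
Proof. exact: mevalD. Qed.
Lemma bevB G H s t : bev (G - H) s t = bev G s t - bev H s t.
Proof. exact: mevalB. Qed.
Lemma bevN G s t : bev (- G) s t = - bev G s t.
Proof. exact: mevalN. Qed.
Lemma bevM G H s t : bev (G * H) s t = bev G s t * bev H s t.
Proof. exact: mevalM. Qed.
Lemma bevZ c G s t : bev (c *: G) s t = c * bev G s t.
Proof. exact: mevalZ. Qed.
Lemma bev0 s t : bev 0 s t = 0.
Proof. exact: meval0. Qed.
Lemma bevX0 s t : bev 'X_0 s t = s.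
Proof. by rewrite /bev mevalXU. Qed.
Lemma bevX1 s t : bev 'X_1 s t = t.
Proof. by rewrite /bev mevalXU. Qed.
Lemma bevXn G s t n : bev (G ^+ n) s t = bev G s t ^+ n.
Proof. by rewrite /bev rmorphXn. Qed.
Lemma bev_sum (I : Type) (r : seq I) (P : pred I) (f : I -> {mpoly A[2]}) s t :
  bev (\sum_(i <- r | P i) f i) s t = \sum_(i <- r | P i) bev (f i) s t.
Proof. by rewrite /bev raddf_sum. Qed.
Lemma bev_prod (I : Type) (r : seq I) (P : pred I) (f : I -> {mpoly A[2]}) s t :
  bev (\prod_(i <- r | P i) f i) s t = \prod_(i <- r | P i) bev (f i) s t.
Proof. by rewrite /bev rmorph_prod. Qed.

Definition mnm2 (a b : nat) : 'X_{1..2} :=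
  [multinom (if (i : nat) == 0 then a else b) | i < 2].

Lemma mnm2E (m : 'X_{1..2}) : m = mnm2 (m 0) (m 1).
Proof.
by apply/mnmP => -[[|[|//]] ip]; rewrite mnmE /=; congr (m _); apply: val_inj.
Qed.

Lemma mdeg2 (m : 'X_{1..2}) : mdeg m = (m 0%R + m 1%R)%N.
Proof.
rewrite mdegE big_ord_recl big_ord1.
by congr (m _ + m _)%N; apply: val_inj.
Qed.

Lemma mnm2_0 a b : mnm2 a b 0 = a. Proof. by rewrite mnmE. Qed.
Lemma mnm2_1 a b : mnm2 a b 1 = b. Proof. by rewrite mnmE. Qed.

Lemma mpolyX2 (a b : nat) : 'X_[mnm2 a b] = 'X_0 ^+ a * 'X_1 ^+ b :> {mpoly
  A[2]}.
Proof.
rewrite mpolyXE_id big_ord_recl big_ord1 !mnmE.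
by congr ('X_ _ ^+ _ * 'X_ _ ^+ _); apply: val_inj.
Qed.

Lemma bformE n G : G \is n.-homog ->
  G = \sum_(k < n.+1) G@_(mnm2 (n - k) k) *: ('X_0 ^+ (n - k) * 'X_1 ^+ k).
Proof.
move=> Gh; apply/mpolyP => m; rewrite raddf_sum /=.
under eq_bigr do rewrite mcoeffZ -mpolyX2 mcoeffX.
have [dm|dm] := eqVneq (mdeg m) n; last first.
  rewrite (dhomog_nemf_coeff Gh dm) big1 // => k _.
  case: eqP => [E|]; last by rewrite mulr0.
  move: dm; rewrite -E mdeg2 mnm2_0 mnm2_1 subnK ?eqxx //.
  by rewrite -ltnS.
have mk : (m 1%R < n.+1)%N by rewrite -dm mdeg2 ltnS leq_addl.
have m0 : (n - m 1%R)%N = m 0%R by rewrite -dm mdeg2 addnK.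
rewrite (bigD1 (Ordinal mk)) //= m0 -mnm2E eqxx mulr1 big1 ?addr0 // => k ne.
case: eqP => [E|]; last by rewrite mulr0.
by case/eqP: ne; apply: val_inj; rewrite /= -E mnm2_1.
Qed.

Lemma bev_form n G s t : G \is n.-homog ->
  bev G s t = \sum_(k < n.+1) G@_(mnm2 (n - k) k) * (s ^+ (n - k) * t ^+ k).
Proof.
move=> Gh; rewrite {1}(bformE Gh) bev_sum; apply: eq_bigr => k _.
by rewrite bevZ bevM !bevXn bevX0 bevX1.
Qed.

Lemma bev_10 n G : G \is n.-homog -> bev G 1 0 = G@_(mnm2 n 0).
Proof.
move=> /(bev_form 1 0) ->; rewrite big_ord_recl expr1n mulr1 mulr1 subn0.
by rewrite big1 ?addr0 // => k _; rewrite expr0n /= !mulr0.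
Qed.

Lemma bev_01 n G : G \is n.-homog -> bev G 0 1 = G@_(mnm2 0 n).
Proof.
move=> /(bev_form 0 1) ->; rewrite big_ord_recr expr1n /= subnn !mulr1.
rewrite big1 ?add0r // => k _; rewrite expr0n subn_eq0 leqNgt ltn_ord /=.
by rewrite !(mul0r, mulr0).
Qed.

Lemma bev_scale n G l s t : G \is n.-homog ->
  bev G (l * s) (l * t) = l ^+ n * bev G s t.
Proof.
move=> Gh; rewrite !(bev_form _ _ Gh) big_distrr; apply: eq_bigr => k _ /=.
have -> : l ^+ n = l ^+ (n - k) * l ^+ k by rewrite -exprD subnK // -ltnS.
rewrite !exprMn; ring.
Qed.

(** The linear form with root (s : t). It depends on the representative, which keeps product
    formulas for resultants free of denominators. *)
Definition lin2 (s t : A) : {mpoly A[2]} := s *: 'X_1 - t *: 'X_0.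

Lemma bev_lin2 a b s t : bev (lin2 a b) s t = a * t - b * s.
Proof. by rewrite bevB !bevZ bevX0 bevX1. Qed.

Lemma lin2_homog a b : lin2 a b \is 1.-homog.
Proof. by apply: rpredB; apply: dhomogZ; rewrite dhomogX /= mdeg1. Qed.

Lemma prod_homog (I : Type) (r : seq I) (f : I -> {mpoly A[2]}) :
  (forall i, f i \is 1.-homog) -> \prod_(i <- r) f i \is (size r).-homog.
Proof.
move=> fh; elim: r => [|i r IH]; first by rewrite big_nil dhomog1.
by rewrite big_cons (@dhomogM _ _ _ 1).
Qed.

End BinaryEval.

Section BinaryMap.
Variables (A B : comNzRingType) (phi : {rmorphism A -> B}).

Lemma bev_map G s t :
  bev (map_mpoly phi G) (phi s) (phi t) = phi (bev G s t).
Proof.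
rewrite /bev /meval (rmorph_mmap phi) /map_mpoly (rmorph_mmap (mmap idfun _))
  /=.
apply: eq_mmap => [c|i] /=; first by rewrite mmapC.
by rewrite mmapX mmap1U /pt2; case: ifP.
Qed.

Lemma map_lin2 s t : map_mpoly phi (lin2 s t) = lin2 (phi s) (phi t).
Proof. by rewrite rmorphB /= !map_mpolyZ !map_mpolyX. Qed.

End BinaryMap.

Lemma form_resultant_map (A B : comUnitRingType) (phi : {rmorphism A -> B})
    m n G H :
  form_resultant m n (map_mpoly phi G) (map_mpoly phi H) =
  phi (form_resultant m n G H).
Proof.
rewrite /form_resultant -det_map_mx /form_sylvester map_col_mx; congr (\det _).
congr col_mx; apply/matrixP => i j; rewrite !mxE /bcoef mcoeff_map_mpoly;
  by case: ifP => // _; rewrite raddf0.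
Qed.

Lemma form_resultantZl (A : comUnitRingType) m n c (G H : {mpoly A[2]}) :
  form_resultant m n (c *: G) H = c ^+ n * form_resultant m n G H.
Proof.
have -> : form_resultant m n (c *: G) H =
    \det (block_mx (c%:M : 'M_n) 0 0 (1%:M : 'M_m) *m form_sylvester m n G H).
  rewrite /form_sylvester mul_block_col.
  rewrite !mul0mx addr0 add0r mul1mx mul_scalar_mx; congr (\det (col_mx _ _)).
  by apply/matrixP => i j; rewrite !mxE /bcoef mcoeffZ; case: ifP;
    rewrite ?mulr0.
by rewrite det_mulmx det_ublock det1 mulr1 det_scalar.
Qed.

Lemma form_resultantZr (A : comUnitRingType) m n c (G H : {mpoly A[2]}) :
  form_resultant m n G (c *: H) = c ^+ m * form_resultant m n G H.
Proof.
have -> : form_resultant m n G (c *: H) =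
    \det (block_mx (1%:M : 'M_n) 0 0 (c%:M : 'M_m) *m form_sylvester m n G H).
  rewrite /form_sylvester mul_block_col.
  rewrite !mul0mx addr0 add0r mul1mx mul_scalar_mx; congr (\det (col_mx _ _)).
  by apply/matrixP => i j; rewrite !mxE /bcoef mcoeffZ; case: ifP;
    rewrite ?mulr0.
by rewrite det_mulmx det_ublock det1 mul1r det_scalar.
Qed.

Lemma map_mderiv (A B : comNzRingType) (phi : {rmorphism A -> B}) n i
    (G : {mpoly A[n]}) :
  map_mpoly phi (mderiv i G) = mderiv i (map_mpoly phi G).
Proof.
apply/mpolyP => m; rewrite mcoeff_map_mpoly !mcoeff_deriv mcoeff_map_mpoly.
by rewrite raddfMn.
Qed.

(** The unit hypothesis concerns the normalizing factor of [form_disc]: the inverse of a non-unit is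
    a default value that [phi] need not preserve. *)
Lemma form_disc_map (A B : comUnitRingType) (phi : {rmorphism A -> B}) d G :
  (d ^ (d - 2))%:R \is a @GRing.unit A ->
  form_disc d (map_mpoly phi G) = phi (form_disc d G).
Proof.
move=> u; rewrite /form_disc !rmorphM /= rmorph_sign rmorphV // rmorph_nat.
by rewrite -form_resultant_map !map_mderiv.
Qed.

Lemma form_discZ (A : comUnitRingType) d c (G : {mpoly A[2]}) :
  form_disc d (c *: G) = c ^+ (d.-1 + d.-1) * form_disc d G.
Proof.
rewrite /form_disc !mderivZ form_resultantZl form_resultantZr exprD.
move: (_^-1) (form_resultant _ _ _ _) => x y; ring.
Qed.

(** A row of a Sylvester matrix against the column of powers of [r]: the row shifted by [i] gives
    r^i times the value of the form at (1 : r). *)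
Lemma shifted_sum (A : comNzRingType) (N i n : nat) (c : nat -> A) (r : A) :
  (i + n < N)%N ->
  \sum_(j < N) (if (i <= j <= i + n)%N then c (j - i)%N else 0) * r ^+ j =
  r ^+ i * \sum_(l < n.+1) c l * r ^+ l.
Proof.
move=> iN; pose F j := (if (i <= j <= i + n)%N then c (j - i)%N else 0) * r ^+
  j.
rewrite -(big_mkord xpredT F) (big_cat_nat (n := i)) //=; last first.
  by apply: leq_trans (ltnW iN); rewrite leq_addr.
rewrite big_nat big1 ?add0r; last first.
  by move=> j /andP[_ ji]; rewrite /F leqNgt ji mul0r.
rewrite (big_cat_nat (n := (i + n).+1)) //=; last by rewrite leqW ?leq_addr.
rewrite [X in _ + X]big_nat [X in _ + X]big1 ?addr0; last first.
  by move=> j /andP[ji _]; rewrite /F [X in _ && X]leqNgt ji andbF mul0r.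
rewrite -{1}(add0n i) big_addn -addnS [(i + _)%N]addnC addnK big_mkord
  big_distrr.
apply: eq_bigr => l _; rewrite /F leq_addl addnK [(l + i)%N]addnC leq_add2l
  -ltnS ltn_ord.
rewrite exprD /=; ring.
Qed.

(* Multiply the Sylvester matrix by the matrix whose last [m] columns evaluate
   at the roots of [G]: the result is block triangular. *)
Lemma resultant_split (K : fieldType) (m n : nat) (r : 'I_m -> K)
    (H : {mpoly K[2]}) :
  H \is n.-homog -> (forall k, r k != 0) -> injective r ->
  form_resultant m n (\prod_(k < m) lin2 1 (r k)) H =
  (-1) ^+ (m * n) * \prod_(k < m) bev H 1 (r k).
Proof.
move=> Hh r0 rinj; set G := \prod_(k < m) _.
have Gh : G \is m.-homog.
  have := prod_homog (enum 'I_m) (fun k => lin2_homog 1 (r k)).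
  by rewrite size_enum_ord big_enum.
pose E := \matrix_(j < n + m, k < m) r k ^+ j : 'M[K]_(n + m, m).
pose V : 'M[K]_(n + m) := row_mx (col_mx 1%:M 0) E.
pose rv := \row_k r k.
set S := form_sylvester m n G H.
pose S1 := usubmx S; pose S2 := dsubmx S.
have S1E : S1 *m E = 0.
  apply/matrixP => i k; rewrite !mxE.
  under eq_bigr do rewrite /S1 /S /form_sylvester col_mxKu !mxE.
  rewrite (shifted_sum (bcoef m G)); last by rewrite ltn_add2r.
  have := bev_form 1 (r k) Gh; rewrite /bcoef.
  under eq_bigr do rewrite expr1n mul1r.
  move=> <-; rewrite bev_prod (bigD1 k) //= bev_lin2 mul1r mulr1 subrr.
  by rewrite mul0r mulr0.
have S2E : S2 *m E = Vandermonde m rv *m diag_mx (\row_k bev H 1 (r k)).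
  apply/matrixP => i k; rewrite mul_mx_diag !mxE.
  under eq_bigr do rewrite /S2 /S /form_sylvester col_mxKd !mxE.
  rewrite (shifted_sum (bcoef n H)); last by rewrite addnC ltn_add2l.
  have := bev_form 1 (r k) Hh; rewrite /bcoef.
  under eq_bigr do rewrite expr1n mul1r.
  by move=> <-.
have dE : dsubmx E = Vandermonde m rv *m diag_mx (\row_k r k ^+ n).
  by apply/matrixP => i k; rewrite mul_mx_diag !mxE /= exprD mulrC.
have detV : \det V = \det (Vandermonde m rv) * \prod_k r k ^+ n.
  rewrite /V -{1}(vsubmxK E) -block_mxEh det_ublock det1 mul1r dE det_mulmx.
  by rewrite det_diag; congr (_ * _); apply: eq_bigr => k _; rewrite mxE.
have G0 : bcoef m G 0 = (-1) ^+ m * \prod_k r k.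
  rewrite /bcoef subn0 -(bev_10 Gh) bev_prod -[in (-1) ^+ m](card_ord m).
  rewrite -prodr_const -big_split; apply: eq_bigr => k _.
  by rewrite bev_lin2 mulr0 mulr1 sub0r /= mulN1r.
have detS1 : \det (usubmx (lsubmx S)) = (bcoef m G 0) ^+ n.
  have SE i j : usubmx (lsubmx S) i j =
      if (i <= j <= i + m)%N then bcoef m G (j - i) else 0.
    by rewrite 2!mxE /S /form_sylvester col_mxEu mxE.
  rewrite -det_tr det_trig.
    rewrite (eq_bigr (fun=> bcoef m G 0)) ?prodr_const ?card_ord // => i _.
    by rewrite mxE SE leqnn leq_addr subnn.
  by apply/is_trig_mxP => i j ij; rewrite mxE SE leqNgt ij.
have detSV : \det S * \det V = \det (usubmx (lsubmx S)) * \det (S2 *m E).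
  have SU : S *m col_mx 1%:M 0 = col_mx (usubmx (lsubmx S)) (dsubmx (lsubmx S)).
    by rewrite vsubmxK -{1}(hsubmxK S) mul_row_col mulmx1 mulmx0 addr0.
  have SE : S *m E = col_mx 0 (S2 *m E).
    by rewrite -S1E -mul_col_mx vsubmxK.
  by rewrite -det_mulmx /V mul_mx_row SU SE -block_mxEh det_lblock.
have Vn0 : \det (Vandermonde m rv) != 0.
  rewrite det_Vandermonde; apply/prodf_neq0 => i _; apply/prodf_neq0 => j ij.
  by rewrite subr_eq0 !mxE (inj_eq rinj) neq_ltn ij orbT.
have rn0 : \prod_k r k ^+ n != 0 by apply/prodf_neq0 => k _; rewrite expf_neq0.
apply: (mulIf (mulf_neq0 Vn0 rn0)); rewrite -detV detSV detS1 G0 S2E.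
rewrite det_mulmx det_diag exprMn -exprM detV prodrXl -prodrXl.
under [\prod_(i < m) (\row_k _) 0 i]eq_bigr do rewrite mxE.
rewrite prodrXl; ring.
Qed.

(** Both sides are polynomial in the roots, so zero or repeated slopes are handled by deformation.
    Over K[X] the roots move to general position, the identity holds wherever [q] does not vanish,
    hence identically in X, and X = 0 restores the given roots. *)
Lemma resultant_prod (K : numFieldType) (m n : nat) (s t : 'I_m -> K)
    (H : {mpoly K[2]}) :
  H \is n.-homog ->
  form_resultant m n (\prod_(k < m) lin2 (s k) (t k)) H =
  (-1) ^+ (m * n) * \prod_(k < m) bev H (s k) (t k).
Proof.
move=> Hh.
(* The speeds (1, k + 1) are pairwise non-proportional: the minor of two deformed roots has
   X^2-coefficient l - k, so [q] is nonzero even when the given roots coincide or are zero. *)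
pose sP (k : 'I_m) : {poly K} := (s k)%:P + 'X.
pose tP (k : 'I_m) : {poly K} := (t k)%:P + (k.+1)%:R *: 'X.
have sPE e k : (sP k).[e] = s k + e by rewrite /sP !hornerE.
have tPE e k : (tP k).[e] = t k + k.+1%:R * e by rewrite /tP !hornerE.
pose q : {poly K} := (\prod_k (sP k * tP k)) *
  \prod_k \prod_(l | l != k) (sP k * tP l - sP l * tP k).
have q0 : q != 0.
  have sz0 (p : {poly K}) i : p`_i != 0 -> p != 0.
    by apply: contra => /eqP ->; rewrite coef0.
  rewrite mulf_neq0 //; apply/prodf_neq0 => k _; first rewrite mulf_neq0 //.
  - by apply: (sz0 _ 1%N); rewrite coefD coefC coefX add0r oner_eq0.
  - by apply: (sz0 _ 1%N); rewrite coefD coefC coefZ coefX add0r mulr1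
    pnatr_eq0.
  apply/prodf_neq0 => l lk; apply: (sz0 _ 2%N).
  rewrite /sP /tP; set a := s k; set b := s l; set c := t k; set d := t l.
  rewrite (_ : _ - _ = (a * d - b * c)%:P +
     (a * l.+1%:R + d - b * k.+1%:R - c) *: 'X +
     (l.+1%:R - k.+1%:R) *: 'X^2); last first.
    rewrite -!mul_polyC !(polyCD, polyCB, polyCM, polyCN); ring.
  rewrite !coefD coefC !coefZ coefX coefXn !mulr0 !add0r mulr1 subr_eq0 eqr_nat.
  by rewrite eqSS; apply: contra lk => /eqP/val_inj->.
pose GP := \prod_(k < m) lin2 (sP k) (tP k).
pose HP := map_mpoly (@polyC K) H.
pose P := form_resultant m n GP HP -
   (-1) ^+ (m * n) * \prod_(k < m) bev HP (sP k) (tP k).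
have HE e : map_mpoly (horner_eval e) HP = H.
  apply/mpolyP => mm; rewrite !mcoeff_map_mpoly /=.
  by rewrite /horner_eval hornerC.
have GE e : map_mpoly (horner_eval e) GP = \prod_k lin2 (sP k).[e] (tP k).[e].
  rewrite rmorph_prod; apply: eq_bigr => k _; exact: map_lin2.
have PE e : P.[e] =
    form_resultant m n (\prod_(k < m) lin2 (sP k).[e] (tP k).[e]) H -
    (-1) ^+ (m * n) * \prod_(k < m) bev H (sP k).[e] (tP k).[e].
  rewrite /P -/(horner_eval e _) rmorphB -form_resultant_map HE GE rmorphM.
  rewrite rmorph_sign rmorph_prod; congr (_ - _ * _).
  by apply: eq_bigr => k _; rewrite -bev_map HE.
suff P0 : P = 0.
  have := PE 0; rewrite P0 horner0 => /esym/eqP; rewrite subr_eq0 => /eqP.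
  have s0 k : (sP k).[0] = s k by rewrite sPE addr0.
  have t0 k : (tP k).[0] = t k by rewrite tPE mulr0 addr0.
  by under eq_bigr do rewrite s0 t0; under [in RHS]eq_bigr do rewrite s0 t0.
suff: P * q = 0 by move/eqP; rewrite mulf_eq0 (negbTE q0) orbF => /eqP.
apply: poly_vanish => e; rewrite hornerM.
have [->|] := eqVneq q.[e] 0; first by rewrite mulr0.
rewrite hornerM mulf_eq0 !horner_prod => /norP[/prodf_neq0 n1 /prodf_neq0 n2].
suff -> : P.[e] = 0 by rewrite mul0r.
have {}n1 k : (sP k).[e] != 0 /\ (tP k).[e] != 0.
  by have := n1 k isT; rewrite hornerM mulf_eq0 => /norP.
rewrite PE; apply/eqP; rewrite subr_eq0; apply/eqP.
set x := fun k => (sP k).[e]; set y := fun k => (tP k).[e].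
have xn0 k : x k != 0 by case: (n1 k).
have yn0 k : y k != 0 by case: (n1 k).
pose r k := y k / x k.
have linE k : lin2 (x k) (y k) = x k *: lin2 1 (r k).
  by rewrite /lin2 scalerBr !scalerA mulr1 mulrCA divff // mulr1.
rewrite (eq_bigr (fun k => x k *: lin2 1 (r k))) => [|k _]; last exact: linE.
rewrite scaler_prod form_resultantZl resultant_split //.
- rewrite mulrCA -prodrXl -big_split; congr (_ * _); apply: eq_bigr => k _ /=.
  by rewrite -(bev_scale _ _ _ Hh) mulr1 mulrCA divff ?mulr1.
- by move=> k; rewrite mulf_neq0 // invr_neq0.
move=> k l /eqP; rewrite eqr_div // => /eqP E; apply/eqP; apply: contraT => kl.
have := n2 k isT; rewrite horner_prod => /prodf_neq0/(_ l); rewrite eq_sym kl.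
move=> /(_ isT); rewrite hornerD hornerN !hornerM -/(x k) -/(y k) -/(x l) -/(y
  l).
by rewrite [x k * _]mulrC -E mulrC subrr eqxx.
Qed.

Lemma prodM_size (A : comNzRingType) (I : Type) (r : seq I) (c : A) (f : I -> A)
  :
  \prod_(i <- r) (c * f i) = c ^+ size r * \prod_(i <- r) f i.
Proof.
elim: r => [|i r IH]; first by rewrite !big_nil mulr1.
by rewrite !big_cons IH /= exprS; ring.
Qed.

(** * Points of the projective line and roots of binary forms *)

(* The point [Some t] of the projective line is (1 : t), and [None] is (0 : 1). *)
Section ProjectiveLine.
Variable K : fieldType.
Implicit Types (o : option K) (G H : {mpoly K[2]}).

Definition px o : K := if o is Some _ then 1 else 0.
Definition py o : K := if o is Some t then t else 1.
Definition evo G o : K := bev G (px o) (py o).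
Definition lf o : {mpoly K[2]} := lin2 (px o) (py o).

Lemma lf_homog o : lf o \is 1.-homog. Proof. exact: lin2_homog. Qed.

Lemma evo_lf o w : evo (lf o) w = px o * py w - py o * px w.
Proof. exact: bev_lin2. Qed.

Lemma evo_lf_eq0 o w : (evo (lf o) w == 0) = (o == w).
Proof.
rewrite evo_lf; case: o w => [t|] [w|] /=; rewrite ?(mul1r, mulr1, mul0r,
  mulr0).
- by rewrite subr_eq0 eq_sym.
- by rewrite subr0 oner_eq0.
- by rewrite sub0r oppr_eq0 oner_eq0.
by rewrite subrr !eqxx.
Qed.

Lemma evo_lf_anti o w : evo (lf o) w = - evo (lf w) o.
Proof. by rewrite !evo_lf; ring. Qed.

Lemma lf_neq0 o : lf o != 0.
Proof.
pose w : option K := if o is Some _ then None else Some 0.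
have : evo (lf o) w != 0 by rewrite evo_lf_eq0 /w; case: (o).
by apply: contra => /eqP->; rewrite /evo bev0.
Qed.

Lemma px_py_neq0 o : (px o != 0) || (py o != 0).
Proof. by case: o => [t|] /=; rewrite oner_eq0 ?orbT. Qed.

Lemma point_of s t : (s != 0) || (t != 0) ->
  exists o l, [/\ l != 0, s = l * px o & t = l * py o].
Proof.
have [->|s0] := eqVneq s 0 => /=.
  by move=> t0; exists None, t; rewrite mulr0 mulr1.
by exists (Some (t / s)), s; rewrite mulr1 mulrCA divff // mulr1.
Qed.

Lemma evoD G H o : evo (G + H) o = evo G o + evo H o. Proof. exact: bevD. Qed.
Lemma evoB G H o : evo (G - H) o = evo G o - evo H o. Proof. exact: bevB. Qed.
Lemma evoM G H o : evo (G * H) o = evo G o * evo H o. Proof. exact: bevM. Qed.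
Lemma evoZ c G o : evo (c *: G) o = c * evo G o. Proof. exact: bevZ. Qed.
Lemma evo0 o : evo 0 o = 0. Proof. exact: bev0. Qed.
Lemma evo_sum (I : Type) (r : seq I) (P : pred I) (f : I -> {mpoly K[2]}) o :
  evo (\sum_(i <- r | P i) f i) o = \sum_(i <- r | P i) evo (f i) o.
Proof. exact: bev_sum. Qed.
Lemma evo_prod (I : Type) (r : seq I) (P : pred I) (f : I -> {mpoly K[2]}) o :
  evo (\prod_(i <- r | P i) f i) o = \prod_(i <- r | P i) evo (f i) o.
Proof. exact: bev_prod. Qed.

Lemma prod_lf_homog ys : \prod_(y <- ys) lf y \is (size ys).-homog.
Proof. exact: prod_homog lf_homog. Qed.

Lemma prod_lf_neq0 ys : \prod_(y <- ys) lf y != 0.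
Proof. by rewrite prodf_seq_neq0; apply/allP => y _; rewrite lf_neq0. Qed.

Lemma evo_prod_lf ys o : (evo (\prod_(y <- ys) lf y) o == 0) = (o \in ys).
Proof.
rewrite evo_prod; elim: ys => [|y ys IH].
  by rewrite big_nil oner_eq0.
by rewrite big_cons mulf_eq0 IH evo_lf_eq0 inE eq_sym.
Qed.

End ProjectiveLine.

Section Roots.
Variable K : numClosedFieldType.
Implicit Types (o : option K) (G H a b : {mpoly K[2]}).

Lemma bev_vanish G : (forall s t, bev G s t = 0) -> G = 0.
Proof.
move=> G0; apply: mpoly_vanish => v; rewrite -[RHS](G0 (v 0) (v 1)).
by apply: meval_eq => -[[|[|//]] ip]; congr (v _); apply: val_inj.
Qed.

Lemma form_dvd_lf n G o : G \is n.-homog -> evo G o = 0 ->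
  exists2 Q, G = lf o * Q & Q \is n.-1.-homog.
Proof.
move=> Gh G0.
pose c (i : 'I_2) : K := if i == 0 then - py o else px o.
have lfE : lf o = linf c.
  have o1 : fintype.lift ord0 (ord0 : 'I_1) = 1 :> 'I_2 by apply: val_inj.
  by rewrite /linf big_ord_recl big_ord1 o1 /c /= scaleNr addrC.
have [i ci] : exists i, c i != 0.
  by case/orP: (px_py_neq0 o) => H; [exists 1|exists 0];
    rewrite /c //= oppr_eq0.
have [|Q GQ] := linf_dvd (G := G) ci.
  move=> v; rewrite -meval_linf -lfE => lv0.
  have -> : G.@[v] = bev G (v 0) (v 1).
    by apply: meval_eq => -[[|[|//]] ip]; congr (v _); apply: val_inj.
  have : bev (lf o) (v 0) (v 1) = 0.
    by rewrite -lv0; apply: meval_eq => -[[|[|//]] ip]; congr (v _);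
      apply: val_inj.
  rewrite bev_lin2 => /eqP; rewrite subr_eq0 => /eqP E.
  have [l -> ->] : exists2 l, v 0 = l * px o & v 1 = l * py o.
    case: (o) E => [t|] /=; rewrite ?(mul1r, mul0r).
      by move=> ->; exists (v 0); rewrite ?mulr1 // mulrC.
    by move=> <-; exists (v 1); rewrite ?mulr0 ?mulr1.
  by rewrite (bev_scale _ _ _ Gh) -/(evo G o) G0 mulr0.
exists Q; first by rewrite lfE.
by rewrite -subn1; apply: dhomog_divl (lf_neq0 o) (lf_homog o) _;
  rewrite lfE -GQ.
Qed.

Lemma form_root n G : (0 < n)%N -> G \is n.-homog -> exists o, evo G o = 0.
Proof.
move=> n0 Gh; have [E|N] := eqVneq (bev G 0 1) 0; first by exists None.
pose p := \poly_(k < n.+1) G@_(mnm2 (n - k) k).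
have pn : p`_n != 0 by rewrite coef_poly ltnSn subnn -bev_01.
have szp : size p = n.+1.
  apply/eqP; rewrite eqn_leq size_poly ltnNge; apply/negP => sz.
  by rewrite (nth_default _ sz) eqxx in pn.
have [|x /rootP px0] := closed_rootP p _; first by rewrite szp eqSS -lt0n.
exists (Some x); rewrite /evo /= (bev_form _ _ Gh) -[RHS]px0 horner_poly.
by apply: eq_bigr => k _; rewrite expr1n mul1r.
Qed.

Lemma form_roots n G : G \is n.-homog -> G != 0 ->
  exists c ys, [/\ c != 0, size ys = n & G = c *: \prod_(y <- ys) lf y].
Proof.
elim: n G => [|n IH] G Gh G0.
  exists (G@_(mnm2 0 0)), [::]; split=> //.
    apply: contra G0 => /eqP E; rewrite (bformE Gh) big_ord1 /=.
    by rewrite subnn E scale0r.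
  by rewrite big_nil {1}(bformE Gh) big_ord1 subnn !expr0 mulr1.
have [o o0] := form_root (ltn0Sn n) Gh.
have [Q GQ Qh] := form_dvd_lf Gh o0.
have Q0 : Q != 0 by apply: contra G0; rewrite GQ => /eqP->; rewrite mulr0.
have [c [ys [c0 szy QE]]] := IH _ Qh Q0.
exists c, (o :: ys); split=> //=; first by rewrite szy.
by rewrite big_cons GQ QE -scalerAr.
Qed.

Lemma form_vanish n G (s : seq (option K)) : G \is n.-homog ->
  (forall o, o \notin s -> evo G o = 0) -> G = 0.
Proof.
move=> Gh van; apply/eqP; apply: contraT => G0.
have [c [ys [c0 _ GE]]] := form_roots Gh G0.
have [x] := exists_notin (pmap id (s ++ ys)).
have memE (r : seq (option K)) : (x \in pmap id r) = (Some x \in r).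
  elim: r => //= -[a|] r IH; rewrite /= !inE ?IH //.
rewrite memE mem_cat negb_or => /andP[xs xy].
by have /eqP := van _ xs; rewrite GE evoZ mulf_eq0 (negbTE c0) evo_prod_lf
  (negbTE xy).
Qed.

Lemma resultant_forms m n c ys H : size ys = m -> H \is n.-homog ->
  form_resultant m n (c *: \prod_(y <- ys) lf y) H =
  (-1) ^+ (m * n) * (c ^+ n * \prod_(y <- ys) evo H y).
Proof.
move=> <- Hh; rewrite form_resultantZl (big_nth None) big_mkord.
rewrite (@resultant_prod _ _ _ (fun k => px (nth None ys k)) (fun k =>
  py (nth None ys k))) //.
by rewrite [in RHS](big_nth None) big_mkord mulrCA.
Qed.

(** The resultant of G and H, computed from the roots of either form. Each side is a product over
    all pairs of roots, and [evo (lf z) y] changes sign when y and z are exchanged. *)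
Lemma evo_swap c e (ys zs : seq (option K)) :
  let G := c *: \prod_(y <- ys) lf y in let H := e *: \prod_(z <- zs) lf z in
  c ^+ size zs * \prod_(y <- ys) evo H y =
  (-1) ^+ (size ys * size zs) * (e ^+ size ys * \prod_(z <- zs) evo G z).
Proof.
move=> G H.
rewrite (eq_bigr (fun y => e * \prod_(z <- zs) evo (lf z) y)); last first.
  by move=> y _; rewrite evoZ evo_prod.
rewrite [in RHS](eq_bigr (fun z => c * \prod_(y <- ys) evo (lf y) z));
  last first.
  by move=> z _; rewrite evoZ evo_prod.
rewrite !prodM_size exchange_big /=.
have -> : \prod_(z <- zs) \prod_(y <- ys) evo (lf z) y =
   (-1) ^+ (size ys * size zs) * \prod_(z <- zs) \prod_(y <- ys) evo (lf y) z.
  rewrite exprM -prodM_size; apply: eq_bigr => z _.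
  rewrite -prodM_size; apply: eq_bigr => y _.
  by rewrite evo_lf_anti mulN1r.
ring.
Qed.

End Roots.

Definition jac (A : comNzRingType) (a b : {mpoly A[2]}) : {mpoly A[2]} :=
  mderiv 0 a * mderiv 1 b - mderiv 1 a * mderiv 0 b.

(** * Discriminants along a pencil *)

Section Jacobian.
Variable K : numClosedFieldType.
Implicit Types (o : option K) (G H a b : {mpoly K[2]}).

Lemma jac_homog d a b : a \is d.-homog -> b \is d.-homog ->
  jac a b \is (d.-1 + d.-1).-homog.
Proof. by move=> ah bh; rewrite rpredB // dhomogM // dhomog_mderiv. Qed.

Lemma jacDl a b e : jac (a + e *: b) b = jac a b.
Proof. by rewrite /jac !mderivD !mderivZ -!mul_mpolyC; ring. Qed.

Lemma euler2 d G : G \is d.-homog ->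
  'X_0 * mderiv 0 G + 'X_1 * mderiv 1 G = d%:R *: G.
Proof.
move=> Gh; rewrite -(euler_homog Gh) big_ord_recl big_ord1.
by congr ('X_ _ * mderiv _ _ + 'X_ _ * mderiv _ _); apply: val_inj.
Qed.

Lemma euler_bev d G s t : G \is d.-homog ->
  s * bev (mderiv 0 G) s t + t * bev (mderiv 1 G) s t = d%:R * bev G s t.
Proof.
move=> Gh; have := congr1 (fun p => bev p s t) (euler2 Gh).
by rewrite /= bevD !bevM bevX0 bevX1 bevZ.
Qed.

Lemma euler_evo d G o : G \is d.-homog ->
  px o * evo (mderiv 0 G) o + py o * evo (mderiv 1 G) o = d%:R * evo G o.
Proof. exact: euler_bev. Qed.

Lemma evo_grad_root d G o : G \is d.-homog -> evo G o = 0 ->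
  exists nu, evo (mderiv 0 G) o = - nu * py o /\ evo (mderiv 1 G) o = nu * px o.
Proof.
move=> Gh G0; have := euler_evo o Gh; rewrite G0 mulr0.
case: o G0 => [t|] G0 /=.
  move=> /eqP; rewrite mul1r addr_eq0 => /eqP E.
  by exists (evo (mderiv 1 G) (Some t)); rewrite mulr1 E mulrC mulNr.
rewrite mul0r add0r mul1r => ->.
by exists (- evo (mderiv 0 G) None); rewrite opprK mulr1 mulr0.
Qed.

Lemma evo_jac_root d G b o : G \is d.-homog -> b \is d.-homog -> evo G o = 0 ->
  exists nu, [/\ evo (mderiv 0 G) o = - nu * py o,
    evo (mderiv 1 G) o = nu * px o & evo (jac G b) o = - d%:R * nu * evo b o].
Proof.
move=> Gh bh /(evo_grad_root Gh) [nu [E0 E1]]; exists nu; split=> //.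
rewrite /jac evoB !evoM E0 E1.
have -> : - d%:R * nu * evo b o = - nu * (d%:R * evo b o) by ring.
by rewrite -(euler_evo o bh); ring.
Qed.

(** At a root y of G, Euler's identity forces the gradient to be nu(y) (-py, px), whence Jac(G,
    b)(y) = - d nu(y) b(y). The product of the nu(y) is in turn the resultant of the two partial
    derivatives, up to a constant and a power of [c]. The condition G(1, 0) != 0 keeps the first
    derivative nonzero, since its value at (1, 0) is d G(1, 0). *)
Lemma disc_jac_roots d : (2 <= d)%N -> exists2 kap : K, kap != 0 &
  forall G b c ys, G \is d.-homog -> b \is d.-homog -> c != 0 ->
    G = c *: \prod_(y <- ys) lf y -> bev G 1 0 != 0 ->
    form_disc d G * (c ^+ d * \prod_(y <- ys) evo b y) =
    kap * (c ^+ (d.-1 + d.-1) * \prod_(y <- ys) evo (jac G b) y).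
Proof.
move=> d2; have d0 : d%:R != 0 :> K by rewrite pnatr_eq0 -lt0n (leq_trans _ d2).
pose s0 : K := (-1) ^+ 'C(d, 2); pose s1 : K := (-1) ^+ (d.-1 * d.-1).
pose s2 : K := (-1) ^+ (d * d.-1); pose s3 : K := (-1) ^+ d.-1.
pose D : K := (d ^ (d - 2))%:R; pose Dd : K := d%:R ^+ d.-1.
pose D' : K := (- d%:R) ^+ d.
have D0 : D != 0 by rewrite pnatr_eq0 expn_eq0 negb_and -lt0n (leq_trans _ d2).
have Dd0 : Dd != 0 by rewrite expf_neq0.
have D'0 : D' != 0 by rewrite expf_neq0 // oppr_eq0.
exists (s0 * D^-1 * (s1 * s2 * s3) * Dd / (d%:R * D')).
  by rewrite !mulf_neq0 ?invr_neq0 ?mulf_neq0 ?signr_eq0.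
move=> G b c ys Gh bh c0 GE g0.
have szy : size ys = d.
  have nz : G != 0 by apply: contra g0 => /eqP->; rewrite bev0.
  by apply: (dhomog_uniq nz _ Gh); rewrite GE dhomogZ // prod_lf_homog.
set G0 := mderiv 0 G; set G1 := mderiv 1 G; set g := bev G 1 0 in g0.
have G0h : G0 \is d.-1.-homog by apply: dhomog_mderiv.
have G1h : G1 \is d.-1.-homog by apply: dhomog_mderiv.
have G010 : bev G0 1 0 = d%:R * g.
  by have := euler_bev 1 0 Gh; rewrite mul1r mul0r addr0.
have [|c0' [zs [cz szz G0E]]] := form_roots G0h.
  by apply: contraTneq g0 => E; move: G010; rewrite E bev0 => /esym/eqP;
     rewrite mulf_eq0 (negbTE d0) negbK.
have bev10 (l : seq (option K)) :
    bev (\prod_(y <- l) lf y) 1 0 = \prod_(y <- l) (-1 * py y).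
  by rewrite bev_prod; apply: eq_bigr => y _; rewrite bev_lin2; ring.
have root y : y \in ys -> evo G y = 0.
  by move=> yys; apply/eqP; rewrite GE evoZ mulf_eq0 (negbTE c0) evo_prod_lf.
(* [nu] is read off from the coordinate of the root that equals 1: px for [Some _], py for
   [None]. *)
pose nu y := if y is Some _ then evo G1 y else - evo G0 y.
have nuP y : y \in ys -> [/\ evo G0 y = nu y * (-1 * py y) &
    evo (jac G b) y = - d%:R * (nu y * evo b y)].
  move=> /root r; have [m [E0 E1 E2]] := evo_jac_root Gh bh r.
  have -> : nu y = m.
    rewrite /nu; case: (y) E0 E1 => [t|] /= E0 E1; first by rewrite -/G1 in E1;
      rewrite E1 mulr1.
    by rewrite -/G0 in E0; rewrite E0 mulr1 opprK.
  by split; rewrite ?E2 ?mulrA // -/G0 in E0 *; rewrite E0; ring.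
set N := \prod_(y <- ys) nu y; set B := \prod_(y <- ys) evo b y.
have EW : \prod_(y <- ys) evo (jac G b) y = D' * (N * B).
  rewrite (eq_big_seq (fun y => - d%:R * (nu y * evo b y))); last first.
    by move=> y /nuP[].
  by rewrite prodM_size szy big_split.
have EG0 : \prod_(y <- ys) evo G0 y = N * \prod_(y <- ys) (-1 * py y).
  by rewrite -big_split; apply: eq_big_seq => y /nuP[].
have EG : g = c * \prod_(y <- ys) (-1 * py y) by rewrite -bev10 -bevZ -GE.
have EG0' : d%:R * g = c0' * (s3 * \prod_(z <- zs) py z).
  by rewrite -G010 {1}G0E bevZ bev10 prodM_size szz.
have ER : form_resultant d.-1 d.-1 G0 G1 =
    s1 * (c0' ^+ d.-1 * \prod_(z <- zs) evo G1 z).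
  by rewrite {1}G0E (resultant_forms _ szz G1h).
have E1 : \prod_(z <- zs) py z * \prod_(z <- zs) evo G1 z =
    Dd * \prod_(z <- zs) evo G z.
  rewrite -big_split /Dd -szz -prodM_size; apply: eq_big_seq => z zz /=.
  rewrite -(euler_evo z Gh) -/G0 (_ : evo G0 z = 0) ?mulr0 ?add0r //.
  by apply/eqP; rewrite G0E evoZ mulf_eq0 evo_prod_lf zz orbT.
have E2 : c ^+ d.-1 * \prod_(y <- ys) evo G0 y =
    s2 * (c0' ^+ d * \prod_(z <- zs) evo G z).
  by have := evo_swap c c0' ys zs; rewrite /= -GE -G0E szy szz.
have s22 : s2 * s2 = 1 by rewrite -expr2 sqrr_sign.
have dE : c0' ^+ d = c0' ^+ d.-1 * c0'.
  by rewrite -exprSr prednK // (leq_trans _ d2).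
have cE : c ^+ d = c ^+ d.-1 * c.
  by rewrite -exprSr prednK // (leq_trans _ d2).
set R := form_resultant _ _ _ _ in ER.
(* After multiplication by g = G(1, 0), the left side contains d g = G_0(1, 0), a multiple of the
   product of the py z. Euler at the roots z of G_0 gives py z G_1(z) = d G(z), and [evo_swap]
   carries the product of the G(z) to the roots of G. *)
have main : R * d%:R * c = s1 * s2 * s3 * Dd * c ^+ d.-1 * N.
  apply: (mulIf g0).
  transitivity (R * (d%:R * g) * c); first by ring.
  rewrite EG0' ER.
  transitivity (s1 * s3 * (c0' ^+ d.-1 * c0') * c *
     (\prod_(z <- zs) py z * \prod_(z <- zs) evo G1 z)); first by ring.
  rewrite E1 -dE.
  transitivity (s1 * s3 * Dd * c * s2 *
     (s2 * (c0' ^+ d * \prod_(z <- zs) evo G z))).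
    transitivity (s1 * s3 * (c0' ^+ d) * c * (Dd * \prod_(z <- zs) evo G z) *
      (s2 * s2)).
      by rewrite s22 mulr1.
    by ring.
  by rewrite -E2 EG0 EG; ring.
rewrite EW /form_disc -/G0 -/G1 -/R -/s0 -/D cE exprD -/B.
have -> : R = s1 * s2 * s3 * Dd * c ^+ d.-1 * N / (d%:R * c).
  by apply: (canRL (mulfK _)); rewrite ?mulf_neq0 // mulrA.
by field; apply/and4P.
Qed.

Lemma form_disc_pencil_poly d a b : (0 < d)%N ->
  exists p : {poly K}, forall e, p.[e] = form_disc d (a + e *: b).
Proof.
move=> d0; pose aP := map_mpoly (@polyC K) a; pose bP := map_mpoly (@polyC K) b.
exists (form_disc d (aP + 'X *: bP)) => e.
have HE (H : {mpoly K[2]}) :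
    map_mpoly (horner_eval e) (map_mpoly (@polyC K) H) = H.
  apply/mpolyP => mm; rewrite !mcoeff_map_mpoly /=.
  by rewrite /horner_eval hornerC.
have GE : map_mpoly (horner_eval e) (aP + 'X *: bP) = a + e *: b.
  rewrite rmorphD /= map_mpolyZ !HE; congr (_ + _ *: _).
  exact: hornerX.
rewrite -/(horner_eval e _) -form_disc_map ?GE //.
by rewrite -polyC_natr poly_unitE size_polyC coefC eqxx pnatr_eq0 expn_eq0
   unitfE pnatr_eq0 expn_eq0 (gtn_eqF d0).
Qed.

(* By [evo_swap], the factor [prod b(y_k)] of [disc_jac_roots] does not depend
   on the member [a + e b] of the pencil, and [prod W(y_k)] is, up to a
   constant, the product of the values of [a + e b] at the roots of [W]. *)
Lemma disc_pencil d a b cw (ws : seq (option K)) : (2 <= d)%N ->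
  a \is d.-homog -> b \is d.-homog -> (forall o, evo a o = 0 -> evo b o != 0) ->
  jac a b = cw *: \prod_(w <- ws) lf w -> cw != 0 ->
  exists2 C, C != 0 & forall e,
    form_disc d (a + e *: b) = C * \prod_(w <- ws) (evo a w + e * evo b w).
Proof.
move=> d2 ah bh cop WE cw0.
have W0 : jac a b != 0 by rewrite WE scaler_eq0 negb_or cw0 prod_lf_neq0.
have szw : size ws = (d.-1 + d.-1)%N.
  apply: (dhomog_uniq W0 _ (jac_homog ah bh)).
  by rewrite WE dhomogZ // prod_lf_homog.
have b0 : b != 0.
  have [o o0] := form_root (ltnW d2) ah.
  by apply: contra (cop _ o0) => /eqP->; rewrite evo0.
have [cb [zs [cb0 szz bE]]] := form_roots bh b0.
have [kap kap0 disc] := disc_jac_roots d2.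
pose N := \prod_(z <- zs) evo a z.
have N0 : N != 0.
  rewrite prodf_seq_neq0; apply/allP => z zz; apply: contraTN isT => /eqP/cop.
  by rewrite bE evoZ mulf_eq0 evo_prod_lf zz orbT.
pose S : K := (-1) ^+ (d * d); pose S' : K := (-1) ^+ (d * (d.-1 + d.-1)).
exists (kap * S' * cw ^+ d / (S * cb ^+ d * N)).
  by rewrite !mulf_neq0 ?invr_neq0 ?mulf_neq0 ?signr_eq0 ?expf_neq0 ?kap0.
set C := _ / _.
have main e : bev a 1 0 + e * bev b 1 0 != 0 ->
    form_disc d (a + e *: b) = C * \prod_(w <- ws) (evo a w + e * evo b w).
  move=> g0; set G := a + e *: b.
  have Gh : G \is d.-homog by rewrite rpredD // dhomogZ.
  have G10 : bev G 1 0 != 0 by rewrite bevD bevZ.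
  have [|c [ys [c0 szy GE]]] := form_roots Gh.
    by apply: contra G10 => /eqP->; rewrite bev0.
  have E1 : c ^+ d * \prod_(y <- ys) evo b y = S * (cb ^+ d * N).
    have := evo_swap c cb ys zs; rewrite /= -GE -bE szy szz => ->.
    congr (_ * (_ * _)); apply: eq_big_seq => z zz.
    rewrite evoD evoZ (_ : evo b z = 0) ?mulr0 ?addr0 //.
    by apply/eqP; rewrite bE evoZ mulf_eq0 evo_prod_lf zz orbT.
  have E2 : c ^+ (d.-1 + d.-1) * \prod_(y <- ys) evo (jac G b) y =
      S' * (cw ^+ d * \prod_(w <- ws) (evo a w + e * evo b w)).
    have := evo_swap c cw ys ws; rewrite /= -GE -WE szy szw jacDl => ->.
    by congr (_ * (_ * _)); apply: eq_bigr => w _; rewrite evoD evoZ.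
  have := disc G b c ys Gh bh c0 GE G10; rewrite E1 E2 => E.
  have nz : S * cb ^+ d * N != 0.
    by rewrite !mulf_neq0 ?signr_eq0 ?expf_neq0.
  apply: (mulIf nz).
  transitivity (form_disc d G * (S * (cb ^+ d * N))); first by rewrite !mulrA.
  rewrite E /C; set P := \prod_(w <- ws) _.
  rewrite [RHS](_ : _ = kap * S' * cw ^+ d * P *
    ((S * cb ^+ d * N)^-1 * (S * cb ^+ d * N))); last by ring.
  by rewrite mulVf // mulr1 !mulrA.
have [p pE] := form_disc_pencil_poly a b (ltnW d2).
(* Both sides are polynomial in [e], so the one member that may vanish at (1, 0), to which
   [disc_jac_roots] does not apply, is recovered from the others. *)
pose q := p - C *: \prod_(w <- ws) ((evo a w)%:P + (evo b w) *: 'X).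
have qE e : q.[e] = form_disc d (a + e *: b) -
    C * \prod_(w <- ws) (evo a w + e * evo b w).
  rewrite hornerD hornerN hornerZ pE horner_prod; congr (_ - _ * _).
  by apply: eq_bigr => w _; rewrite !hornerE mulrC.
suff q0 : q = 0 by move=> e; apply/eqP; rewrite -subr_eq0 -qE q0 horner0.
apply: (@poly_vanish_cofinite _ [:: - bev a 1 0 / bev b 1 0]) => e.
rewrite inE => ne; rewrite qE main ?subrr //.
have [b10|b10] := eqVneq (bev b 1 0) 0.
  rewrite b10 mulr0 addr0.
  by apply: contraTneq isT => /(cop (Some 0)); rewrite /evo /= b10 eqxx.
apply: contra ne; rewrite addrC addr_eq0 => /eqP E.
by apply/eqP; apply: (canRL (mulfK b10)).
Qed.

Lemma mderivXn n i (p : {mpoly K[n]}) m :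
  mderiv i (p ^+ m) = m%:R *: (mderiv i p * p ^+ m.-1).
Proof.
elim: m => [|l IH]; first by rewrite expr0 -mpolyC1 mderivC scale0r.
rewrite exprS mderivM IH /= -scalerAr mulrCA -natr1 scalerDl scale1r addrC.
by case: (l) => [|l']; rewrite ?scale0r //= -exprS.
Qed.

Lemma mderiv0_lf o : mderiv 0 (lf o) = - (py o)%:MP.
Proof. by rewrite mderivB !mderivZ !mderivXU /= scaler0 sub0r alg_mpolyC. Qed.

Lemma mderiv1_lf o : mderiv 1 (lf o) = (px o)%:MP.
Proof. by rewrite mderivB !mderivZ !mderivXU /= scaler0 subr0 alg_mpolyC. Qed.

(* If [z] is a root of [G] but not of [b], the multiplicity of [z] drops by one
   under differentiation, so [W(G, b)] cannot vanish. *)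
Lemma jac_eq0 d a b : a \is d.-homog -> b \is d.-homog -> (0 < d)%N ->
  b != 0 -> jac a b = 0 -> exists k, a = k *: b.
Proof.
move=> ah bh d0 b0 W0.
have [z bz] : exists z, evo b z != 0.
  have [c [ys [c0 _ bE]]] := form_roots bh b0.
  have [x xys] := exists_notin (pmap id ys).
  exists (Some x); rewrite bE evoZ mulf_neq0 // evo_prod_lf.
  by apply: contra xys => H; rewrite mem_pmap; apply/mapP; exists (Some x).
pose k := evo a z / evo b z; exists k.
set G := a - k *: b.
suff G0 : G = 0 by apply/eqP; rewrite -subr_eq0 -/G G0.
have Gh : G \is d.-homog by rewrite rpredB // dhomogZ.
have WG : jac G b = 0 by rewrite /G -scaleNr jacDl.
apply/eqP; apply: contraT => G0.
have [c [ys [c0 szy GE]]] := form_roots Gh G0.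
have Gz : evo G z = 0 by rewrite evoB evoZ divfK ?subrr.
have dn0 : d%:R != 0 :> K by rewrite pnatr_eq0 -lt0n.
pose m := count_mem z ys; pose Q := c *: \prod_(y <- ys | y != z) lf y.
have GQ : G = lf z ^+ m * Q.
  rewrite GE (bigID (pred1 z)) /= -scalerAr; congr (_ *: (_ * _)).
  rewrite /m; elim: (ys) => [|y l IH]; first by rewrite big_nil.
  by rewrite big_cons /=; case: eqP => [->|_]; rewrite IH ?exprS.
have Qz : evo Q z != 0.
  rewrite evoZ mulf_neq0 // evo_prod prodf_seq_neq0; apply/allP => y _.
  by apply/implyP => yz; rewrite evo_lf_eq0.
have m0 : (0 < m)%N.
  by rewrite lt0n; apply: contraNneq Qz => m0; rewrite -Gz GQ m0 expr0 mul1r.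
have dl0 := mderiv0_lf z; have dl1 := mderiv1_lf z.
(* Euler's identity for G and for b turns d (G_i b - G b_i) into a coordinate times the Jacobian, up
   to sign. *)
have xG i : d%:R *: (mderiv i G * b - G * mderiv i b) = 0.
  have eG := euler2 Gh; have eb := euler2 bh.
  rewrite scalerBr scalerAr -eb [d%:R *: (G * _)]scalerAl -eG.
  case: (i) => -[|[|//]] ip.
    rewrite (_ : Ordinal ip = 0); last exact: val_inj.
    by rewrite -[RHS](mulr0 'X_1) -WG /jac; ring.
  rewrite (_ : Ordinal ip = 1); last exact: val_inj.
  by rewrite -[RHS](mulr0 (- 'X_0)) -WG /jac; ring.
have key i : evo (mderiv i (lf z)) z = 0.
  have /eqP := xG i; rewrite scaler_eq0 (negbTE dn0) /= GQ mderivM mderivXn.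
  rewrite (_ : lf z ^+ m = lf z * lf z ^+ m.-1); last by rewrite -exprS prednK.
  have -> : (m%:R *: (mderiv i (lf z) * lf z ^+ m.-1) * Q +
      lf z * lf z ^+ m.-1 * mderiv i Q) * b -
      lf z * lf z ^+ m.-1 * Q * mderiv i b =
      lf z ^+ m.-1 * (m%:R *: mderiv i (lf z) * Q * b +
        lf z * (mderiv i Q * b - Q * mderiv i b)).
    by rewrite -!mul_mpolyC; ring.
  rewrite mulf_eq0 expf_eq0 (negbTE (lf_neq0 z)) andbF /= => /eqP.
  move/(congr1 (fun p => evo p z)); rewrite evoD !evoM evoZ evo0.
  rewrite (_ : evo (lf z) z = 0) ?mul0r ?addr0; last first.
    by apply/eqP; rewrite evo_lf_eq0.
  move/eqP; rewrite !mulf_eq0 (negbTE bz) (negbTE Qz) pnatr_eq0 !orbF.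
  by rewrite (gtn_eqF m0) => /eqP.
have := px_py_neq0 z; move: (key 0) (key 1); rewrite dl0 dl1.
rewrite /evo bevN /bev !mevalC => /eqP; rewrite oppr_eq0 => /eqP-> ->.
by rewrite eqxx.
Qed.

End Jacobian.

Definition i30 : 'I_3 := @Ordinal 3 0 isT.
Definition i31 : 'I_3 := @Ordinal 3 1 isT.
Definition i32 : 'I_3 := @Ordinal 3 2 isT.

Lemma ord3P (P : 'I_3 -> Prop) : P i30 -> P i31 -> P i32 -> forall i, P i.
Proof.
move=> P0 P1 P2 [[|[|[|//]]] ip].
- by rewrite (_ : Ordinal ip = i30) //; apply: val_inj.
- by rewrite (_ : Ordinal ip = i31) //; apply: val_inj.
by rewrite (_ : Ordinal ip = i32) //; apply: val_inj.
Qed.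

Lemma sum3 (V : nmodType) (F : 'I_3 -> V) :
  \sum_(i < 3) F i = F i30 + F i31 + F i32.
Proof.
rewrite !big_ord_recl big_ord0 addr0 addrA.
by congr (F _ + F _ + F _); apply: val_inj.
Qed.

(** * Families of three binary forms *)

Section Vectors3.
Variable A : comNzRingType.
Implicit Types u v w : 'I_3 -> A.

Definition dot u v : A := \sum_i u i * v i.
Definition crs u v (i : 'I_3) : A :=
  match val i with
  | 0 => u i31 * v i32 - u i32 * v i31
  | 1 => u i32 * v i30 - u i30 * v i32
  | _ => u i30 * v i31 - u i31 * v i30
  end.

Lemma dotE u v : dot u v = u i30 * v i30 + u i31 * v i31 + u i32 * v i32.
Proof. exact: sum3. Qed.
Lemma dotC u v : dot u v = dot v u.
Proof. by apply: eq_bigr => i _; rewrite mulrC. Qed.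
Lemma dot_crs_rot u v w : dot (crs u v) w = dot u (crs v w).
Proof. rewrite !dotE /crs /=; ring. Qed.
Lemma crs_anti u v i : crs u v i = - crs v u i.
Proof. by elim/ord3P: i; rewrite /crs /=; ring. Qed.
Lemma crs_self u i : crs u u i = 0.
Proof. by elim/ord3P: i; rewrite /crs /=; ring. Qed.
Lemma dot_crsl u v : dot u (crs u v) = 0.
Proof. rewrite !dotE /crs /=; ring. Qed.
Lemma dot_crsr u v : dot v (crs u v) = 0.
Proof. rewrite !dotE /crs /=; ring. Qed.
Lemma crs_crs u v w i : crs u (crs v w) i = v i * dot u w - w i * dot u v.
Proof. by rewrite !dotE; elim/ord3P: i; rewrite /crs /=; ring. Qed.

Lemma crs_scale_anti k u v w l : (forall j, v j = k * u j) ->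
  crs v w l = - k * crs w u l.
Proof. by move=> E; elim/ord3P: l; rewrite /crs /= !E; ring. Qed.

End Vectors3.

Section Vectors3Field.
Variable K : fieldType.
Implicit Types u v w : 'I_3 -> K.

Definition nz u := exists i, u i != 0.
(** Proportionality, which also holds when one of the vectors is zero; it is therefore transitive
    only through a nonzero middle vector. *)
Definition par u v := forall i, crs u v i = 0.

Lemma nzPn u : ~ nz u -> forall i, u i = 0.
Proof. by move=> nu i; apply/eqP; apply/negPn/negP => ui; apply: nu;
  exists i. Qed.

Lemma par_scale u v i : u i != 0 -> par u v -> forall j, v j = v i / u i * u j.
Proof.
move=> ui p j; have E (k l : 'I_3) : u k * v l = u l * v k.
  have p0 : u i31 * v i32 = u i32 * v i31 by apply: subr0_eq (p i30).
  have p1 : u i32 * v i30 = u i30 * v i32 by apply: subr0_eq (p i31).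
  have p2 : u i30 * v i31 = u i31 * v i30 by apply: subr0_eq (p i32).
  by elim/ord3P: k; elim/ord3P: l => //; rewrite ?p0 ?p1 ?p2.
by rewrite mulrAC [v i * _]mulrC E mulrAC divff // mul1r.
Qed.

Lemma parP u v : nz u -> par u v -> exists k, forall j, v j = k * u j.
Proof. by move=> [i ui] p; exists (v i / u i); apply: par_scale. Qed.

Lemma par_sym u v : par u v -> par v u.
Proof. by move=> p i; rewrite crs_anti p oppr0. Qed.

Lemma par_of_scale k u v : (forall j, v j = k * u j) -> par u v.
Proof. by move=> E; elim/ord3P; rewrite /crs /= !E; ring. Qed.

Lemma par_trans u v w : nz v -> par u v -> par v w -> par u w.
Proof.
move=> nv /par_sym/(parP nv)[k Ek] /(parP nv)[l El].
by elim/ord3P; rewrite /crs /= !Ek !El; ring.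
Qed.

Lemma orth_par u v w : nz (crs v w) -> dot u v = 0 -> dot u w = 0 ->
  par (crs v w) u.
Proof. by move=> _ uv uw i; rewrite crs_anti crs_crs uv uw !mulr0 subrr oppr0.
  Qed.

Lemma not_par u v : ~ par u v -> nz (crs u v).
Proof.
move=> np; have [//|n] := pselect (nz (crs u v)).
by case: np; apply: nzPn.
Qed.

End Vectors3Field.

Section Families.
Variable K : numClosedFieldType.
Implicit Types (o : option K) (u v q : 'I_3 -> K) (f psi : 'I_3 -> {mpoly
  K[2]}).

Definition fo f o : 'I_3 -> K := fun i => evo (f i) o.
Definition dotf u f : {mpoly K[2]} := \sum_i u i *: f i.
Definition nocommon f := forall o, nz (fo f o).

Lemma evo_dotf u f o : evo (dotf u f) o = dot u (fo f o).
Proof. by rewrite evo_sum; apply: eq_bigr => i _; rewrite evoZ. Qed.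

Lemma dotf_homog n u f : (forall i, f i \is n.-homog) -> dotf u f \is n.-homog.
Proof. by move=> fh; apply: rpred_sum => i _; rewrite dhomogZ. Qed.

Lemma dotfD u v e f : dotf (fun i => u i + e * v i) f = dotf u f + e *: dotf v
  f.
Proof.
rewrite /dotf scaler_sumr -big_split; apply: eq_bigr => i _ /=.
by rewrite scalerDl scalerA.
Qed.

Lemma eq_dotf u v f : u =1 v -> dotf u f = dotf v f.
Proof. by move=> E; apply: eq_bigr => i _; rewrite E. Qed.

Lemma mpoly_nonroot n (p : {mpoly K[n]}) : p != 0 ->
  exists v : 'I_n -> K, p.@[v] != 0.
Proof.
move=> p0; have [//|N] := pselect (exists v : 'I_n -> K, p.@[v] != 0).
case/negP: p0; apply/eqP/mpoly_vanish => v; apply/eqP.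
by apply/negPn/negP => H; apply: N; exists (v : 'I_n -> K).
Qed.

(** The product of [p] and of the linear forms [linf (g t)] is a nonzero polynomial. The factor [p]
    leaves room for one more open condition on [v]. *)
Lemma avoid (T : eqType) (s : seq T) (g : T -> 'I_3 -> K) (p : {mpoly K[3]}) :
  p != 0 -> {in s, forall t, nz (g t)} ->
  exists v, p.@[v] != 0 /\ {in s, forall t, dot v (g t) != 0}.
Proof.
move=> p0 gn; have [|v] := @mpoly_nonroot _ (p * \prod_(t <- s) linf (g t)).
  rewrite mulf_neq0 // prodf_seq_neq0; apply/allP => t ts.
  by have [i gi] := gn t ts; apply: linf_neq0 gi.
rewrite mevalM mulf_eq0 rmorph_prod => /norP[pv].
rewrite prodf_seq_neq0 => /allP H; exists v; split=> // t /H.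
by rewrite /= meval_linf -/(dot _ _) dotC.
Qed.

Lemma prod_lf_split (ys : seq (option K)) o :
  \prod_(y <- ys) lf y =
  lf o ^+ count_mem o ys * \prod_(y <- ys | y != o) lf y.
Proof.
rewrite (bigID (pred1 o)) /=; congr (_ * _).
elim: ys => [|y l IH]; first by rewrite big_nil.
by rewrite big_cons /=; case: eqP => [->|_]; rewrite IH ?exprS.
Qed.

(** Common roots are removed one at a time. Each lowers the degree by one, and a nonzero family of
    degree 0 has no common root. *)
Lemma family_gcd n f : (forall i, f i \is n.-homog) -> (exists i, f i != 0) ->
  exists (xs : seq (option K)) psi,
    [/\ (size xs <= n)%N, forall i, psi i \is (n - size xs).-homog, nocommon psi
      & forall i, f i = (\prod_(x <- xs) lf x) * psi i].
Proof.
elim: n f => [|n IH] f fh [j fj].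
  exists [::], f; split=> // [o|i].
    exists j; have [c [ys [c0 /size0nil -> E]]] := form_roots (fh j) fj.
    by rewrite /fo E evoZ mulf_neq0 // evo_prod big_nil oner_eq0.
  by rewrite big_nil mul1r.
have [nc|] := pselect (nocommon f).
  by exists [::], f; split=> // i; rewrite ?subn0 // big_nil mul1r.
move/existsNP => [o /nzPn fo0].
have /choice[g gP] i : exists Q, f i = lf o * Q /\ Q \is n.-homog.
  by have [Q E Qh] := form_dvd_lf (fh i) (fo0 i); exists Q.
have [|xs [psi [sz psih nc E]]] := IH g (fun i => (gP i).2).
  by exists j; apply: contra fj; rewrite (gP j).1 => /eqP->; rewrite mulr0.
exists (o :: xs), psi; split=> // i.
by rewrite big_cons (gP i).1 E mulrA.
Qed.

Lemma jac_neq0 n a b : (0 < n)%N -> a \is n.-homog -> b \is n.-homog ->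
  (forall o, evo a o = 0 -> evo b o != 0) -> jac a b != 0.
Proof.
move=> n0 ah bh cop; apply/eqP => W0.
have b0 : b != 0.
  have [o o0] := form_root n0 ah.
  by apply: contra (cop _ o0) => /eqP->; rewrite evo0.
have [k ak] := jac_eq0 ah bh n0 b0 W0.
have [o o0] := form_root n0 bh.
by have := cop o; rewrite ak evoZ o0 mulr0 eqxx => /(_ erefl).
Qed.

(** Bertini for a pencil: a multiple root of a + e b is a root of the Jacobian of a and b, and a
    root of the member determines e. Hence only finitely many e give a multiple root or a root in
    [B]. *)
Lemma generic_member n a b (B : seq (option K)) : (0 < n)%N ->
  a \is n.-homog -> b \is n.-homog -> (forall o, evo a o = 0 -> evo b o != 0) ->
  {in B, forall o, evo b o != 0} ->
  exists s : seq K, forall e, e \notin s -> exists c ys,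
    [/\ c != 0, size ys = n, uniq ys, a + e *: b = c *: \prod_(y <- ys) lf y
      & {in ys, forall y, y \notin B}].
Proof.
move=> n0 ah bh cop bB.
have W0 := jac_neq0 n0 ah bh cop.
have [cw [ws [cw0 _ WE]]] := form_roots (jac_homog ah bh) W0.
exists [seq - evo a o / evo b o | o <- ws ++ B] => e ne.
set G := a + e *: b; have Gh : G \is n.-homog by rewrite rpredD // dhomogZ.
have [z bz] := form_root n0 bh.
have az : evo a z != 0.
  by apply: contraTneq isT => /cop; rewrite bz eqxx.
have [|c [ys [c0 szy GE]]] := form_roots Gh.
  apply: contra az => /eqP E; have := congr1 (fun p => evo p z) E.
  by rewrite /G evoD evoZ bz mulr0 addr0 evo0 => ->.
have yE y : y \in ys -> evo a y + e * evo b y = 0.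
  move=> yys; rewrite -evoZ -evoD -/G; apply/eqP.
  by rewrite GE evoZ mulf_eq0 evo_prod_lf yys orbT.
have excl y : y \in ys -> y \in ws ++ B -> False.
  move=> yys yw; have E := yE y yys.
  have b0 : evo b y != 0.
    have [bz0|//] := eqVneq (evo b y) 0; move: E; rewrite bz0 mulr0 addr0 =>
      /cop.
    by rewrite bz0 eqxx.
  case/negP: ne; apply/mapP; exists y => //.
  by apply: (canRL (mulfK b0)); apply/eqP; rewrite -addr_eq0 addrC E.
exists c, ys; split=> //; last first.
  by move=> y yys; apply/negP => yB; apply: (excl y yys);
    rewrite mem_cat yB orbT.
apply: contraT => nu.
have [y] : exists y, (1 < count_mem y ys)%N.
  move: nu; elim: (ys) => //= y l IH; rewrite negb_and negbK =>
    /orP[yl|/IH[x xl]].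
    by exists y; rewrite eqxx add1n ltnS -has_count has_pred1.
  by exists x; rewrite (leq_trans xl) // leq_addl.
move=> cy; case: (excl y).
  by rewrite -has_pred1 has_count (leq_trans _ cy).
rewrite mem_cat; apply/orP; left; rewrite -evo_prod_lf.
have : evo (jac a b) y == 0.
  rewrite -(jacDl a b e) -/G GE (prod_lf_split ys y) -(subnKC cy).
  set Q := \prod_(_ <- _ | _) _; set m := (_ - _)%N.
  have d0 (i : 'I_2) : evo (mderiv i (c *: (lf y ^+ (2 + m) * Q))) y = 0.
    have : evo (lf y) y = 0 by apply/eqP; rewrite evo_lf_eq0.
    move: (lf y) => L L0.
    rewrite mderivZ evoZ exprD expr2 -!mulrA !mderivM.
    by rewrite !(evoD, evoM) L0; ring.
  by rewrite /jac evoB !evoM !d0 !mul0r subrr.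
by rewrite WE evoZ mulf_eq0 (negbTE cw0).
Qed.

(** Generic injectivity read on the projective line, where a proper closed subset is a finite list
    of parameters. *)
Definition inj_off f (B : seq (option K)) :=
  forall o w, o \notin B -> w \notin B -> par (fo f o) (fo f w) -> o = w.

Lemma linear_section n f (B : seq (option K)) : (0 < n)%N ->
  (forall i, f i \is n.-homog) -> nocommon f ->
  exists u c ys, [/\ c != 0, size ys = n, uniq ys,
    dotf u f = c *: \prod_(y <- ys) lf y & {in ys, forall y, y \notin B}].
Proof.
move=> n0 fh nc.
(* The extra point [None] ensures that [dotf v f] is nonzero also when [B] is empty. *)
have [v [_ vB]] := @avoid _ (None :: B) (fo f) 1 (oner_neq0 _) (fun o _ =>
  nc o).
have vh := dotf_homog v fh.
have [|cv [zs [cv0 _ vE]]] := form_roots vh.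
  apply: contra (vB None (mem_head _ _)) => /eqP E.
  by rewrite -evo_dotf E evo0.
have [u [_ uz]] := @avoid _ zs (fo f) 1 (oner_neq0 _) (fun o _ => nc o).
have [||s gen] := generic_member n0 (dotf_homog u fh) vh (B := B).
- move=> o uo; apply: contraTneq isT => vo.
  have : o \in zs.
    by rewrite -evo_prod_lf; move/eqP: vo;
      rewrite vE evoZ mulf_eq0 (negbTE cv0).
  by move/uz; rewrite -evo_dotf uo eqxx.
- by move=> o oB; rewrite evo_dotf vB // inE oB orbT.
have [e /gen[c [ys [c0 szy uy E yB]]]] := exists_notin s.
by exists (fun i => u i + e * v i), c, ys; rewrite dotfD.
Qed.

(** The curve lies on no line: if u.f = 0, a general section w.f has n > 1 distinct roots outside
    [B], all sent to the single intersection point of the lines u and w. *)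
Lemma section_neq0 n f B u : (1 < n)%N -> (forall i, f i \is n.-homog) ->
  nocommon f -> inj_off f B -> nz u -> dotf u f != 0.
Proof.
move=> n1 fh nc inj [i ui]; apply/eqP => u0.
have [w [c [ys [c0 szy uy E yB]]]] := linear_section B (ltnW n1) fh nc.
case: ys szy uy E yB => [|y [|y' ys]] /=; [by move=> sz; rewrite -sz in n1..|].
move=> _ /andP[]; rewrite inE negb_or => /andP[ne _] _ E yB.
have w0 o : o \in [:: y, y' & ys] -> dot (fo f o) w = 0.
  by move=> oy; rewrite dotC -evo_dotf; apply/eqP;
    rewrite E evoZ mulf_eq0 evo_prod_lf oy orbT.
have u0' o : dot (fo f o) u = 0 by rewrite dotC -evo_dotf u0 evo0.
have [uw|/not_par nuw] := pselect (par u w).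
  have [k wk] := parP (ex_intro _ i ui) uw.
  have W : dotf w f = 0.
    rewrite -[RHS](scaler0 _ k) -u0 /dotf scaler_sumr.
    by apply: eq_bigr => j _; rewrite wk scalerA.
  have : c *: \prod_(y <- [:: y, y' & ys]) lf y != 0.
    by rewrite scaler_eq0 negb_or c0 prod_lf_neq0.
  by rewrite -E W eqxx.
have p o : o \in [:: y, y' & ys] -> par (crs u w) (fo f o).
  by move=> oy; apply: orth_par; rewrite ?w0.
have/eqP := ne; apply; apply: inj.
- by apply: yB; rewrite mem_head.
- by apply: yB; rewrite !inE eqxx orbT.
apply: (par_trans nuw (par_sym (p y _)) (p y' _)); by rewrite !inE eqxx ?orbT.
Qed.

(** [generic_member] for the pencil of lines through [q] spanned by P x q and v x q. The vector [v]
    is chosen so that the second section vanishes neither at a root of the first nor on [B]. *)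
Lemma generic_line n f q P (B : seq (option K)) (p : {mpoly K[3]}) : (0 < n)%N
  ->
  (forall i, f i \is n.-homog) -> (forall o, ~ par q (fo f o)) ->
  dotf (crs P q) f != 0 -> p != 0 ->
  exists v (s : seq K), p.@[v] != 0 /\ forall e, e \notin s -> exists c ys,
    [/\ c != 0, size ys = n, uniq ys,
        dotf (crs (fun i => P i + e * v i) q) f = c *: \prod_(y <- ys) lf y
      & {in ys, forall y, y \notin B}].
Proof.
move=> n0 fh qf a0 p0; have ah := dotf_homog (crs P q) fh.
have [ca [zs [ca0 _ aE]]] := form_roots ah a0.
have [v [pv vz]] := @avoid _ (zs ++ B) (fun o => crs q (fo f o)) p p0
  (fun o _ => not_par (qf o)).
have bE o : evo (dotf (crs v q) f) o = dot v (crs q (fo f o)).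
  by rewrite evo_dotf dot_crs_rot.
have [||s gen] := generic_member n0 ah (dotf_homog (crs v q) fh) (B := B).
- move=> o ao; rewrite bE vz // mem_cat -evo_prod_lf; apply/orP; left.
  by move/eqP: ao; rewrite aE evoZ mulf_eq0 (negbTE ca0).
- by move=> o oB; rewrite bE vz // mem_cat oB orbT.
exists v, s; split=> // e /gen[c [ys [c0 szy uy E yB]]]; exists c, ys; split=>
  //.
rewrite -E -dotfD; apply: eq_dotf.
by elim/ord3P; rewrite /crs /=; ring.
Qed.

End Families.

(** * Restriction of ternary forms to lines *)

Section Lines.
Variable K : numClosedFieldType.
Notation A := {mpoly K[3]}.
Implicit Types (G : A) (P q : 'I_3 -> K).

Definition line P q (e : K) : 'I_3 -> K := fun i => P i + e * q i.

(** Restriction of [G] to the line of direction [q] through the generic point: a polynomial in the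
    line parameter with coefficients polynomial in the base point. *)
Definition shift q G : {poly A} :=
  mmap (fun c => (c%:MP)%:P) (fun i => ('X_i)%:P + ((q i)%:MP)%:P * 'X) G.

Lemma shiftE q G P e :
  (map_poly (meval P) (shift q G)).[e] = G.@[line P q e].
Proof.
rewrite /shift (rmorph_mmap (map_poly (meval P))) -/(horner_eval e _).
rewrite (rmorph_mmap (horner_eval e)); apply: eq_mmap => [c|i] /=.
  by rewrite map_polyC /= mevalC /horner_eval hornerC.
rewrite rmorphD rmorphM /= !map_polyC map_polyX /= mevalXU mevalC.
by rewrite /horner_eval !hornerE mulrC.
Qed.

Lemma eq_map_shift q G P (p : {poly K}) :
  (forall e, G.@[line P q e] = p.[e]) -> map_poly (meval P) (shift q G) = p.
Proof.
move=> E; apply/eqP; rewrite -subr_eq0; apply/eqP/poly_vanish => e.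
by rewrite hornerD hornerN shiftE E subrr.
Qed.

Lemma horner_shift0 q G : (shift q G).[0] = G.
Proof.
apply: mpoly_funext => P; rewrite -horner_map /= meval0 shiftE.
by apply: meval_eq => i; rewrite /line mul0r addr0.
Qed.

(** The cancellation takes place among polynomials in the parameter, so the conclusion holds also
    where [pL] vanishes. *)
Lemma line_cancel (L G : A) P q (pL pG : {poly K}) : pL != 0 ->
  (forall e, L.@[line P q e] = pL.[e]) ->
  (forall e, L.@[line P q e] * G.@[line P q e] = pL.[e] * pG.[e]) ->
  forall e, G.@[line P q e] = pG.[e].
Proof.
move=> pL0 LE H; have [p pE] : exists p : {poly K}, forall e,
  p.[e] = G.@[line P q e].
  by exists (map_poly (meval P) (shift q G)) => e; rewrite shiftE.
suff -> : pG = p by [].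
apply/eqP; rewrite eq_sym -subr_eq0.
suff : pL * (p - pG) == 0 by rewrite mulf_eq0 (negbTE pL0).
apply/eqP/poly_vanish => e.
by rewrite hornerM hornerD hornerN pE mulrBr -H LE subrr.
Qed.

Lemma evsM P e (u v : {poly A}) : (map_poly (meval P) (u * v)).[e] =
  (map_poly (meval P) u).[e] * (map_poly (meval P) v).[e].
Proof. by rewrite rmorphM hornerM. Qed.

Lemma evsD P e (u v : {poly A}) : (map_poly (meval P) (u + v)).[e] =
  (map_poly (meval P) u).[e] + (map_poly (meval P) v).[e].
Proof. by rewrite rmorphD hornerD. Qed.

Definition dense (Om : ('I_3 -> K) -> Prop) :=
  forall G, (forall P, Om P -> G.@[P] = 0) -> G = 0.

(** Over the generic base point the restriction of [G1] has degree [n] and leading coefficient [a].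
    Pseudo-division of the restriction of [G2] by it leaves a remainder of degree < n that has n
    distinct roots over every base point of [Om], hence is zero by density. Parameter 0 then gives
    the relation between the forms themselves. *)
Lemma split_dvd (G1 G2 a : A) q n (Om : ('I_3 -> K) -> Prop) : dense Om ->
  (forall P, Om P -> a.@[P] != 0 /\ exists es : seq K,
     [/\ uniq es, size es = n,
         forall e, G1.@[line P q e] = a.@[P] * \prod_(x <- es) (e - x)
       & {in es, forall e, G2.@[line P q e] = 0}]) ->
  exists k Q, a ^+ k * G2 = Q * G1.
Proof.
move=> dn H.
have [p1 [p1s p10 p1E']] : exists p1, [/\ forall P e,
    (map_poly (meval P) p1).[e] = G1.@[line P q e],
      p1.[0] = G1 & p1 = shift q G1].
  by exists (shift q G1); split; rewrite ?horner_shift0 // => P e;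
    rewrite shiftE.
have [p2 [p2s p20]] : exists p2, (forall P e,
    (map_poly (meval P) p2).[e] = G2.@[line P q e]) /\ p2.[0] = G2.
  by exists (shift q G2); split; rewrite ?horner_shift0 // => P e;
    rewrite shiftE.
have p1E P es : (forall e, G1.@[line P q e] = a.@[P] * \prod_(x <- es) (e - x))
  ->
    map_poly (meval P) p1 = a.@[P] *: \prod_(x <- es) ('X - x%:P).
  move=> E; rewrite p1E'; apply: eq_map_shift => e;
    rewrite E hornerZ horner_prod.
  by congr (_ * _); apply: eq_bigr => x _; rewrite hornerXsubC.
have p1n : p1`_n = a.
  apply/eqP; rewrite -subr_eq0; apply/eqP/dn => P /H[_ [es [_ sz E _]]].
  rewrite mevalB -coef_map (p1E P es E) coefZ -{1}sz.
  have /monicP := monic_prod_XsubC es xpredT id.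
  by rewrite lead_coefE size_prod_XsubC /= => ->; rewrite mulr1 subrr.
have p1j j : (n < j)%N -> p1`_j = 0.
  move=> nj; apply: dn => P /H[_ [es [_ sz E _]]].
  rewrite -coef_map (p1E P es E) coefZ nth_default ?mulr0 //.
  by rewrite size_prod_XsubC sz.
have a0 : a != 0.
  apply: contraTneq isT => a0; have: (1 : A) = 0; last by move/eqP;
    rewrite oner_eq0.
  by apply: dn => P /H[]; rewrite a0 meval0 eqxx.
have sz1 : size p1 = n.+1.
  apply/eqP; rewrite eqn_leq; apply/andP; split.
    by apply/leq_sizeP => j; apply: p1j.
  by rewrite ltnNge; apply/negP => /leq_sizeP/(_ n (leqnn _)); rewrite p1n =>
    /eqP; rewrite (negbTE a0).
have lc : lead_coef p1 = a by rewrite lead_coefE sz1.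
have p1n0 : p1 != 0 by rewrite -size_poly_eq0 sz1.
have := Pdiv.Idomain.divp_eq p2 p1; rewrite lc -mul_polyC.
have szR : (size (modp p2 p1) < n.+1)%N by rewrite -sz1
  Pdiv.CommonIdomain.ltn_modp.
move: (scalp p2 p1) (divp p2 p1) (modp p2 p1) szR => k Q R szR E.
suff R0 : R = 0.
  exists k, Q.[0]; rewrite -{1}p20 -p10 -hornerM -[a ^+ k](hornerC _ 0) -hornerM
    E.
  by rewrite R0 addr0.
apply/polyP => j; rewrite coef0; apply: dn => P /H[_ [es [ue sz EP E2]]].
rewrite -coef_map; suff -> : map_poly (meval P) R = 0 by rewrite coef0.
apply: (@roots_geq_poly_eq0 _ _ es) => //.
  apply/allP => e ees; apply/rootP.
  have : (map_poly (meval P) ((a ^+ k)%:P * p2)).[e] =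
    (map_poly (meval P) (Q * p1 + R)).[e] by rewrite E.
  rewrite evsD !evsM p2s p1s E2 // mulr0 EP.
  by rewrite (big_rem e) //= subrr mul0r !mulr0 add0r => <-.
by rewrite sz; apply: leq_trans (size_poly _ _) _.
Qed.

End Lines.

Lemma mpoly_unitP (K : fieldType) n (p : {mpoly K[n]}) :
  reflect (exists2 c, c != 0 & p = c%:MP) (p \is a GRing.unit).
Proof.
apply: (iffP idP) => [u|[c c0 ->]]; last first.
  by apply: (rmorph_unit (@mpolyC n K)); rewrite unitfE.
apply/msize_poly1P; have p0 : p != 0.
  by apply: contraTneq u => ->; rewrite unitr0.
have q0 : p^-1 != 0 by rewrite invr_eq0.
have := msizeM p0 q0; rewrite divrr // msize1 => /esym/eqP.
by rewrite (mpolySpred _ p0) (mpolySpred _ q0) addSn addnS /= eqSS addn_eq0 =>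
  /andP[/eqP->].
Qed.

Section LinearFactors.
Variable K : numClosedFieldType.
Notation A := {mpoly K[3]}.

Lemma linf_power_factor (n : 'I_3 -> K) k (F Q H : A) : nz n ->
  linf n ^+ k * F = Q * H ->
  exists j Q' H', F = Q' * H' /\ H = linf n ^+ j * H'.
Proof.
move=> [i ni]; elim: k Q H => [|k IH] Q H.
  by rewrite mul1r => ->; exists 0%N, Q, H; rewrite mul1r.
have l0 := linf_neq0 ni; rewrite exprS -mulrA => E.
have [[Q1 Q1E]|[H1 H1E]] := linf_prime ni (esym E).
  move: E; rewrite Q1E -mulrA => /(mulfI l0); exact: IH.
move: E; rewrite H1E [Q * _]mulrCA => /(mulfI l0)/IH [j [Q' [H' [FE HE]]]].
by exists j.+1, Q', H'; split=> //; rewrite HE exprS mulrA.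
Qed.

End LinearFactors.

Section GenericForm.
Variable K : numClosedFieldType.
Notation A := {mpoly K[3]}.

Definition genf (f : 'I_3 -> {mpoly K[2]}) (L : 'I_3 -> A) : {mpoly A[2]} :=
  \sum_i L i *: map_mpoly (@mpolyC 3 K) (f i).

Lemma map_genf f L P :
  map_mpoly (meval P) (genf f L) = dotf (fun i => (L i).@[P]) f.
Proof.
rewrite rmorph_sum; apply: eq_bigr => i _; rewrite /= map_mpolyZ;
  congr (_ *: _).
by apply/mpolyP => m; rewrite !mcoeff_map_mpoly /= mevalC.
Qed.

Lemma meval_crs (u v : 'I_3 -> A) P i :
  (crs u v i).@[P] = crs (fun j => (u j).@[P]) (fun j => (v j).@[P]) i.
Proof. by elim/ord3P: i; rewrite /crs /= mevalB !mevalM. Qed.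

End GenericForm.

Section Span.
Variable K : numClosedFieldType.
Implicit Types P q v : 'I_3 -> K.

(** It suffices to meet [Om] at almost all points of one line through each P: G then vanishes along
    that line, in particular at P. The hyperplane [dot P n = 0] is absorbed by multiplying G by
    [linf n]. *)
Lemma dense_lines (n : 'I_3 -> K) (Om : ('I_3 -> K) -> Prop) : nz n ->
  (forall P, dot P n != 0 -> exists v (s : seq K), forall e, e \notin s ->
     dot (line P v e) n != 0 -> Om (line P v e)) ->
  dense Om.
Proof.
move=> [i ni] H G G0; apply/eqP.
suff : G * linf n == 0 by rewrite mulf_eq0 (negbTE (linf_neq0 ni)) orbF.
apply/eqP/mpoly_vanish => P; rewrite mevalM meval_linf -/(dot n P) dotC.
have [->|nP] := eqVneq (dot P n) 0; first by rewrite mulr0.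
have [v [s Hv]] := H P nP.
have dE e : dot (line P v e) n = dot P n + e * dot v n.
  by rewrite !dotE /line; ring.
have p0 : map_poly (meval P) (shift v G) = 0.
  apply: (@poly_vanish_cofinite _ (- dot P n / dot v n :: s)) => e.
  rewrite inE negb_or => /andP[ne es]; rewrite shiftE; apply/G0/Hv => //.
  rewrite dE; have [v0|v0] := eqVneq (dot v n) 0.
    by rewrite v0 mulr0 addr0.
  apply: contra ne; rewrite addrC addr_eq0 => /eqP E.
  by apply/eqP; apply: (canRL (mulfK v0)).
have := shiftE v G P 0; rewrite p0 horner0 => E.
rewrite (_ : G.@[P] = 0) ?mul0r // E; apply: meval_eq => j.
by rewrite /line mul0r addr0.
Qed.

Lemma exists_dot v : nz v -> exists t, dot v t != 0.
Proof.
move=> [i vi]; exists (fun j => (j == i)%:R);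
  rewrite /dot (bigD1 i) //= eqxx mulr1.
by rewrite big1 ?addr0 // => j /negbTE->; rewrite mulr0.
Qed.

Lemma span2 P q v : nz (crs P q) -> dot (crs P q) v = 0 -> ~ par q v ->
  exists k r, k != 0 /\ forall j, v j = k * line P q r j.
Proof.
move=> /exists_dot[t D0] v0 npar; set D := dot _ _ in D0.
(* Cramer's rule in the basis P, q, t; the t-coordinate of [v] is zero by hypothesis. *)
pose al := dot (crs v q) t / D; pose be := dot (crs P v) t / D.
have E j : v j = al * P j + be * q j.
  apply: (mulIf D0).
  have -> : (al * P j + be * q j) * D =
      dot (crs v q) t * P j + dot (crs P v) t * q j + dot (crs P q) v * t j.
    by rewrite v0 mul0r addr0 mulrDl /al /be; field.
  by rewrite /D !dotE; elim/ord3P: j; rewrite /crs /=; ring.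
have al0 : al != 0.
  apply/negP => /eqP a0; apply: npar; apply: (par_of_scale (k := be)) => j.
  by rewrite E a0 mul0r add0r.
exists al, (be / al); split=> // j; rewrite E /line mulrDr.
by rewrite [al * (_ * _)]mulrA [al * (be / al)]mulrC divfK.
Qed.

End Span.

(** * The implicit equation along a line, by projection from a point off the curve *)

Section ImplicitEquation.
Variables (K : numClosedFieldType) (d N : nat) (f : 'I_3 -> {mpoly K[2]}).
Variables (B : seq (option K)) (F : {mpoly K[3]}).
Hypothesis d2 : (1 < d)%N.
Hypothesis fh : forall i, f i \is d.-homog.
Hypothesis nc : nocommon f.
Hypothesis inj : inj_off f B.
Hypothesis Fh : F \is N.-homog.
Hypothesis Firr : irreducible_elt F.
Hypothesis Ff : forall o, F.@[fo f o] = 0.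

Notation A := {mpoly K[3]}.
Implicit Types (P q : 'I_3 -> K) (o : option K).

Definition off_curve q := forall o, ~ par q (fo f o).

Lemma homog_zero_line P q k r v : k != 0 -> (forall j,
  v j = k * line P q r j) ->
  F.@[v] = 0 -> F.@[line P q r] = 0.
Proof.
move=> k0 E; rewrite (meval_eq _ E) (meval_homog _ _ Fh) => /eqP.
by rewrite mulf_eq0 expf_eq0 (negbTE k0) andbF => /eqP.
Qed.

(* H(P) is the resultant of the sections of the curve by the lines Pq and Pq'.
   On the line P + e q it is, up to a constant, l(P)^d prod (e - r_y), where
   l(P) = det(P, q, q') and the r_y are the parameters of the points of the
   curve on that line. *)
Section Projection.
Variables (q q' : 'I_3 -> K).
Hypothesis qf : off_curve q.
Hypothesis nq' : nz (crs q q').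
Let n := crs q q'.

Let X : 'I_3 -> A := fun i => 'X_i.
Let C (v : 'I_3 -> K) : 'I_3 -> A := fun i => (v i)%:MP.

Definition elim_res : A :=
  form_resultant d d (genf f (crs X (C q))) (genf f (crs X (C q'))).

Lemma elim_resE P :
  elim_res.@[P] = form_resultant d d (dotf (crs P q) f) (dotf (crs P q') f).
Proof.
rewrite /elim_res -(form_resultant_map (meval P)) !map_genf.
by congr form_resultant; apply: eq_dotf => i; rewrite meval_crs;
  elim/ord3P: i; rewrite /crs /= /X /C !mevalXU !mevalC.
Qed.

(** Along P + e q the section by the line Pq is fixed, and at a root y of it the other section
    equals n.f(y) times e - r_y. By [evo_swap] the product of the n.f(y) becomes that of the values
    of (P x q).f at the roots z of n.f. As f(z) lies on the line qq', each of these is a nonzero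
    constant times P.n, whence the factor [dot P n ^+ d]. *)
Lemma elim_res_line : exists2 kap : K, kap != 0 & forall P c ys r,
  dot P n != 0 -> c != 0 -> size ys = d ->
  dotf (crs P q) f = c *: \prod_(y <- ys) lf y ->
  {in ys, forall y, exists2 k, k != 0 & forall j,
    fo f y j = k * line P q (r y) j} ->
  forall e, elim_res.@[line P q e] =
    kap * dot P n ^+ d * \prod_(y <- ys) (e - r y).
Proof.
have nh := dotf_homog n fh.
have [c' [zs [c'0 szz nE]]] := form_roots nh (section_neq0 d2 fh nc inj nq').
have be_ex z : exists be, z \in zs -> be != 0 /\
    forall P, dot (crs P q) (fo f z) = be * dot P n.
  have [zz|] := boolP (z \in zs); last by exists 0.
  have z0 : dot n (fo f z) = 0.
    by rewrite -evo_dotf nE evoZ; apply/eqP;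
      rewrite mulf_eq0 evo_prod_lf zz orbT.
  have nq'' : nz (crs q' q).
    by have [i ni] := nq'; exists i; rewrite crs_anti oppr_eq0.
  have z0' : dot (crs q' q) (fo f z) = 0.
    transitivity (- dot n (fo f z)); last by rewrite z0 oppr0.
    by rewrite !dotE /n /crs /=; ring.
  have [k [r [k0 E]]] := span2 nq'' z0' (@qf z).
  exists k => _; split=> // P.
  by rewrite !dotE /n /crs /= !E /line; ring.
have [be beP] := choice be_ex.
pose s1 : K := (-1) ^+ (d * d).
exists (s1 * s1 * (c' ^+ d * \prod_(z <- zs) be z)).
  rewrite !mulf_neq0 ?signr_eq0 ?expf_neq0 // prodf_seq_neq0.
  by apply/allP => z /beP[].
move=> P c ys r lP c0 szy uE rP e.
have -> : elim_res.@[line P q e] = s1 * (c ^+ d *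
    \prod_(y <- ys) evo (dotf (crs (line P q e) q') f) y).
  rewrite elim_resE -(resultant_forms c szy (dotf_homog _ fh)) -uE.
  congr form_resultant; apply: eq_dotf.
  by elim/ord3P; rewrite /crs /line /=; ring.
have -> : \prod_(y <- ys) evo (dotf (crs (line P q e) q') f) y =
    (\prod_(y <- ys) evo (dotf n f) y) * \prod_(y <- ys) (e - r y).
  rewrite -big_split; apply: eq_big_seq => y /rP[k k0 E] /=.
  by rewrite !evo_dotf !dotE /n /crs /= !E /line; ring.
have := evo_swap c c' ys zs; rewrite /= -uE -nE szy szz -/s1 => E.
rewrite [c ^+ d * _]mulrA E.
have -> : \prod_(z <- zs) evo (dotf (crs P q) f) z =
    dot P n ^+ d * \prod_(z <- zs) be z.
  rewrite -szz -prodM_size; apply: eq_big_seq => z /beP[_ H].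
  by rewrite evo_dotf H mulrC.
ring.
Qed.

End Projection.

Lemma section_params P q c ys : off_curve q -> nz (crs P q) ->
  dotf (crs P q) f = c *: \prod_(y <- ys) lf y ->
  exists r : option K -> K, {in ys, forall y, exists2 k, k != 0 &
    forall j, fo f y j = k * line P q (r y) j}.
Proof.
move=> qf nPq E; have H y : exists r, y \in ys -> exists2 k, k != 0 &
    forall j, fo f y j = k * line P q r j.
  have [yys|] := boolP (y \in ys); last by exists 0.
  have y0 : dot (crs P q) (fo f y) = 0.
    by rewrite -evo_dotf E evoZ; apply/eqP;
      rewrite mulf_eq0 evo_prod_lf yys orbT.
  by have [k [r [k0 rE]]] := span2 nPq y0 (@qf y); exists r => _; exists k.
by have [r rP] := choice H; exists r => y; apply: rP.
Qed.

Lemma uniq_params P q (r : option K -> K) (ys : seq (option K)) :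
  uniq ys -> {in ys, forall y, y \notin B} ->
  {in ys, forall y, exists2 k, k != 0 & forall j,
    fo f y j = k * line P q (r y) j} ->
  uniq [seq r y | y <- ys].
Proof.
move=> uy yB rP; rewrite map_inj_in_uniq // => y y' yy yy' E.
apply: inj; [exact: yB..|].
have [k k0 Ek] := rP y yy; have [k' k'0 Ek'] := rP y' yy'.
apply: (par_of_scale (k := k' / k)) => j; rewrite Ek' Ek E.
by rewrite mulrA divfK.
Qed.

Definition generic_base q n P := dot P n != 0 /\ exists c ys,
  [/\ c != 0, size ys = d, uniq ys,
      dotf (crs P q) f = c *: \prod_(y <- ys) lf y
    & {in ys, forall y, y \notin B}].

Lemma dense_base q q' : off_curve q -> nz (crs q q') ->
  dense (generic_base q (crs q q')).
Proof.
move=> qf nq; apply: (dense_lines nq) => P lP.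
have nPq : nz (crs P q).
  apply: not_par => pp; case/negP: lP; rewrite -dot_crs_rot dotE !pp !mul0r
    !addr0 //.
have [v [s [_ H]]] := generic_line B (ltnW d2) fh qf
  (section_neq0 d2 fh nc inj nPq) (oner_neq0 A).
by exists v, s => e /H.
Qed.

(** With q' chosen so that P.n != 0, [split_dvd] makes [elim_res] divide F times a power of the
    linear form of n. This form being prime and F irreducible, F is a constant multiple of
    [elim_res] divided by a power of it, and on the line that power is a nonzero constant. *)
Lemma F_line P q c ys : off_curve q -> nz (crs P q) -> c != 0 ->
  dotf (crs P q) f = c *: \prod_(y <- ys) lf y ->
  exists kap r, [/\ kap != 0,
    {in ys, forall y, exists2 k, k != 0 & forall j,
      fo f y j = k * line P q (r y) j}
    & forall e, F.@[line P q e] = kap * \prod_(y <- ys) (e - r y)].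
Proof.
move=> qf nPq c0 uE.
have [q' lP'] := exists_dot nPq; have lP : dot P (crs q q') != 0 by rewrite
  -dot_crs_rot.
have nq : nz (crs q q').
  apply: not_par => pp; case/negP: lP; rewrite dotE !pp !mulr0 !addr0 //.
have [kap0 kap00 HH] := elim_res_line qf nq.
set n := crs q q' in lP nq HH *; set H := elim_res q q' in HH.
have dn := dense_base qf nq.
pose a : A := kap0 *: linf n ^+ d.
have aE P0 : a.@[P0] = kap0 * dot P0 n ^+ d.
  by rewrite mevalZ rmorphXn /= meval_linf -/(dot n P0) dotC.
have sizeys c1 ys1 P1 : dotf (crs P1 q) f = c1 *: \prod_(y <- ys1) lf y ->
    c1 != 0 -> nz (crs P1 q) -> size ys1 = d.
  move=> E c10 nP1; have := section_neq0 d2 fh nc inj nP1.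
  move/(dhomog_uniq); apply; last exact: dotf_homog.
  by rewrite E dhomogZ // prod_lf_homog.
have nbase P0 : dot P0 n != 0 -> nz (crs P0 q).
  move=> l0; apply: not_par => pp; case/negP: l0;
    rewrite /n -dot_crs_rot dotE !pp.
  by rewrite !mul0r !addr0.
have [|k [Q E]] := @split_dvd _ H F a q d _ dn.
  move=> P0 [l0 [c1 [ys1 [c10 sz1 u1 E1 B1]]]]; split.
    by rewrite aE mulf_neq0 // expf_neq0.
  have [r rP] := section_params qf (nbase _ l0) E1.
  exists [seq r y | y <- ys1]; split.
  - exact: uniq_params rP.
  - by rewrite size_map.
  - by move=> e; rewrite (HH _ _ _ r l0 c10 sz1 E1 rP) aE big_map.
  move=> _ /mapP[y yy ->]; have [k k0 kE] := rP y yy.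
  exact: homog_zero_line k0 kE (Ff y).
have {}E : linf n ^+ (d * k) * F = ((kap0 ^+ k)^-1 *: Q) * H.
  rewrite -scalerAl -E /a exprZn -scalerAl scalerA mulVf ?expf_neq0 // scale1r.
  by rewrite exprM.
have [j [Q' [H' [FE HE]]]] := linf_power_factor nq E.
have lline P0 e : (linf n).@[line P0 q e] = dot P0 n.
  by rewrite meval_linf -/(dot _ _) !dotE /n /crs /line /=; ring.
have [_ _ /(_ _ _ FE)[/mpoly_unitP[c2 c20 Q'E]|/mpoly_unitP[c2 c20 H'E]]] :=
  Firr.
  have szy := sizeys _ _ _ uE c0 nPq.
  have [r rP] := section_params qf nPq uE.
  have dl0 : dot P n ^+ j != 0 by rewrite expf_neq0.
  exists (c2 / dot P n ^+ j * (kap0 * dot P n ^+ d)), r; split=> // [|e].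
    by rewrite !mulf_neq0 ?invr_neq0 ?expf_neq0.
  rewrite -[RHS]mulrA -(HH P c ys r lP c0 szy uE rP) HE FE Q'E !mevalM rmorphXn
    /=.
  rewrite lline mevalC; field.
  exact: dl0.
(* In the other case [elim_res] would be a nonzero constant times a power of the linear form of n.
   It would then have no zero on the line through q and a point of [generic_base], although it
   vanishes where this line meets the curve. *)
have [P0 [l0 [c1 [ys1 [c10 sz1 u1 E1 B1]]]]] : exists P0, generic_base q n P0.
  have [//|ne] := pselect (exists P0, generic_base q n P0).
  have /eqP : (1 : A) = 0; last by rewrite oner_eq0.
  by apply: dn => P0 HP0; case: ne; exists P0.
have [r rP] := section_params qf (nbase _ l0) E1.
case: ys1 sz1 u1 E1 B1 rP => [sz1|y ys1 sz1 u1 E1 B1 rP].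
  by move: d2; rewrite -sz1.
have := HH P0 c1 _ r l0 c10 sz1 E1 rP (r y).
rewrite big_cons subrr mul0r mulr0 HE H'E mevalM rmorphXn /= lline mevalC.
by move/eqP; rewrite mulf_eq0 expf_eq0 (negbTE l0) andbF (negbTE c20).
Qed.

End ImplicitEquation.

(** * Pullback of ternary forms, and the cross product of the partial derivatives *)

Section Pullback.
Variables (K : numClosedFieldType).
Implicit Types (f : 'I_3 -> {mpoly K[2]}) (G : {mpoly K[3]}) (o : option K).
Implicit Types (P q : 'I_3 -> K).

Definition pull f G : {mpoly K[2]} := mmap (@mpolyC 2 K) f G.

Lemma bev_pull f G s t : bev (pull f G) s t = G.@[fun i => bev (f i) s t].
Proof.
rewrite /bev /pull (rmorph_mmap (meval _)).
by apply: eq_mmap => [c|i] //=; rewrite mevalC.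
Qed.

Lemma evo_pull f G o : evo (pull f G) o = G.@[fo f o].
Proof. exact: bev_pull. Qed.

Lemma pull_homog d n f G : (forall i, f i \is d.-homog) -> G \is n.-homog ->
  pull f G \is (d * n).-homog.
Proof.
move=> fh Gh; rewrite /pull /mmap big_seq; apply: rpred_sum => m mG.
rewrite mul_mpolyC dhomogZ // -(dhomog_mf Gh mG) /= mdegE /mmap1 big_distrr /=.
elim/big_rec2: _ => [|i e p _ IH]; first exact: dhomog1.
by rewrite dhomogM // dhomogMn.
Qed.

Lemma pull_vanish d n f G : (forall i, f i \is d.-homog) -> G \is n.-homog ->
  (forall o, G.@[fo f o] = 0) -> pull f G = 0.
Proof.
move=> fh Gh G0; apply: (@form_vanish _ _ _ [::] (pull_homog fh Gh)) => o _.
by rewrite evo_pull.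
Qed.

Definition grad G (v : 'I_3 -> K) : 'I_3 -> K := fun i => (mderiv i G).@[v].
Definition fd (j : 'I_2) f : 'I_3 -> {mpoly K[2]} := fun i => mderiv j (f i).

Lemma chain_rule f G j o :
  evo (mderiv j (pull f G)) o = dot (grad G (fo f o)) (fo (fd j f) o).
Proof.
rewrite /pull mderiv_mmap evo_sum; apply: eq_bigr => i _.
by rewrite evoM -/(pull f _) evo_pull.
Qed.

(** For fixed v both sides are polynomials in l, and the coefficient of l^j on the left is the value
    at v of the component of degree j. *)
Lemma homog_of_scale k n (G : {mpoly K[k]}) :
  (forall l v, G.@[fun i => l * v i] = l ^+ n * G.@[v]) -> G \is n.-homog.
Proof.
move=> H; have [M GM] : exists M, (msize G <= M)%N by exists (msize G).
have E := pihomog_partitionE GM; rewrite E; apply: rpred_sum => j _.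
have [->|ne] := eqVneq (j : nat) n; first exact: pihomogP.
rewrite (_ : pihomog _ _ _ = 0) ?rpred0 //; apply: mpoly_vanish => v.
pose p : {poly K} := (\poly_(i < M) (pihomog mdeg i G).@[v]) - (G.@[v]) *: 'X^n.
have p0 : p = 0.
  apply: poly_vanish => l; rewrite hornerD hornerN hornerZ hornerXn horner_poly.
  apply/eqP; rewrite subr_eq0 [_ * l ^+ n]mulrC -H {2}E raddf_sum /=; apply/eqP.
  by apply: eq_bigr => i _; rewrite (meval_homog _ _ (pihomogP _ _ _)) mulrC.
have := congr1 (fun p : {poly K} => p`_j) p0.
by rewrite coefB coef_poly ltn_ord coefZ coefXn (negbTE ne) mulr0 subr0 coef0.
Qed.

Lemma coprime_section n f u (p : {mpoly K[3]}) : (forall i, f i \is n.-homog) ->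
  nocommon f -> dotf u f != 0 -> p != 0 ->
  exists v, p.@[v] != 0 /\ forall o, evo (dotf u f) o = 0 -> evo (dotf v f) o !=
    0.
Proof.
move=> fh nc u0 p0; have [c [ys [c0 _ E]]] := form_roots (dotf_homog u fh) u0.
have [v [pv vy]] := @avoid _ _ ys (fo f) p p0 (fun o _ => nc o).
exists v; split=> // o; rewrite E evoZ => /eqP; rewrite mulf_eq0 (negbTE c0).
by rewrite evo_prod_lf evo_dotf => /vy.
Qed.

Definition gf f : 'I_3 -> {mpoly K[2]} := crs (fd 0 f) (fd 1 f).

(** The Binet-Cauchy identity (u.a)(v.b) - (u.b)(v.a) = (u x v).(a x b), applied to the two partial
    derivatives of [f]. *)
Lemma jac_dotf f u v : jac (dotf u f) (dotf v f) = dotf (crs u v) (gf f).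
Proof.
rewrite /jac /dotf !raddf_sum /= !sum3 /gf /crs /fd /= !mderivZ -!mul_mpolyC.
rewrite !mpolyCB !mpolyCM; ring.
Qed.

Lemma gf_homog d f i : (forall i, f i \is d.-homog) ->
  gf f i \is (d.-1 + d.-1).-homog.
Proof.
move=> fh; have H (j k : 'I_2) (a b : 'I_3) :
    mderiv j (f a) * mderiv k (f b) \is (d.-1 + d.-1).-homog.
  by rewrite dhomogM // dhomog_mderiv.
by elim/ord3P: i; rewrite /gf /crs /fd /= rpredB.
Qed.

Lemma fo_gf f o i : fo (gf f) o i = crs (fo (fd 0 f) o) (fo (fd 1 f) o) i.
Proof. by elim/ord3P: i; rewrite /fo /gf /crs /= evoB !evoM. Qed.

Lemma gf_neq0 d f : (0 < d)%N -> (forall i, f i \is d.-homog) -> nocommon f ->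
  (exists u, dotf u f != 0) -> exists i, gf f i != 0.
Proof.
move=> d0 fh nc [u u0].
have [v [_ cop]] := coprime_section fh nc u0 (oner_neq0 _).
have := jac_neq0 d0 (dotf_homog u fh) (dotf_homog v fh) cop.
rewrite jac_dotf => nz0; have [//|H] := pselect (exists i, gf f i != 0).
case/negP: nz0; apply/eqP; apply: big1 => i _.
have [->|ne] := eqVneq (gf f i) 0; first by rewrite scaler0.
by case: H; exists i.
Qed.

Lemma line_swap n (G : {mpoly K[3]}) P q t : G \is n.-homog -> t != 0 ->
  G.@[line q P t] = t ^+ n * G.@[line P q t^-1].
Proof.
move=> Gh t0; rewrite -(meval_homog _ _ Gh); apply: meval_eq => i.
by rewrite /line mulrDr mulrA divff // mul1r addrC.
Qed.

(** The line seen from its point [q] at infinity: with t = 1/e, homogeneity gives G(q + t P) = t^n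
    G(P + e q). Clearing denominators yields a polynomial identity in t, which at t = 0 compares the
    degree [n] with the number of roots. *)
Lemma line_product_swap n (G : {mpoly K[3]}) P q kap (T : Type) (ys : seq T)
    (r : T -> K) : G \is n.-homog ->
  (forall e, G.@[line P q e] = kap * \prod_(y <- ys) (e - r y)) ->
  exists p1 p2 : {poly K},
    [/\ p1.[0] = G.@[q], p2.[0] = kap & 'X^(size ys) * p1 = 'X^n * p2].
Proof.
move=> Gh GE; pose p2 := kap *: \prod_(y <- ys) (1 - (r y) *: 'X).
exists (map_poly (meval q) (shift P G)), p2; split.
- by rewrite shiftE; apply: meval_eq => i; rewrite /line mul0r addr0.
- rewrite hornerZ horner_prod big1 ?mulr1 // => y _.
  by rewrite hornerD hornerN hornerZ hornerX mulr0 subr0 hornerC.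
apply/eqP; rewrite -subr_eq0; apply/eqP.
apply: (@poly_vanish_cofinite _ [:: 0]) => t; rewrite inE => t0.
rewrite hornerD hornerN !hornerM !hornerXn shiftE (line_swap _ _ Gh t0) GE.
rewrite hornerZ horner_prod.
have -> : \prod_(y <- ys) (1 - r y *: 'X).[t] =
    t ^+ size ys * \prod_(y <- ys) (t^-1 - r y).
  rewrite -prodM_size; apply: eq_bigr => y _.
  by rewrite mulrBr divff // hornerD hornerN hornerZ hornerX hornerC mulrC.
ring.
Qed.

Lemma polyXn_lreg m : GRing.lreg ('X^m : {poly K}).
Proof. by apply/mulfI; rewrite -size_poly_eq0 size_polyXn. Qed.

Lemma line_lead n (G : {mpoly K[3]}) P q kap (T : Type) (ys : seq T) (r : T ->
  K) :
  G \is n.-homog -> size ys = n ->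
  (forall e, G.@[line P q e] = kap * \prod_(y <- ys) (e - r y)) -> G.@[q] = kap.
Proof.
move=> Gh sz /(line_product_swap Gh)[p1 [p2 [<- <-]]].
by rewrite sz => /polyXn_lreg ->.
Qed.

Lemma exists_not_par q : nz q -> exists P, nz (crs P q).
Proof.
move=> [j qj]; have [//|H] := pselect (exists P, nz (crs P q)).
have p P : par P q by apply: nzPn => n; apply: H; exists P.
pose k : 'I_3 := if j == i30 then i31 else i30.
have kj : (j == k) = false by rewrite /k; case: (eqVneq j i30) => [->|/negbTE].
have := par_scale qj (par_sym (p (fun l => (l == k)%:R))) k.
by rewrite eqxx kj mul0r mul0r => /eqP; rewrite oner_eq0.
Qed.

Lemma off_nz f q : off_curve f q -> nz q.
Proof.
move=> qf; have [//|/nzPn q0] := pselect (nz q).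
case: (qf None); by elim/ord3P; rewrite /crs /= !q0 !mul0r subrr.
Qed.

End Pullback.

(** * Degree and ideal of the curve *)

Section CurveEquation.
Variables (K : numClosedFieldType) (d N : nat) (f : 'I_3 -> {mpoly K[2]}).
Variables (B : seq (option K)) (F : {mpoly K[3]}).
Hypothesis d2 : (1 < d)%N.
Hypothesis fh : forall i, f i \is d.-homog.
Hypothesis nc : nocommon f.
Hypothesis inj : inj_off f B.
Hypothesis Fh : F \is N.-homog.
Hypothesis Firr : irreducible_elt F.
Hypothesis Ff : forall o, F.@[fo f o] = 0.

Notation A := {mpoly K[3]}.
Implicit Types (P q : 'I_3 -> K) (o : option K).

Lemma off_curve_of q : F.@[q] != 0 -> off_curve f q.
Proof.
move=> Fq o /par_sym/(parP (nc o))[k E]; case/negP: Fq.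
by rewrite (meval_eq _ E) (meval_homog _ _ Fh) Ff mulr0.
Qed.

Lemma section_size P q c ys : nz (crs P q) ->
  dotf (crs P q) f = c *: \prod_(y <- ys) lf y -> size ys = d.
Proof.
move=> nP E; have u0 := section_neq0 d2 fh nc inj nP.
by apply: (dhomog_uniq u0 _ (dotf_homog _ fh));
  rewrite E dhomogZ // prod_lf_homog.
Qed.

Lemma F_nonroot : exists q, F.@[q] != 0.
Proof. by apply: mpoly_nonroot; case: Firr. Qed.

(** In [line_product_swap] the cofactors have the nonzero values F(q) and [kap] at t = 0, so the two
    powers of t in front of them agree. *)
Lemma curve_degree : N = d.
Proof.
have [q Fq] := F_nonroot; have qf := off_curve_of Fq.
have [P nP] := exists_not_par (off_nz qf).
have u0 := section_neq0 d2 fh nc inj nP.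
have [c [ys [c0 szy E]]] := form_roots (dotf_homog (crs P q) fh) u0.
have [kap [r [k0 _ FE]]] := F_line d2 fh nc inj Fh Firr Ff qf nP c0 E.
have [p1 [p2 [p1E p2E pE]]] := line_product_swap Fh FE; rewrite szy in pE.
have [lt|gt|//] := ltngtP N d.
  move: pE; rewrite -(subnKC (ltnW lt)) exprD -mulrA =>
    /polyXn_lreg/(congr1 (horner^~ 0)).
  rewrite hornerM hornerXn expr0n subn_eq0 leqNgt lt mul0r p2E => /esym/eqP.
  by rewrite (negbTE k0).
move: pE; rewrite -(subnKC (ltnW gt)) exprD -mulrA =>
  /polyXn_lreg/(congr1 (horner^~ 0)).
rewrite hornerM hornerXn expr0n subn_eq0 leqNgt gt mul0r p1E => /eqP.
by rewrite (negbTE Fq).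
Qed.

Lemma curve_homog : F \is d.-homog. Proof. by rewrite -curve_degree. Qed.

Lemma F_line_lead P q c ys kap r : nz (crs P q) ->
  dotf (crs P q) f = c *: \prod_(y <- ys) lf y ->
  (forall e, F.@[line P q e] = kap * \prod_(y <- ys) (e - r y)) -> F.@[q] = kap.
Proof. by move=> nP E; apply: line_lead curve_homog (section_size nP E). Qed.

(* F is squarefree on a general line through a point off the curve. *)
Lemma curve_ideal m (G : A) : G \is m.-homog -> pull f G = 0 ->
  exists Q, G = Q * F.
Proof.
move=> Gh G0; have [q Fq] := F_nonroot; have qf := off_curve_of Fq.
have [P nP] := exists_not_par (off_nz qf).
have [q' lq] := exists_dot nP.
have nq : nz (crs q q').
  apply: not_par => pp; case/negP: lq; rewrite dot_crs_rot dotE !pp !mulr0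
    !addr0 //.
have [|k [Q E]] := @split_dvd _ F G (F.@[q])%:MP q d _
    (dense_base d2 fh nc inj qf nq).
  move=> P0 [l0 [c1 [ys1 [c10 sz1 u1 E1 B1]]]]; rewrite mevalC; split=> //.
  have nP0 : nz (crs P0 q).
    apply: not_par => pp; case/negP: l0; rewrite -dot_crs_rot dotE !pp.
    by rewrite !mul0r !addr0.
  have [kap [r [k0 rP FE]]] := F_line d2 fh nc inj Fh Firr Ff qf nP0 c10 E1.
  exists [seq r y | y <- ys1]; split.
  - exact: uniq_params inj _ _ _ _ u1 B1 rP.
  - by rewrite size_map.
  - by move=> e; rewrite FE big_map (F_line_lead nP0 E1 FE).
  move=> _ /mapP[y yy ->]; have [k k0' kE] := rP y yy.
  apply: (homog_zero_line Gh k0' kE).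
  by rewrite -evo_pull G0 evo0.
exists (((F.@[q]) ^+ k)^-1 *: Q); rewrite -scalerAl -E.
rewrite -(rmorphXn (@mpolyC 3 K)) /= mul_mpolyC scalerA.
by rewrite mulVf ?expf_neq0 // scale1r.
Qed.

(** A partial derivative of F vanishing on the curve is a multiple of F, hence zero as its degree is
    d - 1. If all were zero, Euler's identity would give F = 0. *)
Lemma grad_pull_neq0 : exists i, pull f (mderiv i F) != 0.
Proof.
have [//|H] := pselect (exists i, pull f (mderiv i F) != 0).
have F0 : F != 0 by case: Firr.
suff D0 i : mderiv i F = 0.
  have := euler_homog curve_homog; rewrite big1 => [|i _];
    last by rewrite D0 mulr0.
  move/esym/eqP; rewrite scaler_eq0 (negbTE F0) pnatr_eq0 orbF => /eqP E.
  by move: d2; rewrite E.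
have p0 : pull f (mderiv i F) = 0.
  by apply/eqP/negPn/negP => ne; apply: H; exists i.
have dh := dhomog_mderiv i curve_homog.
have [Q E] := curve_ideal dh p0; apply/eqP; apply: contraT => D0.
have Q0 : Q != 0 by apply: contra D0; rewrite E => /eqP->; rewrite mul0r.
have := dhomog_divl F0 curve_homog; rewrite mulrC in E.
move=> /(_ d.-1 Q); rewrite -E dh => /(_ isT) Qh.
have := dhomogM curve_homog Qh; rewrite -E => Eh.
have := dhomog_uniq D0 dh Eh; move: d2; lia.
Qed.

End CurveEquation.

(** * Biduality *)

Section DualParametrization.
Variables (K : numClosedFieldType) (d e : nat) (f psi : 'I_3 -> {mpoly K[2]}).
Variables (B xs : seq (option K)).
Hypothesis d2 : (1 < d)%N.
Hypothesis fh : forall i, f i \is d.-homog.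
Hypothesis nc : nocommon f.
Hypothesis inj : inj_off f B.
Hypothesis psih : forall i, psi i \is e.-homog.
Hypothesis psinc : nocommon psi.
Hypothesis gE : forall i, gf f i = (\prod_(x <- xs) lf x) * psi i.

Notation A := {mpoly K[3]}.
Implicit Types (P q u v : 'I_3 -> K) (o : option K).

Lemma evo_dot (a b : 'I_3 -> {mpoly K[2]}) o :
  evo (dot a b) o = dot (fo a o) (fo b o).
Proof. by rewrite evo_sum; apply: eq_bigr => i _; rewrite evoM. Qed.

(** f_s x f_t is orthogonal to f_s and f_t, and the common factor h cancels. From this, Euler's
    identity gives f.psi = 0, and differentiation gives f.psi_s = f.psi_t = 0: the roles of f and
    psi are exchanged. *)
Lemma fd_psi j : dot (fd j f) psi = 0.
Proof.
apply: (mulfI (prod_lf_neq0 xs)); rewrite mulr0 big_distrr /=.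
rewrite (eq_bigr (fun i => fd j f i * gf f i)); last first.
  by move=> i _; rewrite gE mulrCA.
have [->|->] : j = 0 \/ j = 1.
  by case: j => -[|[|//]] jp; [left|right]; apply: val_inj.
  exact: dot_crsl.
exact: dot_crsr.
Qed.

Lemma f_psi : dot f psi = 0.
Proof.
have : d%:R *: dot f psi = 0.
  rewrite scaler_sumr.
  transitivity ('X_0 * dot (fd 0 f) psi + 'X_1 * dot (fd 1 f) psi).
    rewrite /dot !big_distrr -big_split; apply: eq_bigr => i _ /=.
    by rewrite scalerAl -(euler2 (fh i)) mulrDl !mulrA.
  by rewrite !fd_psi !mulr0 addr0.
by move/eqP; rewrite scaler_eq0 pnatr_eq0 (gtn_eqF (ltnW d2)) => /eqP.
Qed.

Lemma f_dpsi j : dot f (fd j psi) = 0.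
Proof.
have := congr1 (mderiv j) f_psi; rewrite mderivC raddf_sum /=.
under eq_bigr do rewrite mderivM.
by rewrite big_split /= -/(dot (fd j f) psi) fd_psi add0r.
Qed.

(** A constant psi would be a line containing the curve, by f.psi = 0. *)
Lemma dual_degree_gt0 : (0 < e)%N.
Proof.
rewrite lt0n; apply/eqP => e0.
have := section_neq0 d2 fh nc inj (psinc None); case/negP; apply/eqP.
rewrite -[RHS]f_psi /dotf /dot; apply: eq_bigr => i _.
have := psih i; rewrite e0 => h.
have -> : psi i = (evo (psi i) None)%:MP.
  by rewrite /evo (bev_form _ _ h) {1}(bformE h) !big_ord1 !subnn !expr0 !mulr1
     -[in RHS]alg_mpolyC.
by rewrite mulrC mul_mpolyC.
Qed.

Lemma exists_dpsi : exists i, gf psi i != 0.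
Proof.
apply: gf_neq0 dual_degree_gt0 psih psinc _.
have [i pi] := psinc None; exists (fun j => (j == i)%:R).
apply: contra pi => /eqP/(congr1 (fun p => evo p None)).
rewrite evo_dotf evo0 /dot (bigD1 i) //= eqxx mul1r big1 ?addr0 =>
  [->//|j /negbTE->].
by rewrite mul0r.
Qed.

Lemma orth_dpsi o w : nz (fo (gf psi) o) ->
  (forall j, dot w (fo (fd j psi) o) = 0) -> par (fo (gf psi) o) w.
Proof.
move=> n0 w0; have E i : fo (gf psi) o i =
    crs (fo (fd 0 psi) o) (fo (fd 1 psi) o) i by apply: fo_gf.
have n1 : nz (crs (fo (fd 0 psi) o) (fo (fd 1 psi) o)).
  by have [i ni] := n0; exists i; rewrite -E.
have p := orth_par n1 (w0 0) (w0 1).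
by move=> i; rewrite -(p i); elim/ord3P: i; rewrite /crs !E.
Qed.

Lemma f_par_dpsi o : nz (fo (gf psi) o) -> par (fo (gf psi) o) (fo f o).
Proof. by move=> n0; apply: orth_dpsi => // j;
  rewrite -evo_dot f_dpsi evo0. Qed.

Lemma roots_form n (G : {mpoly K[2]}) : G \is n.-homog -> G != 0 ->
  exists s : seq (option K), forall o, (evo G o == 0) = (o \in s).
Proof.
move=> Gh G0; have [c [ys [c0 _ E]]] := form_roots Gh G0.
by exists ys => o; rewrite E evoZ mulf_eq0 (negbTE c0) evo_prod_lf.
Qed.

Lemma exists_point (s : seq (option K)) : exists o, o \notin s.
Proof.
have [x xs'] := exists_notin (pmap id s); exists (Some x).
by apply: contra xs' => H; rewrite mem_pmap; apply/mapP; exists (Some x).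
Qed.

Lemma exists_dpsi_roots : exists s : seq (option K), forall o, o \notin s ->
  nz (fo (gf psi) o).
Proof.
have [i ni] := exists_dpsi.
have [s sP] := roots_form (gf_homog i psih) ni.
by exists s => o; rewrite -sP => H; exists i.
Qed.

(** If w.psi = 0 then w is orthogonal to psi_s and psi_t, as f is. So f is proportional to w at all
    but finitely many parameters, against injectivity. *)
Lemma dual_section_neq0 w : nz w -> dotf w psi != 0.
Proof.
move=> nw; apply/eqP => w0; have [s sP] := exists_dpsi_roots.
have wf o : o \notin s -> par w (fo f o).
  move=> os; have n0 := sP _ os.
  apply: (par_trans n0 _ (f_par_dpsi n0)); apply: par_sym.
  apply: orth_dpsi => // j.
  have : evo (mderiv j (dotf w psi)) o = 0 by rewrite w0 mderivC evo0.
  by rewrite raddf_sum evo_sum => E; rewrite -[RHS]E; apply: eq_bigr => i _;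
     rewrite /= mderivZ evoZ.
have [o oP] := exists_point (s ++ B).
have [o' o'P] := exists_point (o :: s ++ B).
move: oP o'P; rewrite inE !mem_cat !negb_or =>
  /andP[os oB] /andP[ne /andP[os' oB']].
case/eqP: ne; apply: inj => //; apply: (par_trans nw); last exact: wf.
by apply: par_sym; apply: wf.
Qed.

(* Biduality: if Phi is a form of minimal degree vanishing on psi, its gradient
   at a general psi(o) is proportional to psi_0 x psi_1, hence to f(o), so psi(o)
   determines f(o). *)
Lemma dual_inj_off n (Phi : A) : Phi \is n.-homog -> Phi != 0 ->
  (forall o, Phi.@[fo psi o] = 0) -> exists B', inj_off psi B'.
Proof.
move=> Ph P0 Pv.
pose good m := `[< exists G : A, [/\ G \is m.-homog,
  G != 0 & pull psi G = 0] >].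
have ex : exists m, good m.
  by exists n; apply/asboolP; exists Phi; split=> //;
    apply: pull_vanish psih Ph Pv.
case: (ex_minnP ex) => m /asboolP[G [Gh G0 Gv]] minm.
have dG i : (0 < m)%N -> pull psi (mderiv i G) = 0 -> mderiv i G = 0.
  move=> m0 p0; apply/eqP; apply: contraT => D0.
  have := minm m.-1; rewrite leqNgt prednK // leqnn => H.
  suff: good m.-1 by move/H.
  by apply/asboolP; exists (mderiv i G); rewrite dhomog_mderiv.
have m0 : (0 < m)%N.
  rewrite lt0n; apply: contra G0 => /eqP m0; rewrite m0 in Gh.
  have GC : G = (G@_0%MM)%:MP.
    apply/mpolyP => mm; rewrite mcoeffC.
    case: eqP => [->|/eqP ne]; first by rewrite mulr1.
    by rewrite (dhomog_nemf_coeff Gh) ?mulr0 // /= mdeg_eq0.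
  by move: Gv; rewrite GC /pull mmapC => /eqP; rewrite !mpolyC_eq0.
have [i ni] : exists i, pull psi (mderiv i G) != 0.
  have [//|H] := pselect (exists i, pull psi (mderiv i G) != 0).
  have : m%:R *: G = 0.
    rewrite -(euler_homog Gh) big1 // => i _; rewrite dG ?mulr0 //.
    by apply/eqP/negPn/negP => ne; apply: H; exists i.
  by move/eqP; rewrite scaler_eq0 (negbTE G0) pnatr_eq0 (gtn_eqF m0).
have [s1 s1P] := exists_dpsi_roots.
have [s2 s2P] := roots_form (pull_homog psih (dhomog_mderiv i Gh)) ni.
have key o : o \notin s1 ++ s2 ->
    nz (grad G (fo psi o)) /\ par (grad G (fo psi o)) (fo f o).
  rewrite mem_cat negb_or => /andP[os1 os2]; have n0 := s1P _ os1.
  split; first by exists i; rewrite /grad -evo_pull s2P.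
  apply: (par_trans n0 _ (f_par_dpsi n0)); apply: par_sym.
  by apply: orth_dpsi => // j; rewrite -chain_rule Gv mderivC evo0.
exists (s1 ++ s2 ++ B) => o w.
rewrite catA !(mem_cat _ (s1 ++ s2)) !negb_or => /andP[os oB] /andP[ws wB] p.
apply: inj => //; have [no po] := key o os; have [nw pw] := key w ws.
apply: (par_trans nw _ pw); apply: par_sym; apply: (par_trans no _ po).
have [k kE] := parP (psinc o) p; apply: par_sym.
apply: (par_of_scale (k := k ^+ m.-1)) => j.
by rewrite /grad (meval_eq _ kE) (meval_homog _ _ (dhomog_mderiv j Gh)).
Qed.

End DualParametrization.

(** * The factors of the discriminant *)

Section DiscriminantFactor.
Variables (K : numClosedFieldType) (d e : nat) (f psi : 'I_3 -> {mpoly K[2]}).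
Variables (B xs : seq (option K)).
Hypothesis d2 : (1 < d)%N.
Hypothesis fh : forall i, f i \is d.-homog.
Hypothesis nc : nocommon f.
Hypothesis inj : inj_off f B.
Hypothesis psih : forall i, psi i \is e.-homog.
Hypothesis psinc : nocommon psi.
Hypothesis gE : forall i, gf f i = (\prod_(x <- xs) lf x) * psi i.

Notation A := {mpoly K[3]}.
Implicit Types (P q u v : 'I_3 -> K) (o : option K).

Definition disc_form : A := form_disc d (generic_combination f).

Lemma disc_formE u : disc_form.@[u] = form_disc d (dotf u f).
Proof.
rewrite /disc_form -(form_disc_map (meval u)).
  rewrite (map_genf f (fun i => 'X_i)); congr form_disc; apply: eq_dotf => i.
  by rewrite mevalXU.
rewrite -(rmorph_nat (@mpolyC 3 K)); apply: rmorph_unit.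
by rewrite unitfE pnatr_eq0 expn_eq0 (gtn_eqF (ltnW d2)).
Qed.

Lemma disc_form_homog : disc_form \is (d.-1 + d.-1).-homog.
Proof.
apply: homog_of_scale => l v; rewrite !disc_formE -form_discZ; congr form_disc.
by rewrite /dotf scaler_sumr; apply: eq_bigr => i _; rewrite scalerA.
Qed.

Definition coprime_lines u v :=
  forall o, evo (dotf u f) o = 0 -> evo (dotf v f) o != 0.

Lemma disc_form_line u v c ws : coprime_lines u v -> c != 0 ->
  dotf (crs u v) psi = c *: \prod_(w <- ws) lf w ->
  exists2 C, C != 0 & forall r, disc_form.@[line u v r] =
    C * \prod_(w <- xs ++ ws) dot (line u v r) (fo f w).
Proof.
move=> cop c0 E.
have [|C C0 CE] := disc_pencil d2 (dotf_homog u fh) (dotf_homog v fh) cop _ c0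
   (ws := xs ++ ws).
  rewrite jac_dotf big_cat /= scalerAr -E /dotf big_distrr; apply: eq_bigr =>
    i _.
  by rewrite gE scalerAr.
exists C => // r; rewrite disc_formE dotfD CE; congr (_ * _).
apply: eq_bigr => w _; rewrite !evo_dotf /line !dotE; ring.
Qed.

Lemma crs_coprime u v : coprime_lines u v -> dotf (crs u v) psi != 0.
Proof.
move=> cop; have := jac_neq0 (ltnW d2) (dotf_homog u fh) (dotf_homog v fh) cop.
rewrite jac_dotf; apply: contra => /eqP E;
  rewrite -(mulr0 (\prod_(x <- xs) lf x)) -E.
by rewrite /dotf big_distrr; apply/eqP/eq_bigr => i _ /=; rewrite gE scalerAr.
Qed.

Lemma exists_orth v : nz v -> exists w, nz w /\ dot w v = 0.
Proof.
move=> /exists_not_par[t nt]; exists (crs t v); split=> //.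
by rewrite dotC dot_crsr.
Qed.

Definition point_line o : A := linf (fo f o).

Lemma meval_point_line o u : (point_line o).@[u] = dot u (fo f o).
Proof. by rewrite meval_linf dotC. Qed.

Lemma point_line_neq0 o : point_line o != 0.
Proof. by have [i ni] := nc o; apply: linf_neq0 ni. Qed.

Definition line_prod u v (s : seq (option K)) : {poly K} :=
  \prod_(y <- s) ((dot u (fo f y))%:P + (dot v (fo f y)) *: 'X).

Lemma line_prodE u v s r :
  (line_prod u v s).[r] = \prod_(y <- s) dot (line u v r) (fo f y).
Proof.
rewrite horner_prod; apply: eq_bigr => y _.
by rewrite hornerD hornerC hornerZ hornerX !dotE /line; ring.
Qed.

Lemma line_prod_neq0 u v s : coprime_lines u v -> line_prod u v s != 0.
Proof.
move=> cop; rewrite prodf_seq_neq0; apply/allP => y _ /=.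
apply/eqP => E; have := cop y; rewrite !evo_dotf.
have := congr1 (fun p : {poly K} => p`_0) E.
rewrite coefD coefC coefZ coefX mulr0 addr0 coef0 => -> /(_ erefl).
have := congr1 (fun p : {poly K} => p`_1) E.
by rewrite coefD coefC coefZ coefX mulr1 add0r coef0 => ->; rewrite eqxx.
Qed.

(* Restrict to a line through a general point of the hyperplane of [x], where
   the discriminant splits into linear factors. *)
Lemma disc_form_prefix xs1 xs2 : xs = xs1 ++ xs2 ->
  exists E, disc_form = (\prod_(x <- xs1) point_line x) * E.
Proof.
(* The factors are removed one by one because distinct or repeated roots of h may have the same
   image: once the earlier factors are cancelled on the line, the factor of [x] is still there. *)
elim/last_ind: xs1 xs2 => [|xs1 x IH] xs2 xsE.
  by exists disc_form; rewrite big_nil mul1r.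
have [|E DE] := IH (x :: xs2); first by rewrite xsE cat_rcons.
suff [Q EQ] : exists Q, E = point_line x * Q.
  by exists Q; rewrite -cats1 big_cat big_seq1 DE EQ /= mulrA.
have van u : nz u -> dot u (fo f x) = 0 -> E.@[u] = 0.
  move=> nu ux; have u0 := section_neq0 d2 fh nc inj nu.
  have [v [_ cop]] := coprime_section fh nc u0 (oner_neq0 A).
  have [c [ws [c0 _ wE]]] := form_roots (dotf_homog _ psih) (crs_coprime cop).
  have [C _ CE] := disc_form_line cop c0 wE.
  have LE r : (\prod_(y <- xs1) point_line y).@[line u v r] = (line_prod u v
    xs1).[r].
    by rewrite line_prodE rmorph_prod; apply: eq_bigr => y _;
      rewrite /= meval_point_line.
  have := @line_cancel _ _ E u v _ (C *: line_prod u v (x :: xs2 ++ ws))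
    (line_prod_neq0 xs1 cop) LE.
  have H r : (\prod_(y <- xs1) point_line y).@[line u v r] * E.@[line u v r] =
      (line_prod u v xs1).[r] * (C *: line_prod u v (x :: xs2 ++ ws)).[r].
    have := CE r; rewrite DE mevalM => ->; rewrite hornerZ !line_prodE.
    by rewrite xsE cat_rcons -catA big_cat /= mulrCA.
  move=> /(_ H 0); rewrite hornerZ line_prodE big_cons.
  have E0 : line u v 0 =1 u by move=> i; rewrite /line mul0r addr0.
  rewrite (meval_eq _ E0) => ->.
  rewrite (_ : dot (line u v 0) (fo f x) = 0) ?mul0r ?mulr0 //.
  by rewrite -[RHS]ux; apply: eq_bigr => i _; rewrite E0.
have [i ni] := nc x; apply: (linf_dvd ni) => u ux.
have ux' : dot u (fo f x) = 0 by rewrite dotC.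
have [nu|/nzPn u0] := pselect (nz u); first exact: van.
(* The zero vector defines no section; E vanishes there because it vanishes at all nonzero multiples
   of a vector [w] of the hyperplane. *)
have [w [nw wx]] := exists_orth (nc x).
have p0 : map_poly (meval u) (shift w E) = 0.
  apply: (@poly_vanish_cofinite _ [:: 0]) => r; rewrite inE => r0;
    rewrite shiftE.
  apply: van.
    have [j nj] := nw; exists j.
    by rewrite /line u0 add0r mulf_neq0.
  transitivity (dot u (fo f x) + r * dot w (fo f x));
    last by rewrite ux' wx mulr0 addr0.
  by rewrite /line !dotE; ring.
have := shiftE w E u 0; rewrite p0 horner0 => ->.
by apply: meval_eq => j; rewrite /line mul0r addr0.
Qed.

Variable Fd : A.
Variable Nd : nat.
Hypothesis Fdh : Fd \is Nd.-homog.
Hypothesis Fdirr : irreducible_elt Fd.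
Hypothesis Fdpsi : forall o, Fd.@[fo psi o] = 0.
Hypothesis sizes : (size xs + e)%N = (d.-1 + d.-1)%N.

(** The cofactor E of the point lines has degree e. On a general line of direction q its roots are
    the parameters of the points psi(w), distinct because psi is generically injective by biduality,
    and Fd vanishes at them. So E divides a constant times Fd and, having positive degree, equals
    the irreducible Fd up to a constant. *)
Theorem disc_factorization : exists2 c, c != 0 &
  disc_form = c *: (Fd * \prod_(x <- xs) point_line x).
Proof.
have [|E DE] := @disc_form_prefix xs [::]; first by rewrite cats0.
set L := \prod_(x <- xs) _ in DE *.
have L0 : L != 0 by rewrite prodf_seq_neq0; apply/allP => y _;
  apply: point_line_neq0.
have Lh : L \is (size xs).-homog.
  rewrite /L; elim: (xs) => [|y l IH]; first by rewrite big_nil dhomog1.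
  rewrite big_cons (@dhomogM _ _ _ 1) // /point_line /linf rpred_sum // => i _.
  by rewrite dhomogZ // dhomogX /= mdeg1.
have Eh : E \is e.-homog.
  have := @dhomog_divl _ _ (d.-1 + d.-1) _ _ E L0 Lh.
  by rewrite -DE disc_form_homog -sizes addKn => /(_ isT).
have [B' injpsi] : exists B', inj_off psi B'.
  by apply: dual_inj_off d2 fh nc inj psih psinc gE Nd Fd Fdh _ Fdpsi;
    case: Fdirr.
have e0 := dual_degree_gt0 d2 fh nc inj psih psinc gE.
have psineq := dual_section_neq0 d2 fh nc inj psih psinc gE.
have D0 : disc_form != 0.
  have u0 := section_neq0 d2 fh nc inj (nc None).
  have [v [_ cop]] := coprime_section fh nc u0 (oner_neq0 A).
  have [c [ws [c0 _ wE]]] := form_roots (dotf_homog _ psih) (crs_coprime cop).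
  have [C C0 CE] := disc_form_line cop c0 wE.
  have : C *: line_prod (fo f None) v (xs ++ ws) != 0.
    by rewrite scaler_eq0 negb_or C0 line_prod_neq0.
  apply: contra => /eqP D0; apply/eqP/poly_vanish => r.
  by rewrite hornerZ line_prodE -CE D0 meval0.
have E0 : E != 0 by apply: contra D0; rewrite DE => /eqP->; rewrite mulr0.
have Fd0 : Fd != 0 by case: Fdirr.
have [q] := mpoly_nonroot (mulf_neq0 E0 Fd0).
rewrite mevalM mulf_eq0 => /norP[Eq Fdq].
have qpsi : off_curve psi q := off_curve_of psinc Fdh Fdpsi Fdq.
have nq := off_nz qpsi.
have [q' nqq'] := exists_not_par nq.
have nn : nz (crs q q').
  by have [i ni] := nqq'; exists i; rewrite crs_anti oppr_eq0.
(* The first condition makes [disc_form_line] available; the second makes the points of psi on the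
   line distinct. *)
pose Om P := coprime_lines P q /\ exists c ws, [/\ c != 0, size ws = e, uniq ws,
  dotf (crs P q) psi = c *: \prod_(y <- ws) lf y & {in ws, forall y,
    y \notin B'}].
have qf0 := section_neq0 d2 fh nc inj nq.
have [cq [zs [cq0 _ zE]]] := form_roots (dotf_homog q fh) qf0.
have dOm : dense Om.
  apply: (dense_lines nn) => P lP.
  have nP : nz (crs P q).
    apply: not_par => pp; case/negP: lP; rewrite -dot_crs_rot dotE !pp.
    by rewrite !mul0r !addr0.
  have p0 : \prod_(z <- zs) point_line z != 0.
    by rewrite prodf_seq_neq0; apply/allP => y _; apply: point_line_neq0.
  have [v [s [pv H]]] := generic_line B' e0 psih qpsi (psineq _ nP) p0.
  exists v, ([seq - dot P (fo f z) / dot v (fo f z) | z <- zs] ++ s) => r.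
  rewrite mem_cat negb_or => /andP[rz rs] _; split; last exact: H.
  move=> o Po; apply/eqP => qo.
  have oz : o \in zs.
    by rewrite -evo_prod_lf; move/eqP: qo;
      rewrite zE evoZ mulf_eq0 (negbTE cq0).
  case/negP: rz; apply/mapP; exists o => //.
  have vo : dot v (fo f o) != 0.
    move: pv; rewrite rmorph_prod prodf_seq_neq0 => /allP/(_ o oz) /=.
    by rewrite meval_point_line.
  apply: (canRL (mulfK vo)); apply/eqP; rewrite -addr_eq0 addrC.
  by move: Po; rewrite evo_dotf => <-; rewrite /line !dotE; apply/eqP; ring.
have [|k [Q QE]] := @split_dvd _ E Fd (E.@[q])%:MP q e _ dOm.
  move=> P [cop [c [ws [c0 szw uw wE wB]]]]; rewrite mevalC; split=> //.
  have [C C0 CE] := disc_form_line cop c0 wE.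
  have nP : nz (crs P q).
    apply: not_par => pp; have := crs_coprime cop; case/negP; apply/eqP.
    by apply: big1 => i _; rewrite pp scale0r.
  have [r rP] := section_params qpsi nP wE.
  have fpsi o : dot (fo psi o) (fo f o) = 0.
    by rewrite dotC -evo_dot (f_psi d2 fh gE) evo0.
  (* P + r_w q represents psi(w), which is orthogonal to f(w). Therefore (P + t q).f(w) = (t - r_w)
     q.f(w), the linear factor of E belonging to [w]. *)
  have rf w : w \in ws -> dot (line P q (r w)) (fo f w) = 0.
    move=> /rP[m m0 mE]; apply: (mulfI m0); rewrite mulr0 -[RHS](fpsi w).
    by rewrite !dotE !mE; ring.
  have qw w : w \in ws -> dot q (fo f w) != 0.
    move=> /rf; have := cop w; rewrite !evo_dotf.
    have [q0|//] := eqVneq (dot q (fo f w)) 0.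
    move=> H E1; apply: H; rewrite -[RHS]E1.
    transitivity (dot P (fo f w) + r w * dot q (fo f w));
      first by rewrite q0 mulr0 addr0.
    by rewrite /line !dotE; ring.
  pose kap := C * \prod_(w <- ws) dot q (fo f w).
  have Lq (t : K) : L.@[line P q t] = \prod_(x <- xs) dot (line P q t) (fo f x).
    by rewrite rmorph_prod; apply: eq_bigr => y _; rewrite /= meval_point_line.
  have EL t : E.@[line P q t] = kap * \prod_(w <- ws) (t - r w).
    pose p : {poly K} := kap *: \prod_(w <- ws) ('X - (r w)%:P).
    have pE t' : p.[t'] = kap * \prod_(w <- ws) (t' - r w).
      by rewrite hornerZ horner_prod; congr (_ * _); apply: eq_bigr => w _;
        rewrite hornerXsubC.
    have H t' : L.@[line P q t'] * E.@[line P q t'] = (line_prod P q xs).[t'] *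
      p.[t'].
      have := CE t'; rewrite DE mevalM => ->.
      rewrite line_prodE big_cat /= mulrCA pE /kap -mulrA -big_split;
        congr (_ * (_ * _)).
      apply: eq_big_seq => w ww /=.
      have := rf w ww; rewrite /line !dotE => H.
      apply/eqP; rewrite -subr_eq0 -[X in _ == X]H; apply/eqP; ring.
    rewrite -pE; apply: (line_cancel (line_prod_neq0 xs cop) _ H) => t'.
    by rewrite Lq line_prodE.
  exists [seq r w | w <- ws]; split.
  - exact: uniq_params injpsi _ _ _ _ uw wB rP.
  - by rewrite size_map.
  - by move=> t; rewrite EL big_map (line_lead Eh szw EL).
  move=> _ /mapP[w ww ->]; have [m m0 mE] := rP w ww.
  exact: (homog_zero_line Fdh m0 mE (Fdpsi w)).
set a := E.@[q] in Eq QE; have ak0 : a ^+ k != 0 by rewrite expf_neq0.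
have FdE : Fd = ((a ^+ k)^-1 *: Q) * E.
  rewrite -scalerAl -QE -(rmorphXn (@mpolyC 3 K)) /= mul_mpolyC scalerA.
  by rewrite mulVf // scale1r.
have [_ _ /(_ _ _ FdE)[] /mpoly_unitP[c c0 cE]] := Fdirr; last first.
  have E0h : E \is 0.-homog by rewrite cE -alg_mpolyC dhomogZ // dhomog1.
  by move: e0; rewrite (dhomog_uniq E0 Eh E0h).
exists c^-1; first by rewrite invr_eq0.
rewrite FdE cE mul_mpolyC -scalerAl scalerA mulVf // scale1r mulrC.
by rewrite DE.
Qed.

End DiscriminantFactor.

(** * Multiplicities *)

Section LocalMultiplicity.
Variable K : numClosedFieldType.
Implicit Types (o : option K).

Lemma lf_exponent_le o a b (u v : {mpoly K[2]}) :
  lf o ^+ a * u = lf o ^+ b * v -> evo u o != 0 -> (b <= a)%N.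
Proof.
move=> E u0; rewrite leqNgt; apply/negP => ab; case/negP: u0.
have l0 : lf o ^+ a != 0 by rewrite expf_neq0 // lf_neq0.
move: E; rewrite -(subnKC (ltnW ab)) exprD -mulrA => /(mulfI l0) ->.
by rewrite -(subnSK ab) exprS !evoM (eqP (_ : evo (lf o) o == 0)) ?evo_lf_eq0
  ?mul0r.
Qed.

Lemma evo_coprime_prod o (s : seq (option K)) :
  evo (\prod_(y <- s | y != o) lf y) o != 0.
Proof.
rewrite evo_prod prodf_seq_neq0; apply/allP => y _.
by apply/implyP => yz; rewrite evo_lf_eq0.
Qed.

End LocalMultiplicity.

Section LocalBranch.
Variables (K : numClosedFieldType) (d : nat) (f psi : 'I_3 -> {mpoly K[2]}).
Variables (B xs : seq (option K)).
Hypothesis d2 : (1 < d)%N.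
Hypothesis fh : forall i, f i \is d.-homog.
Hypothesis nc : nocommon f.
Hypothesis inj : inj_off f B.
Hypothesis psinc : nocommon psi.
Hypothesis gE : forall i, gf f i = (\prod_(x <- xs) lf x) * psi i.
Implicit Types (P q u v : 'I_3 -> K) (o : option K).

(* Near [o], f = f_i p / p_i + (lf o)^k M / p_i with p = f(o) and M(o) not
   proportional to p; then f_0 x f_1 vanishes at [o] to the order k - 1. *)
Lemma local_order o : exists Nv : 'I_3 -> K, nz (crs (fo f o) Nv) /\
  forall u, dot u (fo f o) = 0 -> exists2 Q,
    dotf u f = lf o ^+ (count_mem o xs).+1 * Q & evo Q o = dot u Nv.
Proof.
have [i pi0] := nc o; set p := fo f o in pi0 *.
pose be j : {mpoly K[2]} := p i *: f j - p j *: f i.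
have beh j : be j \is d.-homog by rewrite rpredB // dhomogZ.
have dotbe u : dot u p = 0 -> dotf u be = p i *: dotf u f.
  move=> up; rewrite /dotf scaler_sumr.
  transitivity (\sum_j (p i *: (u j *: f j) - (u j * p j) *: f i)).
    apply: eq_bigr => j _.
    by rewrite /be scalerBr !scalerA [u j * p i]mulrC.
  by rewrite sumrB -scaler_suml -/(dot u p) up scale0r subr0.
have [u0 [nu0 u0p]] := exists_orth (nc o).
have bene : exists j, be j != 0.
  have [//|H] := pselect (exists j, be j != 0).
  have b0 j : be j = 0 by apply/eqP/negPn/negP => ne; apply: H; exists j.
  have := dotbe _ u0p; rewrite /dotf big1 => [|j _]; last by rewrite b0 scaler0.
  move/esym/eqP; rewrite scaler_eq0 (negbTE pi0) /=.
  by rewrite (negbTE (section_neq0 d2 fh nc inj nu0)).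
have [xs' [N0 [_ _ N0nc beE]]] := family_gcd beh bene.
set m := count_mem o xs'; pose R := \prod_(y <- xs' | y != o) lf y.
have [M ME] : exists M : 'I_3 -> {mpoly K[2]}, forall j, M j = R * N0 j.
  by exists (fun j => R * N0 j).
have R0 : evo R o != 0 by apply: evo_coprime_prod.
have bM j : be j = lf o ^+ m * M j by rewrite ME beE (prod_lf_split xs' o)
  mulrA.
have m0 : (0 < m)%N.
  have [j nj] := N0nc o; rewrite lt0n; apply: contra nj => /eqP m0.
  have : evo (be j) o = 0 by rewrite evoB !evoZ mulrC -/(p i) -/(p j) subrr.
  rewrite bM m0 expr0 mul1r ME evoM => /eqP; rewrite mulf_eq0 (negbTE R0).
  by move/eqP => E; apply/eqP.
have nM : nz (fo M o).
  by have [j nj] := N0nc o; exists j; rewrite /fo ME evoM mulf_neq0.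
have Mi : M i = 0.
  have l0 : lf o ^+ m != 0 by rewrite expf_neq0 // lf_neq0.
  by apply: (mulfI l0); rewrite -bM mulr0 /be subrr.
have npM : nz (crs p (fo M o)).
  apply: not_par => pp; have [j nj] := nM.
  have := par_scale pi0 pp j; rewrite /fo Mi evo0 !mul0r => E.
  by rewrite /fo E eqxx in nj.
suff cm : (count_mem o xs).+1 = m.
  exists (fun j => (p i)^-1 * fo M o j); split.
    have [j nj] := npM; exists j.
    rewrite (_ : crs _ _ _ = (p i)^-1 * crs p (fo M o) j) ?mulf_neq0 ?invr_neq0
      //.
    by move: (j); elim/ord3P; rewrite /crs /=; ring.
  move=> u up; exists ((p i)^-1 *: dotf u M).
    apply: (can_inj (scalerK pi0)); rewrite -dotbe // cm -scalerAr scalerA divff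
      //.
    rewrite scale1r /dotf big_distrr; apply: eq_bigr => j _ /=.
    by rewrite bM scalerAr.
  rewrite evoZ evo_dotf /dot big_distrr; apply: eq_bigr => j _ /=.
  by rewrite mulrCA.
have fE j : (p i)%:MP * f j = (p j)%:MP * f i + lf o ^+ m * M j.
  by rewrite -bM /be !mul_mpolyC addrC subrK.
case: (m) m0 fE => // k _ fE.
set L := lf o in fE *; set a := f i in fE.
have dE (t : 'I_2) j : (p i)%:MP * mderiv t (f j) = (p j)%:MP * mderiv t a +
    (k.+1%:R * (mderiv t L * L ^+ k) * M j + L ^+ k * L * mderiv t (M j)).
  have := congr1 (mderiv t) (fE j); rewrite mderivD !mderivM !mderivC !mul0r
    !add0r.
  by rewrite mderivXn scaler_nat exprSr mulr_natl.
pose pc j : {mpoly K[2]} := (p j)%:MP.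
(* T is what remains of p_i^2 (f_0 x f_1), expanded by [dE], after division by L^k. At o only its
   first term survives, and Euler's identity evaluates it to (k + 1) d f_i(o) times p x M(o), which
   is nonzero. *)
pose T j := k.+1%:R * (mderiv 0 a * mderiv 1 L - mderiv 1 a * mderiv 0 L) * crs
  pc M j +
  L * (crs pc (fun j => mderiv 0 a * mderiv 1 (M j) - mderiv 1 a * mderiv 0 (M
    j)) j +
    L ^+ k * (k.+1%:R * (mderiv 0 L * crs M (fd 1 M) j + mderiv 1 L * crs (fd 0
      M) M j)
    + L * crs (fd 0 M) (fd 1 M) j)).
have gT j : ((p i)%:MP * (p i)%:MP) * gf f j = L ^+ k * T j.
  have g2 (x0 x1 y0 y1 : {mpoly K[2]}) :
    ((p i)%:MP * (p i)%:MP) * (x0 * y1 - x1 * y0) =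
    ((p i)%:MP * x0) * ((p i)%:MP * y1) - ((p i)%:MP * x1) * ((p i)%:MP * y0) by
      ring.
  by move: (j); elim/ord3P; rewrite /gf /T /crs /fd /pc /= g2 !dE; ring.
have To : nz (fo T o).
  have [j nj] := npM; exists j.
  rewrite /fo /T evoD !evoM (eqP (_ : evo L o == 0)) ?evo_lf_eq0 // mul0r addr0.
  have -> : evo (crs pc M j) o = crs p (fo M o) j.
    by move: (j); elim/ord3P; rewrite /crs /= evoB !evoM /fo /pc /evo /bev
      !mevalC.
  rewrite !mulf_neq0 //.
    by rewrite /evo /bev rmorph_nat pnatr_eq0.
  rewrite evoB !evoM /L mderiv0_lf mderiv1_lf.
  have -> : evo (px o)%:MP o = px o by rewrite /evo /bev mevalC.
  have -> : evo (- (py o)%:MP) o = - py o by rewrite /evo /bev mevalN mevalC.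
  rewrite mulrN opprK mulrC [_ * py o]mulrC (euler_evo o (fh i)).
  by rewrite mulf_neq0 // pnatr_eq0 -lt0n (ltnW d2).
have gX j : ((p i)%:MP * (p i)%:MP) * gf f j =
    L ^+ count_mem o xs * ((p i * p i) *: (\prod_(y <- xs | y != o) lf y * psi
      j)).
  by rewrite gE (prod_lf_split xs o) -!mul_mpolyC -/L mpolyCM; ring.
apply/eqP; rewrite eqSS eqn_leq; apply/andP; split.
  have [j nj] := To; apply: lf_exponent_le nj; rewrite -gT gX; reflexivity.
have [j nj] := psinc o.
have := @lf_exponent_le _ o (count_mem o xs) k
  ((p i * p i) *: (\prod_(y <- xs | y != o) lf y * psi j)) (T j).
rewrite -gX -gT => /(_ erefl); apply.
by rewrite evoZ evoM !mulf_neq0 // evo_coprime_prod.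
Qed.

(** The parameters over P are roots of the section by any line through P. *)
Lemma fiber_list P : nz P -> exists X : seq (option K),
  uniq X /\ forall o, o \in X <-> par P (fo f o).
Proof.
move=> nP; have [u [nu uP]] := exists_orth nP.
have [c [ys [c0 _ uE]]] := form_roots (dotf_homog u fh) (section_neq0 d2 fh nc
  inj nu).
exists (undup [seq o <- ys | `[< par P (fo f o) >] ]); rewrite undup_uniq;
  split=> // o.
rewrite mem_undup mem_filter; split=> [/andP[/asboolP]//|p].
rewrite (introT (asboolP _) p) /= -evo_prod_lf.
have [k kE] := parP nP p; have := evo_dotf u f o.
rewrite uE evoZ (_ : dot u _ = 0); last first.
  transitivity (k * dot u P); last by rewrite uP mulr0.
  by rewrite !dotE !kE; ring.
by move/eqP; rewrite mulf_eq0 (negbTE c0).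
Qed.

Lemma section_count o u c ys : dot u (fo f o) = 0 -> c != 0 ->
  dotf u f = c *: \prod_(y <- ys) lf y ->
  (count_mem o xs < count_mem o ys)%N.
Proof.
move=> uo c0 uE; have [Nv [_ /(_ u uo)[Q QE _]]] := local_order o.
apply: (@lf_exponent_le _ o _ _ (c *: \prod_(y <- ys | y != o) lf y) Q).
  by rewrite -QE uE (prod_lf_split ys o) scalerAr.
by rewrite evoZ mulf_neq0 // evo_coprime_prod.
Qed.

End LocalBranch.

Lemma count_mem_sum (T : eqType) (X s : seq T) : uniq X ->
  count (mem X) s = (\sum_(o <- X) count_mem o s)%N.
Proof.
move=> uX; elim: s => [|y s IH] /=; first by rewrite big1.
rewrite big_split /= -IH; congr (_ + _)%N.
rewrite -(count_uniq_mem y uX) -sum1_count big_mkcond; apply: eq_bigr => o _ /=.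
by rewrite eq_sym; case: eqP.
Qed.

Section OrderAt0.
Variable K : numClosedFieldType.
Implicit Types g : {mpoly K[2]}.

Lemma mcoeff_pihomog g m : (pihomog mdeg (mdeg m) g)@_m = g@_m.
Proof.
have [M gM] : exists M, (maxn (msize g) (mdeg m).+1 <= M)%N.
  by exists (maxn (msize g) (mdeg m).+1).
have gM' : (msize g <= M)%N by apply: leq_trans gM; rewrite leq_maxl.
have mM : (mdeg m < M)%N by apply: leq_trans gM; rewrite leq_maxr.
have := congr1 (mcoeff m) (pihomog_partitionE gM').
rewrite (raddf_sum (mcoeff m)) /= (bigD1 (Ordinal mM)) //= => ->.
rewrite big1 ?addr0 // => j ne.
rewrite (dhomog_nemf_coeff (pihomogP mdeg j g)) //=.
by apply: contra ne => /eqP E; apply/eqP/val_inj.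
Qed.

Lemma bigmin_le (T : eqType) (s : seq T) (F : T -> nat) x m : m \in s ->
  (\big[minn/x]_(i <- s) F i <= F m)%N.
Proof.
elim: s => //= y s IH; rewrite inE big_cons => /orP[/eqP->|/IH H].
  exact: geq_minl.
exact: leq_trans (geq_minr _ _) H.
Qed.

Lemma order_at0_eq g M : (forall j, (j < M)%N -> pihomog mdeg j g = 0) ->
  pihomog mdeg M g != 0 -> order_at0 g = M.
Proof.
move=> low top; have supp m : m \in msupp g -> (M <= mdeg m)%N.
  rewrite mcoeff_msupp -mcoeff_pihomog; case: leqP => // /low ->.
  by rewrite mcoeff0 eqxx.
have [m mM] : exists m, m \in msupp (pihomog mdeg M g).
  case E : (msupp (pihomog mdeg M g)) => [|m s]; last by exists m;
    rewrite mem_head.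
  by move: E => /eqP; rewrite msupp_eq0 (negbTE top).
have dm : mdeg m = M := dhomog_mf (pihomogP mdeg M g) mM.
have mg : m \in msupp g.
  by rewrite mcoeff_msupp -mcoeff_pihomog dm -mcoeff_msupp.
apply/eqP; rewrite eqn_leq; apply/andP; split.
  by rewrite -dm; apply: bigmin_le.
(* The default value [msize g] of the minimum exceeds the degree of every monomial, so it does not
   affect the bound. *)
rewrite /order_at0 big_seq.
apply: (big_ind (fun n => (M <= n)%N)) => [|x y Mx My|m' m'g].
- by rewrite -dm ltnW // msize_mdeg_lt.
- by rewrite leq_min Mx.
exact: supp.
Qed.

Lemma pihomog_line g v : exists p : {poly K}, forall j,
  p`_j = (pihomog mdeg j g).@[v] /\
  forall e, p.[e] = g.@[fun k => e * v k].
Proof.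
have [M gM] : exists M, (msize g <= M)%N by exists (msize g).
exists (\poly_(j < M) (pihomog mdeg j g).@[v]) => j; split.
  rewrite coef_poly; case: ltnP => // Mj.
  rewrite pihomogE big1_seq ?meval0 // => m /andP[/eqP dm mg].
  by have := leq_trans (msize_mdeg_lt mg) gM; rewrite /= dm ltnNge Mj.
move=> e; rewrite horner_poly [in RHS](pihomog_partitionE gM) raddf_sum.
by apply: eq_bigr => i _; rewrite /= (meval_homog _ _ (pihomogP _ _ _)) mulrC.
Qed.

End OrderAt0.

Section Multiplicity.
Variables (K : numClosedFieldType) (d : nat) (f psi : 'I_3 -> {mpoly K[2]}).
Variables (B xs : seq (option K)) (F : {mpoly K[3]}) (Nf : nat).
Hypothesis d2 : (1 < d)%N.
Hypothesis fh : forall i, f i \is d.-homog.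
Hypothesis nc : nocommon f.
Hypothesis inj : inj_off f B.
Hypothesis psinc : nocommon psi.
Hypothesis gE : forall i, gf f i = (\prod_(x <- xs) lf x) * psi i.
Hypothesis Fh : F \is Nf.-homog.
Hypothesis Firr : irreducible_elt F.
Hypothesis Ff : forall o, F.@[fo f o] = 0.
Implicit Types (P q u v : 'I_3 -> K) (o : option K) (X : seq (option K)).

Definition is_fiber P X := uniq X /\ forall o, o \in X <-> par P (fo f o).
Definition fiber_mult X := (\sum_(o <- X) (count_mem o xs).+1)%N.

(** In the splitting of F along P + e q, the roots equal to 0 come from the parameters over P. Their
    number is the order of F on the line at P, and each o counts at least 1 + ord_o h times by
    [section_count]. As these are orders of vanishing of the section, any factorization of it gives
    the same numbers. *)
Lemma line_order P q X : is_fiber P X -> F.@[q] != 0 -> nz (crs P q) ->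
  exists n (p : {poly K}), [/\ p.[0] != 0,
    forall e, F.@[line P q e] = e ^+ n * p.[e], (fiber_mult X <= n)%N &
    forall c ys, c != 0 -> dotf (crs P q) f = c *: \prod_(y <- ys) lf y ->
      n = (\sum_(o <- X) count_mem o ys)%N].
Proof.
move=> [uX XP] Fq nP; have qf := off_curve_of nc Fh Ff Fq.
have [c [ys [c0 _ E]]] :=
  form_roots (dotf_homog _ fh) (section_neq0 d2 fh nc inj nP).
have [kap [r [k0 rP FE]]] := F_line d2 fh nc inj Fh Firr Ff qf nP c0 E.
have r0 y : y \in ys -> (r y == 0) = (y \in X).
  move=> yys; have [k k0' kE] := rP y yys; apply/idP/idP => [/eqP ry|/XP p].
    apply/XP; apply: (par_of_scale (k := k)) => j.
    by rewrite kE /line ry mul0r addr0.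
  have [i ni] := nP; have := p i.
  have -> : crs P (fo f y) i = k * r y * crs P q i.
    by elim/ord3P: (i); rewrite /crs /= !kE /line; ring.
  by move/eqP; rewrite !mulf_eq0 (negbTE k0') (negbTE ni) orbF.
exists (count (mem X) ys), (kap *: \prod_(y <- ys | y \notin X) ('X - (r
  y)%:P)).
split.
- rewrite hornerZ mulf_neq0 // horner_prod prodf_seq_neq0; apply/allP => y yys.
  apply/implyP => yX; rewrite hornerXsubC sub0r oppr_eq0 r0 //.
- move=> e; rewrite FE hornerZ mulrCA; congr (_ * _).
  rewrite horner_prod (bigID (mem X)) /=; congr (_ * _); last first.
    by apply: eq_bigr => y _; rewrite hornerXsubC.
  rewrite big_seq_cond (eq_bigr (fun=> e)); last first.
    by move=> y /andP[yys yX]; move: (r0 y yys); rewrite yX => /eqP->;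
      rewrite subr0.
  by rewrite -big_seq_cond big_const_seq; elim: (count _ _) => //= n ->;
    rewrite exprS.
- rewrite (count_mem_sum _ uX) /fiber_mult !big_seq; apply: leq_sum => o oX.
  apply: (section_count d2 fh nc inj psinc gE _ c0 E).
  have /(parP _)[|k kE] := (XP o).1 oX.
    have [i ni] := nP; have [//|/nzPn P0] := pselect (nz P).
    by move: ni; elim/ord3P: (i); rewrite /crs /= !P0 !mul0r subrr eqxx.
  transitivity (k * dot (crs P q) P); first by rewrite !dotE !kE; ring.
  by rewrite dotC dot_crsl mulr0.
move=> c' ys' c'0 E'; rewrite (count_mem_sum _ uX); apply: eq_bigr => o _.
have cnt c1 ys1 c2 ys2 : c1 != 0 -> c2 != 0 ->
    c1 *: \prod_(y <- ys1) lf y = c2 *: \prod_(y <- ys2) lf y ->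
    (count_mem o ys1 <= count_mem o ys2)%N.
  move=> c10 c20 EE; apply: (@lf_exponent_le _ o _ _
    (c2 *: \prod_(y <- ys2 | y != o) lf y) (c1 *: \prod_(y <- ys1 | y != o) lf
      y)).
    by rewrite -!scalerAr -!prod_lf_split.
  by rewrite evoZ mulf_neq0 // evo_coprime_prod.
apply/eqP; rewrite eqn_leq.
by rewrite (cnt _ _ _ _ c0 c'0) ?(cnt _ _ _ _ c'0 c0) // -E -E'.
Qed.

(** f(o) and [Nv o] span the tangent line of the curve along the parameter o. For a line through P
    that is none of these tangents, the section vanishes at each o over P to order exactly 1 + ord_o
    h. *)
Lemma line_order_generic : exists Nv : option K -> 'I_3 -> K,
  (forall o, nz (crs (fo f o) (Nv o))) /\
  forall P q X, is_fiber P X -> F.@[q] != 0 -> nz (crs P q) ->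
  {in X, forall o, dot (crs P q) (Nv o) != 0} ->
  exists p : {poly K}, p.[0] != 0 /\
    forall e, F.@[line P q e] = e ^+ fiber_mult X * p.[e].
Proof.
have /choice[Nv NvP] := local_order d2 fh nc inj psinc gE.
exists Nv; split=> [o|P q X Xf Fq nP Nq]; first by case: (NvP o).
have [n [p [p0 pE _ nE]]] := line_order Xf Fq nP.
exists p; split=> // e; rewrite pE; congr (_ ^+ _ * _).
have [c [ys [c0 _ E]]] :=
  form_roots (dotf_homog _ fh) (section_neq0 d2 fh nc inj nP).
rewrite (nE c ys c0 E) /fiber_mult !big_seq; apply: eq_bigr => o oX.
have [_ H] := NvP o; have [|Q QE Qo] := H (crs P q).
  have /(parP _)[|k kE] := (Xf.2 o).1 oX.
    have [i ni] := nP; have [//|/nzPn P0] := pselect (nz P).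
    by move: ni; elim/ord3P: (i); rewrite /crs /= !P0 !mul0r subrr eqxx.
  transitivity (k * dot (crs P q) P); first by rewrite !dotE !kE; ring.
  by rewrite dotC dot_crsl mulr0.
have EE : lf o ^+ (count_mem o xs).+1 * Q =
    lf o ^+ count_mem o ys * (c *: \prod_(y <- ys | y != o) lf y).
  by rewrite -QE E (prod_lf_split ys o) scalerAr.
apply/eqP; rewrite eqn_leq; apply/andP; split.
  by apply: lf_exponent_le EE _; rewrite Qo Nq.
apply: lf_exponent_le (esym EE) _.
by rewrite evoZ mulf_neq0 // evo_coprime_prod.
Qed.

Lemma shift_coef1 q P (G : {mpoly K[3]}) :
  (map_poly (meval P) (shift q G))`_1 = dot (grad G P) q.
Proof.
have [T [TE TD TM]] : exists T : {mpoly K[3]} -> {poly K},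
    [/\ forall G, T G = map_poly (meval P) (shift q G),
        {morph T : u w / u + w} & {morph T : u w / u * w}].
  exists (fun G => map_poly (meval P) (shift q G)); split=> // u w.
    rewrite -rmorphD; congr (map_poly _ _).
    by rewrite /shift -(mmapD _ ((@polyC {mpoly K[3]}) \o (@mpolyC 3 K))).
  rewrite -rmorphM; congr (map_poly _ _).
  exact: (rmorphM (mmap ((@polyC {mpoly K[3]}) \o (@mpolyC 3 K)) _)).
rewrite -TE.
suff [] : (T G)`_0 = G.@[P] /\ (T G)`_1 = dot (grad G P) q by [].
elim/mpoly_alg_ind: G => [c|i|u w [u0 u1] [w0 w1]|u w [u0 u1] [w0 w1]].
- rewrite TE (@eq_map_shift _ q _ P c%:P) => [|e];
  last by rewrite mevalC hornerC.
  rewrite !coefC mevalC; split=> //; rewrite /dot big1 // => i _.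
  by rewrite /grad mderivC meval0 mul0r.
- rewrite TE (@eq_map_shift _ q _ P ((P i)%:P + (q i) *: 'X)) => [|e];
  last first.
    by rewrite mevalXU hornerD hornerC hornerZ hornerX mulrC.
  rewrite !coefD !coefC !coefZ !coefX mevalXU mulr0 addr0 mulr1 add0r; split=>
    //.
  rewrite /dot (bigD1 i) //= /grad mderivXU eqxx meval1 mul1r big1 ?addr0 // =>
    j ne.
  by rewrite mderivXU (negbTE ne) meval0 mul0r.
- rewrite TD !coefD u0 w0 u1 w1 mevalD; split=> //.
  by rewrite /dot -big_split; apply: eq_bigr => i _;
    rewrite /= /grad mderivD mevalD mulrDl.
rewrite TM !coefM big_ord1 subnn u0 w0 mevalM; split=> //.
have E i : grad (u * w) P i = grad u P i * w.@[P] + u.@[P] * grad w P i.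
  by rewrite /grad mderivM mevalD !mevalM.
by rewrite big_ord_recl big_ord1 /= u0 w0 u1 w1 !dotE !E; ring.
Qed.

End Multiplicity.

Section Chart.
Variable K : fieldType.

Definition chart_dir (i : 'I_3) (v : 'I_2 -> K) (j : 'I_3) : K :=
  if unlift i j is Some k then v k else 0.

Lemma chart_dir_lift i v k : chart_dir i v (fintype.lift i k) = v k.
Proof. by rewrite /chart_dir liftK. Qed.

Lemma chart_dir_id i v : chart_dir i v i = 0.
Proof. by rewrite /chart_dir unlift_none. Qed.

Lemma dot_chart_dir i v (w : 'I_3 -> K) :
  dot (chart_dir i v) w = \sum_k w (fintype.lift i k) * v k.
Proof.
rewrite /dot (bigD1_ord i) //= chart_dir_id mul0r add0r.
by apply: eq_bigr => k _; rewrite chart_dir_lift mulrC.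
Qed.

Lemma germ_chartE (F : {mpoly K[3]}) (P : 'rV[K]_3) i v :
  (germ_chart F P i).@[v] = F.@[fun j => P 0 j / P 0 i + chart_dir i v j].
Proof.
rewrite /germ_chart comp_mpoly_meval; apply: meval_eq => j.
rewrite tnth_mktuple mevalD mevalC /chart_dir; congr (_ + _).
by case: unliftP => [k|] _; rewrite ?mevalXU ?meval0.
Qed.

End Chart.

Section Singular.
Variables (K : numClosedFieldType) (d : nat) (f psi : 'I_3 -> {mpoly K[2]}).
Variables (B xs : seq (option K)) (F : {mpoly K[3]}) (Nf : nat).
Hypothesis d2 : (1 < d)%N.
Hypothesis fh : forall i, f i \is d.-homog.
Hypothesis nc : nocommon f.
Hypothesis inj : inj_off f B.
Hypothesis psinc : nocommon psi.
Hypothesis gE : forall i, gf f i = (\prod_(x <- xs) lf x) * psi i.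
Hypothesis Fh : F \is Nf.-homog.
Hypothesis Firr : irreducible_elt F.
Hypothesis Ff : forall o, F.@[fo f o] = 0.
Implicit Types (p q : 'I_3 -> K) (o : option K) (X : seq (option K)).
Implicit Types (P : 'rV[K]_3).

Definition vec P : 'I_3 -> K := fun j => P 0 j.

Lemma fiber_par p p' X : nz p -> nz p' -> par p p' -> is_fiber f p X -> is_fiber
  f p' X.
Proof.
move=> np np' pp [uX XP]; split=> // o; split=> [/XP|H]; last first.
  by apply/XP; apply: par_trans pp H.
by apply: par_trans => //; apply: par_sym.
Qed.

(** Otherwise X_i divides F, so F is X_i up to a constant and the curve lies on a line. *)
Lemma hyperplane_nonroot i : exists v : 'I_2 -> K, F.@[chart_dir i v] != 0.
Proof.
have [//|H] := pselect (exists v : 'I_2 -> K, F.@[chart_dir i v] != 0).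
pose e (j : 'I_3) : K := (j == i)%:R.
have ei : e i != 0 by rewrite /e eqxx oner_eq0.
have [v|Q FQ] := @linf_dvd _ _ e i F ei.
  rewrite (bigD1 i) //= /e eqxx mul1r big1 ?addr0 => [vi|j /negbTE->];
    last first.
    by rewrite mul0r.
  rewrite (@meval_eq _ _ _ (chart_dir i (fun k => v (fintype.lift i k)))) =>
    [|j].
    by apply/eqP/negPn/negP => h; apply: H; eexists; exact: h.
  by have [k ->|->] := unliftP i j; rewrite ?chart_dir_lift ?chart_dir_id.
have [_ _ /(_ _ _ FQ)[]] := Firr => /mpoly_unitP[c c0 cE].
  have := congr1 (meval (fun=> 0)) cE; rewrite meval_linf mevalC.
  by rewrite big1 => [/esym/eqP|j _]; rewrite ?(negbTE c0) ?mulr0.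
have ni : nz e by exists i.
have := section_neq0 d2 fh nc inj ni; case/negP; apply/eqP.
apply: (@form_vanish _ _ _ [::] (dotf_homog _ fh)) => o _; rewrite evo_dotf.
have := Ff o; rewrite FQ cE mevalM mevalC meval_linf => /eqP.
by rewrite mulf_eq0 (negbTE c0) orbF => /eqP.
Qed.

(** In a direction v of the chart, F has order exactly [fiber_mult xs X] at P unless v is tangent
    along some parameter over P or its point at infinity lies on the curve. Both exceptions are
    excluded where [del] is nonzero. So the components of the germ of smaller degree vanish on a
    dense set of directions, hence identically, while the next one does not. *)
Lemma multiplicity_fiber P X : P != 0 -> is_fiber f (vec P) X ->
  multiplicity F P = fiber_mult xs X.
Proof.
move=> P0 XP; rewrite /multiplicity /germ; case: pickP => [i Pi|none];
  last first.
  by case/eqP: P0; apply/rowP => j; rewrite mxE; have /negbFE/eqP := none j.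
pose P' j := P 0 j / P 0 i.
have P'i : P' i = 1 by rewrite /P' divff.
have nP' : nz P' by exists i; rewrite P'i oner_eq0.
have nP : nz (vec P) by exists i.
have X'P : is_fiber f P' X.
  apply: (fiber_par nP nP' _ XP); apply: (par_of_scale (k := (P 0 i)^-1)) => j.
  by rewrite /P' mulrC.
have [Nv [NvP ord]] := line_order_generic d2 fh nc inj psinc gE Fh Firr Ff.
(* Coefficients of the linear form in v that vanishes when v is tangent along the parameter o. *)
pose lo o (k : 'I_2) := crs (Nv o) P' (fintype.lift i k).
have loE o v : dot (crs P' (chart_dir i v)) (Nv o) = (linf (lo o)).@[v].
  rewrite meval_linf -dot_chart_dir !dotE /crs /=; ring.
have lo0 o : o \in X -> linf (lo o) != 0.
  move=> oX; have pf : par P' (fo f o) by apply/X'P.2.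
  have [k kE] := parP nP' pf.
  have [l nl] : nz (crs (Nv o) P').
    have [l nl] := NvP o; exists l; apply: contra nl => /eqP E.
    by rewrite (crs_scale_anti _ _ kE) E mulr0.
  have [k' nk'] : exists k', lo o k' != 0.
    have [//|H] := pselect (exists k', lo o k' != 0).
    have z k' : lo o k' = 0 by apply/eqP/negPn/negP => ne; apply: H; exists k'.
    have : dot (crs (Nv o) P') P' = 0 by rewrite dotC dot_crsr.
    rewrite /dot (bigD1_ord i) //= big1 ?addr0 => [|k' _];
      last by rewrite -/(lo o k') z mul0r.
    rewrite P'i mulr1 => ci; case/negP: nl; apply/eqP.
    by have [j ->|->] := unliftP i l; [exact: z|].
  exact: linf_neq0 nk'.
pose sg (j : 'I_3) : {mpoly K[2]} := if unlift i j is Some k then 'X_k else 0.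
pose pF := mmap (@mpolyC 2 K) sg F.
have pFE v : pF.@[v] = F.@[chart_dir i v].
  rewrite /pF (rmorph_mmap (meval v)); apply: eq_mmap => [c|j] /=.
    by rewrite mevalC.
  by rewrite /sg /chart_dir; case: unlift => [k|]; rewrite ?mevalXU ?meval0.
pose del := pF * \prod_(o <- X) linf (lo o).
have del0 : del != 0.
  rewrite mulf_neq0 //.
    have [v Fv] := hyperplane_nonroot i.
    by apply: contra Fv => /eqP E; rewrite -pFE E meval0.
  by rewrite prodf_seq_neq0; apply/allP => o /lo0.
set g := germ_chart F P i.
have main v : del.@[v] != 0 -> (forall j, (j < fiber_mult xs X)%N ->
    (pihomog mdeg j g).@[v] = 0) /\ (pihomog mdeg (fiber_mult xs X) g).@[v] !=
      0.
  rewrite mevalM mulf_eq0 pFE rmorph_prod => /norP[Fv].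
  rewrite prodf_seq_neq0 => /allP Nvv.
  have nq := off_nz (off_curve_of nc Fh Ff Fv).
  have nPq : nz (crs P' (chart_dir i v)).
    apply: not_par => pp; have P'i0 : P' i != 0 by rewrite P'i oner_eq0.
    have [j] := nq; rewrite (par_scale P'i0 pp j) chart_dir_id mul0r mul0r.
    by rewrite eqxx.
  have [|p [p0 pE]] := ord P' _ X X'P Fv nPq.
    by move=> o /Nvv /=; rewrite loE.
  have [r rE] := pihomog_line g v.
  have rX : r = 'X^(fiber_mult xs X) * p.
    apply/eqP; rewrite -subr_eq0; apply/eqP/poly_vanish => e.
    rewrite hornerD hornerN hornerM hornerXn -pE (rE 0%N).2 germ_chartE.
    apply/eqP; rewrite subr_eq0; apply/eqP/meval_eq => j;
      rewrite /line /P' /chart_dir.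
    by case: unlift => [k|]; rewrite ?mulr0.
  split=> [j jM|]; rewrite -(rE _).1 rX coefXnM ?jM // ltnn subnn.
  by rewrite -horner_coef0.
apply: order_at0_eq => [j jM|].
  apply/eqP; suff : pihomog mdeg j g * del == 0.
    by rewrite mulf_eq0 (negbTE del0) orbF.
  apply/eqP/mpoly_vanish => v; rewrite mevalM.
  have [->|/main[H _]] := eqVneq del.@[v] 0; first by rewrite mulr0.
  by rewrite H ?mul0r.
have [v /main[_]] := mpoly_nonroot del0.
by apply: contra => /eqP->; rewrite meval0.
Qed.

(** The coefficient of e in F(p + e q) is grad F(p).q. If [fiber_mult xs X] is at least 2 it
    vanishes for every q off the curve, and such q are dense. Conversely, for a general q the order
    of F(p + e q) is exactly [fiber_mult xs X], so a zero gradient excludes the value 1. *)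
Lemma grad_fiber p o1 X : nz p -> is_fiber f p X -> par p (fo f o1) ->
  (forall i, (mderiv i F).@[p] = 0) <-> (1 < fiber_mult xs X)%N.
Proof.
move=> np XP po1.
have Fp : F.@[p] = 0.
  have [k kE] := parP (nc o1) (par_sym po1).
  by rewrite (meval_eq _ kE) (meval_homog _ _ Fh) Ff mulr0.
have M0 : (0 < fiber_mult xs X)%N.
  by rewrite /fiber_mult (bigD1_seq o1) ?XP.1 //=; apply/XP.2.
have coef1 q n (r : {poly K}) : (forall e, F.@[line p q e] = e ^+ n * r.[e]) ->
    dot (grad F p) q = ('X^n * r)`_1.
  move=> E; rewrite -shift_coef1 (@eq_map_shift _ _ _ _ ('X^n * r)) // => e.
  by rewrite E hornerM hornerXn.
split=> [g0|M2 i].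
  have [Nv [NvP ord]] := line_order_generic d2 fh nc inj psinc gE Fh Firr Ff.
  have [t nt] := exists_not_par np.
  have l0 : \prod_(o <- X) linf (crs (Nv o) p) != 0.
    rewrite prodf_seq_neq0; apply/allP => o oX /=.
    have [k kE] := parP np ((XP.2 o).1 oX).
    have [l nl] := NvP o.
    suff : crs (Nv o) p l != 0 by exact: linf_neq0.
    apply: contra nl => /eqP E.
    by rewrite (crs_scale_anti _ _ kE) E mulr0.
  have F0 : F != 0 by case: Firr.
  have [q] := mpoly_nonroot (mulf_neq0 F0 l0).
  rewrite mevalM mulf_eq0 rmorph_prod => /norP[Fq].
  rewrite prodf_seq_neq0 => /allP Nq.
  have npq : nz (crs p q).
    apply: not_par => pp; have [k kE] := parP np pp; case/negP: Fq.
    by rewrite (meval_eq _ kE) (meval_homog _ _ Fh) Fp mulr0.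
  have [|r [r0 rE]] := ord p q X XP Fq npq.
    move=> o /Nq; rewrite /= meval_linf => H; apply: contra H => /eqP E;
      apply/eqP.
    by rewrite -[RHS]E -/(dot _ q) !dotE /crs /=; ring.
  have := coef1 _ _ _ rE; rewrite /dot big1 => [|i _];
    last by rewrite /grad g0 mul0r.
  move=> /esym E; rewrite ltn_neqAle M0 andbT eq_sym.
  apply: contra_eqN E => /eqP ->; rewrite expr1 coefXM /=.
  by rewrite -horner_coef0.
have g0 q : F.@[q] != 0 -> dot (grad F p) q = 0.
  move=> Fq; have npq : nz (crs p q).
    apply: not_par => pp; have [k kE] := parP np pp; case/negP: Fq.
    by rewrite (meval_eq _ kE) (meval_homog _ _ Fh) Fp mulr0.
  have [n [r [r0 rE le _]]] :=
    line_order d2 fh nc inj psinc gE Fh Firr Ff XP Fq npq.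
  by rewrite (coef1 _ _ _ rE) coefXnM (leq_trans M2 le).
have F0 : F != 0 by case: Firr.
have : linf (grad F p) * F = 0.
  apply: mpoly_vanish => q; rewrite mevalM meval_linf -/(dot (grad F p) q).
  by have [->|/g0 ->] := eqVneq F.@[q] 0; rewrite ?mulr0 ?mul0r.
move/eqP; rewrite mulf_eq0 (negbTE F0) orbF => /eqP l0.
apply/eqP/negPn/negP => gi; have := @linf_neq0 _ _ (grad F p) i gi.
by rewrite l0 eqxx.
Qed.

End Singular.

Lemma linear_dependence (K : fieldType) (T : finType) (m : nat)
    (phi : T -> 'I_m -> K) : (m < #|T|)%N ->
  exists c : T -> K, (exists t, c t != 0) /\ forall j, \sum_t c t * phi t j = 0.
Proof.
move=> mT; pose M := \matrix_(i < #|T|, j < m) phi (enum_val i) j.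
have [u un0 uM] : exists2 u : 'rV_#|T|, u != 0 & u *m M = 0.
  have k0 : kermx M != 0.
    rewrite -mxrank_eq0 mxrank_ker subn_eq0 -ltnNge.
    by apply: leq_ltn_trans (rank_leq_col M) mT.
  have [i ri] : exists i, row i (kermx M) != 0.
    apply/existsP; rewrite -[X in is_true X]negbK negb_exists; apply: contra k0.
    move=> /forallP H; apply/eqP/row_matrixP => i.
    by rewrite row0; apply/eqP/negbNE.
  by exists (row i (kermx M)) => //; rewrite -row_mul mulmx_ker row0.
exists (fun t => u 0 (enum_rank t)); split.
  have [j uj] : exists j, u 0 j != 0.
    apply/existsP; rewrite -[X in is_true X]negbK negb_exists;
      apply: contra un0.
    by move=> /forallP H; apply/eqP/rowP => j; rewrite mxE; apply/eqP/negbNE.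
  by exists (enum_val j); rewrite enum_valK.
move=> j; have := congr1 (fun A : 'rV_m => A 0 j) uM; rewrite !mxE => E.
rewrite -[RHS]E (reindex (enum_val : 'I_#|T| -> T)) /=; last first.
  by exists enum_rank => t _; rewrite ?enum_rankK ?enum_valK.
by apply: eq_bigr => i _; rewrite enum_valK mxE.
Qed.

(** * The rational inverse of a parametrization *)

Section RationalInverse.
Variables (K : numClosedFieldType) (d : nat) (f : 'I_3 -> {mpoly K[2]}).
Variables (B : seq (option K)) (F : {mpoly K[3]}) (Nf : nat).
Hypothesis d2 : (1 < d)%N.
Hypothesis fh : forall i, f i \is d.-homog.
Hypothesis nc : nocommon f.
Hypothesis inj : inj_off f B.
Hypothesis Fh : F \is Nf.-homog.
Hypothesis Firr : irreducible_elt F.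
Hypothesis Ff : forall o, F.@[fo f o] = 0.
Notation A := {mpoly K[3]}.
Implicit Types (P q : 'I_3 -> K) (o : option K).

Lemma linf_homog (u : 'I_3 -> K) : linf u \is 1.-homog.
Proof. by rewrite rpred_sum // => i _; rewrite dhomogZ // dhomogX /= mdeg1. Qed.

Lemma homog_coef_eq0 n (G : {mpoly K[2]}) : G \is n.-homog ->
  (forall j : 'I_n.+1, G@_(mnm2 (n - j) j) = 0) -> G = 0.
Proof.
by move=> Gh G0; rewrite (bformE Gh) big1 // => k _; rewrite G0 scale0r.
Qed.

(* A combination of these monomials has degree < d along the lines through a
   point q off the curve, which meet the curve in d points. *)
Lemma independent_family n : (d <= n)%N ->
  exists M : 'I_d * 'I_(n - d).+1 -> A, (forall t, M t \is n.-homog) /\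
  forall c, pull f (\sum_t c t *: M t) = 0 -> forall t, c t = 0.
Proof.
move=> dn; have [q Fq] := F_nonroot Firr; have qf := off_curve_of nc Fh Ff Fq.
have nq := off_nz qf.
have [m0] := exists_dot nq; rewrite dotC => mq.
have [t1 nt1] := exists_not_par nq.
have nt1' : nz (crs q t1).
  by have [i ni] := nt1; exists i; rewrite crs_anti oppr_eq0.
have [t2 D0] := exists_dot nt1'; set D := dot _ _ in D0.
pose n1 := crs q t1; pose n2 := crs q t2.
pose M (t : 'I_d * 'I_(n - d).+1) : A :=
  linf m0 ^+ t.1 * (linf n1 ^+ t.2 * linf n2 ^+ (n - t.1 - t.2)).
have Mh t : M t \is n.-homog.
  have ph (u : 'I_3 -> K) k : linf u ^+ k \is k.-homog.
    by have := dhomogMn k (linf_homog u); rewrite mul1n.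
  have mh x y z k : (x + (y + z))%N = k ->
      linf m0 ^+ x * (linf n1 ^+ y * linf n2 ^+ z) \is k.-homog.
    by move=> <-; rewrite !dhomogM.
  by apply: mh; have := ltn_ord t.1; have := ltn_ord t.2; move: dn; lia.
exists M; split=> [//|c].
set G := \sum_t _ => G0.
have n2' : nz (crs q t2).
  have [//|/nzPn z] := pselect (nz (crs q t2)).
  case/negP: D0; apply/eqP; rewrite /D.
  transitivity (- dot (crs q t2) t1); first by rewrite !dotE /crs /=; ring.
  by rewrite dotE !z !mul0r !addr0 oppr0.
pose g (j : 'I_d) : A := \sum_(a < (n - d).+1) c (j,
  a) *: (linf n1 ^+ a * linf n2 ^+ (n - j - a)).
have GE P e : G.@[line P q e] =
    \sum_(j < d) (dot m0 P + e * dot m0 q) ^+ j * (g j).@[P].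
  have lE (u : 'I_3 -> K) : (linf u).@[line P q e] = dot u P + e * dot u q.
    by rewrite meval_linf -/(dot u _) !dotE /line; ring.
  have n1q : dot n1 q = 0 by rewrite dotC dot_crsl.
  have n2q : dot n2 q = 0 by rewrite dotC dot_crsl.
  rewrite (eq_bigr (fun j : 'I_d => \sum_(a < (n - d).+1)
      (dot m0 P + e * dot m0 q) ^+ j * (c (j, a) *:
         (linf n1 ^+ a * linf n2 ^+ (n - j - a))).@[P])); last first.
    by move=> j _; rewrite /g raddf_sum big_distrr.
  rewrite pair_bigA /G raddf_sum; apply: eq_bigr => -[j a] _ /=.
  rewrite !mevalZ !mevalM !rmorphXn /= !lE n1q n2q !mulr0 !addr0.
  by rewrite !meval_linf -!/(dot _ _) mulrCA.
(* The [g j] are constant along the line, so G restricts to a polynomial of degree < d in the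
   coordinate m0.P + e m0.q, with a root at each of the d points of the curve. *)
have g0 j : g j = 0.
  apply: (dense_base d2 fh nc inj qf nt1') =>
    P [l0 [c1 [ys [c10 szy uy E yB]]]].
  have nP : nz (crs P q).
    apply: not_par => pp; case/negP: l0; rewrite -dot_crs_rot dotE !pp.
    by rewrite !mul0r !addr0.
  have [r rP] := section_params qf nP E.
  pose p : {poly K} := \poly_(j < d) (if insub j is Some j' then (g j').@[P]
    else 0).
  have pE x : p.[x] = \sum_(j < d) x ^+ j * (g j).@[P].
    rewrite horner_poly; apply: eq_bigr => j' _.
    by rewrite (insubT (fun j => j < d)%N (ltn_ord j')) /= mulrC;
      congr (_ * (g _).@[_]); apply: val_inj.
  have p0 : p = 0.
    apply: (@roots_geq_poly_eq0 _ _ [seq dot m0 P + r y * dot m0 q | y <- ys]).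
    - apply/allP => _ /mapP[y yy ->]; apply/rootP; rewrite pE -GE.
      have [k k0 kE] := rP y yy.
      have Gh : G \is n.-homog.
        by apply: rpred_sum => t _; rewrite dhomogZ.
      by apply: (homog_zero_line Gh k0 kE); rewrite -evo_pull G0 evo0.
    - rewrite (map_comp (fun x => dot m0 P + x * dot m0 q) r) map_inj_uniq;
      last first.
        by move=> x y /addrI /(mulIf mq).
      exact: uniq_params inj _ _ _ _ uy yB rP.
    by rewrite size_map szy size_poly.
  have := congr1 (fun p : {poly K} => p`_j) p0.
  rewrite coef0 coef_poly ltn_ord (insubT (fun j => j < d)%N (ltn_ord j)) /= =>
    <-.
  by congr (g _).@[_]; apply: val_inj.
case=> j a.
pose p : {poly K} := \poly_(a < (n - d).+1) c (j, inord a).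
have p0 : p = 0.
  have [k kD] : exists k, k * D = 1 by exists D^-1; rewrite mulVf.
  (* P is chosen with n1.P = x and n2.P = 1, which turns [g j] into a polynomial in x with the
     coefficients c (j, a). *)
  apply: poly_vanish => x; pose P i := x * k * t2 i - k * t1 i.
  have n1P : dot n1 P = x.
    rewrite -[RHS]mulr1 -kD /D !dotE /n1 /P /crs /=; ring.
  have n2P : dot n2 P = 1.
    rewrite -kD /D !dotE /n2 /P /crs /=; ring.
  have := congr1 (meval P) (g0 j); rewrite meval0 horner_poly => E;
    rewrite -[RHS]E.
  rewrite /g (raddf_sum (meval P)); apply: eq_bigr => b _ /=.
  rewrite mevalZ mevalM !rmorphXn /= !meval_linf -!/(dot _ _) n1P n2P expr1n
    mulr1.
  by rewrite inord_val.
have := congr1 (fun p : {poly K} => p`_a) p0.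
by rewrite coef0 coef_poly ltn_ord inord_val.
Qed.

Lemma pull_lin (T : finType) (c : T -> K) (M : T -> A) :
  pull f (\sum_t c t *: M t) = \sum_t c t *: pull f (M t).
Proof.
by rewrite /pull raddf_sum; apply: eq_bigr => t _; rewrite /= mmapZ mul_mpolyC.
Qed.

(** G0 and G1 are sought with t G0(f) = s G1(f). Then s divides G0(f), t divides G1(f), and the
    cofactor k is the same. It is nonzero because k = 0 would make both combinations vanish on the
    curve, against independence. *)
Lemma rational_inverse : exists n m k G0 G1,
  [/\ G0 \is n.-homog, G1 \is n.-homog, k \is m.-homog & k != 0] /\
  pull f G0 = 'X_0 * k /\ pull f G1 = 'X_1 * k.
Proof.
(* In degree 2d there are 2d (d + 1) unknowns, against the 2d^2 + 2 coefficients of a binary form of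
   degree 2d^2 + 1; d >= 2 makes the former larger. *)
pose n := d.*2; have dn : (d <= n)%N by rewrite /n -addnn leq_addr.
have [M [Mh Mind]] := independent_family dn.
pose T := ('I_d * 'I_(n - d).+1)%type.
pose w (t : T + T) : {mpoly K[2]} :=
  match t with inl t => 'X_1 * pull f (M t) | inr t =>
    - ('X_0 * pull f (M t)) end.
have Xh (i : 'I_2) (p : {mpoly K[2]}) e : p \is e.-homog -> 'X_i * p \is
  e.+1.-homog.
  by move=> ph; rewrite (@dhomogM _ _ _ 1) // dhomogX /= mdeg1.
have wh t : w t \is (d * n).+1.-homog.
  by case: t => t; rewrite /w ?dhomogN Xh // pull_homog.
have [|c [[t0 ct0] c0]] := @linear_dependence K (T + T)%type (d * n).+2
    (fun t j => (w t)@_(mnm2 ((d * n).+1 - j) j)).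
  rewrite card_sum card_prod !card_ord /n; move: d2; nia.
have W0 : \sum_t c t *: w t = 0.
  apply: (@homog_coef_eq0 (d * n).+1); first by rewrite rpred_sum // => t _;
    rewrite dhomogZ.
  move=> j; rewrite raddf_sum -[RHS](c0 j); apply: eq_bigr => t _.
  by rewrite /= mcoeffZ.
pose G0 := \sum_(t : T) c (inl t) *: M t;
  pose G1 := \sum_(t : T) c (inr t) *: M t.
have G0h : G0 \is n.-homog by rewrite rpred_sum // => t _; rewrite dhomogZ.
have G1h : G1 \is n.-homog by rewrite rpred_sum // => t _; rewrite dhomogZ.
have E : 'X_1 * pull f G0 = 'X_0 * pull f G1.
  apply/eqP; rewrite -subr_eq0 -[X in _ == X]W0 big_sumType /=; apply/eqP.
  rewrite /G0 /G1 !pull_lin !big_distrr /= -sumrN; congr (_ + _);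
    apply: eq_bigr => t _.
    by rewrite scalerAr.
  by rewrite scalerN scalerAr.
have p0h := pull_homog fh G0h.
have [|Q QE Qh] := form_dvd_lf (o := None) p0h.
  have := congr1 (fun p => evo p None) E; rewrite !evoM /evo !bevX0 !bevX1 /=.
  by rewrite mul1r mul0r.
have lfN : lf (None : option K) = - 'X_0 by rewrite /lf /lin2 /= scale0r scale1r
  sub0r.
have p0E : pull f G0 = 'X_0 * - Q by rewrite QE lfN mulNr mulrN.
have X0 : 'X_0 != 0 :> {mpoly K[2]}.
  by apply/eqP => /(congr1 (fun p => bev p 1 0)); rewrite bevX0 bev0 => /eqP;
    rewrite oner_eq0.
have p1E : pull f G1 = 'X_1 * - Q.
  by apply: (mulfI X0); rewrite -E p0E mulrCA.
exists n, (d * n).-1, (- Q), G0, G1; split; split; rewrite ?dhomogN //.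
apply/eqP => Q0; case/negP: ct0; apply/eqP; move: p0E p1E; rewrite Q0 !mulr0 =>
  p0E p1E.
case: t0 => t.
  exact: (Mind (fun t => c (inl t)) p0E).
exact: (Mind (fun t => c (inr t)) p1E).
Qed.

(** A form in two coordinates lying in the ideal of G and F. Its n + 1 coefficients and the d (n - b
    - d + 1) of H outnumber the dn + 1 coefficients of the pullback as soon as n > d (b + d) - d. A
    solution with r = 0 would give G(f) H(f) = 0, hence H = 0 by independence. *)
Lemma elimination b (G : A) (i j : 'I_3) : G \is b.-homog -> pull f G != 0 ->
  exists n (r : 'I_n.+1 -> K) H Q, (exists a, r a != 0) /\
    \sum_a r a *: ('X_i ^+ (n - a) * 'X_j ^+ a) = G * H + Q * F.
Proof.
move=> Gh G0; pose n := (d * (b + d)).+1.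
have dn : (d <= n - b)%N by rewrite /n; nia.
have [M [Mh Mind]] := independent_family dn.
pose T := ('I_d * 'I_(n - b - d).+1)%type.
pose w (t : 'I_n.+1 + T) : A :=
  match t with inl a => 'X_i ^+ (n - a) * 'X_j ^+ a | inr t => - (G * M t) end.
have bn : (b <= n)%N by rewrite /n; nia.
have Xkh (l : 'I_3) k : ('X_l : A) ^+ k \is k.-homog.
  have Xh : ('X_l : A) \is 1.-homog by rewrite dhomogX /= mdeg1.
  by have := dhomogMn k Xh; rewrite mul1n.
have wh t : w t \is n.-homog.
  case: t => t; rewrite /w.
    have := dhomogM (Xkh i (n - t)%N) (Xkh j t).
    by rewrite subnK // -ltnS.
  by rewrite dhomogN -(subnKC bn) dhomogM.
have [|c [[t0 ct0] c0]] := @linear_dependence K ('I_n.+1 + T)%type (d * n).+1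
    (fun t k => (pull f (w t))@_(mnm2 (d * n - k) k)).
  rewrite card_sum card_prod !card_ord /n; move: d2; nia.
have W0 : pull f (\sum_t c t *: w t) = 0.
  apply: (@homog_coef_eq0 (d * n)).
    by apply: pull_homog => //; rewrite rpred_sum // => t _; rewrite dhomogZ.
  move=> k; rewrite pull_lin raddf_sum -[RHS](c0 k); apply: eq_bigr => t _.
  by rewrite /= mcoeffZ.
have Wh : \sum_t c t *: w t \is n.-homog by rewrite rpred_sum // => t _;
  rewrite dhomogZ.
have [Q QE] := curve_ideal d2 fh nc inj Fh Firr Ff Wh W0.
pose H := \sum_(t : T) c (inr t) *: M t.
have E : \sum_t c t *: w t =
    \sum_a c (inl a) *: ('X_i ^+ (n - a) * 'X_j ^+ a) - G * H.
  rewrite big_sumType /= /H big_distrr -sumrN; congr (_ + _); apply: eq_bigr =>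
    t _ /=.
  by rewrite scalerN scalerAr.
exists n, (fun a => c (inl a)), H, Q; split; last first.
  by rewrite -QE E addrC subrK.
have [//|no] := pselect (exists a, c (inl a) != 0).
have z a : c (inl a) = 0 by apply/eqP/negPn/negP => ne; apply: no; exists a.
case: t0 ct0 => [a|t ct0]; first by rewrite z eqxx.
case/negP: ct0; apply/eqP; apply: (Mind (fun t => c (inr t))).
move: W0; rewrite E big1 => [|a _]; last by rewrite z scale0r.
rewrite sub0r /pull mmapN rmorphM /= -!/(pull f _) => /eqP.
by rewrite oppr_eq0 mulf_eq0 (negbTE G0) => /eqP.
Qed.

End RationalInverse.

(** The wrapper carries the convolution product, as opposed to the bare coefficient functions in the
    definition of branches. *)
Record series (K : fieldType) := Series { sc : nat -> K }.

(** * Formal power series *)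

Section SeriesRing.
Variable K : fieldType.
Notation S := (series K).
Implicit Types (a b c : S) (p q r : {poly K}).

Lemma seriesP a b : (forall n, sc a n = sc b n) -> a = b.
Proof. by case: a b => [a] [b] /= E; congr Series; apply: funext. Qed.

HB.instance Definition _ := gen_eqMixin S.
HB.instance Definition _ := gen_choiceMixin S.

Definition trunc n a : {poly K} := \poly_(k < n.+1) sc a k.

(** Identities between series are transferred from polynomials: it is enough that, for every n, both
    sides agree up to degree n with one polynomial. *)
Definition agree n p a := forall k, (k <= n)%N -> p`_k = sc a k.

Lemma agree_trunc n a : agree n (trunc n a) a.
Proof. by move=> k kn; rewrite coef_poly ltnS kn. Qed.

Lemma agree_eq a b : (forall n, exists2 p, agree n p a & agree n p b) -> a = b.
Proof. by move=> H; apply: seriesP => n; have [p <- // <-] := H n. Qed.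

Definition of_poly p : S := Series (fun n => p`_n).

Lemma agree_of_poly n p : agree n p (of_poly p). Proof. by []. Qed.

Definition series_add a b := Series (fun n => sc a n + sc b n).
Definition series_opp a := Series (fun n => - sc a n).
Definition series_mul a b :=
  Series (fun n => \sum_(i < n.+1) sc a i * sc b (n - i)).

Lemma agree_add n p q a b : agree n p a -> agree n q b ->
  agree n (p + q) (series_add a b).
Proof. by move=> pa qb k kn; rewrite coefD pa // qb. Qed.

Lemma agree_mul n p q a b : agree n p a -> agree n q b ->
  agree n (p * q) (series_mul a b).
Proof.
move=> pa qb k kn; rewrite coefM; apply: eq_bigr => i _.
have ik : (i <= k)%N by rewrite -ltnS.
by rewrite pa ?(leq_trans ik) // qb // (leq_trans (leq_subr _ _)).
Qed.

Fact series_addA : associative series_add.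
Proof. by move=> a b c; apply: seriesP => n /=; rewrite addrA. Qed.
Fact series_addC : commutative series_add.
Proof. by move=> a b; apply: seriesP => n /=; rewrite addrC. Qed.
Fact series_add0 : left_id (of_poly 0) series_add.
Proof. by move=> a; apply: seriesP => n /=; rewrite coef0 add0r. Qed.
Fact series_addN : left_inverse (of_poly 0) series_opp series_add.
Proof. by move=> a; apply: seriesP => n /=; rewrite coef0 addNr. Qed.

HB.instance Definition _ :=
  GRing.isZmodule.Build S series_addA series_addC series_add0 series_addN.

Fact series_mulA : associative series_mul.
Proof.
move=> a b c; apply: agree_eq => n; exists (trunc n a * (trunc n b * trunc n
  c)).
  by do !apply: agree_mul; apply: agree_trunc.
by rewrite mulrA; do !apply: agree_mul; apply: agree_trunc.
Qed.
Fact series_mulC : commutative series_mul.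
Proof.
move=> a b; apply: agree_eq => n; exists (trunc n a * trunc n b).
  by apply: agree_mul; apply: agree_trunc.
by rewrite mulrC; apply: agree_mul; apply: agree_trunc.
Qed.
Fact series_mul1 : left_id (of_poly 1) series_mul.
Proof.
move=> a; apply: agree_eq => n; exists (trunc n a); last exact: agree_trunc.
by rewrite -[trunc n a]mul1r; apply: agree_mul;
  [exact: agree_of_poly|exact: agree_trunc].
Qed.
Fact series_mulDl : left_distributive series_mul series_add.
Proof.
move=> a b c; apply: agree_eq => n; exists ((trunc n a + trunc n b) * trunc n
  c).
  by apply: agree_mul; [apply: agree_add|]; apply: agree_trunc.
by rewrite mulrDl; apply: agree_add; apply: agree_mul; apply: agree_trunc.
Qed.
Fact series_one_neq0 : of_poly 1 != 0 :> S.
Proof.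
apply/eqP => /(congr1 (fun a => sc a 0)) /=; rewrite coef1 coef0 => /eqP.
by rewrite oner_eq0.
Qed.

HB.instance Definition _ := GRing.Zmodule_isComNzRing.Build S
  series_mulA series_mulC series_mul1 series_mulDl series_one_neq0.

Fact of_poly_additive : additive of_poly.
Proof. by move=> p q; apply: seriesP => n /=; rewrite coefB. Qed.
HB.instance Definition _ :=
  GRing.isAdditive.Build {poly K} S of_poly of_poly_additive.
Fact of_poly_multiplicative : multiplicative of_poly.
Proof.
split=> // p q; apply: agree_eq => n; exists (p * q);
  first exact: agree_of_poly.
by apply: agree_mul; apply: agree_of_poly.
Qed.
HB.instance Definition _ :=
  GRing.isMultiplicative.Build {poly K} S of_poly of_poly_multiplicative.

Lemma sc0 n : sc (0 : S) n = 0. Proof. by rewrite /= coef0. Qed.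
Lemma sc1 n : sc (1 : S) n = (n == 0%N)%:R. Proof. by rewrite /= coef1. Qed.
Lemma scD a b n : sc (a + b) n = sc a n + sc b n. Proof. by []. Qed.
Lemma scN a n : sc (- a) n = - sc a n. Proof. by []. Qed.
Lemma scM a b n : sc (a * b) n = \sum_(i < n.+1) sc a i * sc b (n - i).
Proof. by []. Qed.
Lemma scM0 a b : sc (a * b) 0 = sc a 0 * sc b 0.
Proof. by rewrite scM big_ord1. Qed.

Definition cst (x : K) : S := of_poly x%:P.

Lemma sc_cst x n : sc (cst x) n = if n == 0%N then x else 0.
Proof. by rewrite /= coefC. Qed.

Definition TT : S := of_poly 'X.

Lemma sc_TTM a n : sc (TT * a) n = if n is m.+1 then sc a m else 0.
Proof.
rewrite scM; case: n => [|n]; first by rewrite big_ord1 /= coefX mul0r.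
rewrite big_ord_recl /= coefX mul0r add0r big_ord_recl /= coefX mul1r subn1.
rewrite big1 ?addr0 // => i _.
by rewrite /= coefX /bump /= !add1n mul0r.
Qed.

Lemma TT_dvd a : sc a 0 = 0 -> exists b, a = TT * b.
Proof.
move=> a0; exists (Series (fun n => sc a n.+1)).
by apply: seriesP => -[|n]; rewrite sc_TTM.
Qed.

Lemma TT_lreg : GRing.lreg TT.
Proof.
move=> a b E; apply: seriesP => n; have := congr1 (fun s => sc s n.+1) E.
by rewrite !sc_TTM.
Qed.

Lemma series_order a : a != 0 -> exists k b, sc b 0 != 0 /\ a = TT ^+ k * b.
Proof.
move=> a0; have [n] : exists n, sc a n != 0.
  have [//|H] := pselect (exists n, sc a n != 0).
  case/eqP: a0; apply: seriesP => n; rewrite sc0; apply/eqP/negPn/negP => ne.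
  by apply: H; exists n.
elim: n a {a0} => [|n IH] a an; first by exists 0%N, a; rewrite mul1r.
have [a0|a0] := eqVneq (sc a 0) 0; last by exists 0%N, a; rewrite mul1r.
have [b bE] := TT_dvd a0; move: an; rewrite bE sc_TTM => /IH[k [b' [b'0 ->]]].
by exists k.+1, b'; rewrite exprS mulrA.
Qed.

Lemma series_mul_eq0 a b : a * b = 0 -> a = 0 \/ b = 0.
Proof.
move=> ab; have [->|a0] := eqVneq a 0; [by left|right]; apply/eqP;
  apply: contraT => b0.
have [k [a' [a'0 aE]]] := series_order a0;
  have [l [b' [b'0 bE]]] := series_order b0.
have TkI m c : TT ^+ m * c = 0 -> c = 0.
  elim: m => [|m IH]; first by rewrite mul1r.
  by rewrite exprS -mulrA -[X in _ = X](mulr0 TT) => /TT_lreg/IH.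
have : a' * b' = 0.
  apply: (TkI k); apply: (TkI l); rewrite -[RHS]ab aE bE; ring.
move/(congr1 (fun s => sc s 0)); rewrite scM0 sc0 => /eqP.
by rewrite mulf_eq0 (negbTE a'0) (negbTE b'0).
Qed.

Lemma series_lreg a : a != 0 -> GRing.lreg a.
Proof.
move=> a0 b c E; have : a * (b - c) = 0 by rewrite mulrBr E subrr.
by case/series_mul_eq0 => [/eqP|/eqP]; rewrite ?(negbTE a0) // subr_eq0 => /eqP.
Qed.

Lemma agree_mmap n m (h : 'I_m -> {poly K}) (s : 'I_m -> S) (G : {mpoly K[m]}) :
  (forall i, agree n (h i) (s i)) -> agree n (mmap polyC h G) (mmap cst s G).
Proof.
move=> H; elim/mpoly_alg_ind: G => [c|i|u w Hu Hw|u w Hu Hw].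
- rewrite mmapC (mmapC _ (of_poly \o polyC)); exact: agree_of_poly.
- rewrite mmapX (mmapX _ (of_poly \o polyC)) !mmap1U; exact: H.
- rewrite mmapD (mmapD _ (of_poly \o polyC)); exact: agree_add.
rewrite rmorphM (rmorphM (mmap (of_poly \o polyC) s)); exact: agree_mul.
Qed.

End SeriesRing.

Section Composition.
Variable K : fieldType.
Notation S := (series K).
Implicit Types (a b h : S) (p q r : {poly K}).

Lemma eq_coef_upto n p q : (forall k, (k <= n)%N -> p`_k = q`_k) ->
  exists r, p = q + r * 'X^(n.+1).
Proof.
move=> E; exists (drop_poly n.+1 (p - q)).
have -> : drop_poly n.+1 (p - q) * 'X^(n.+1) = p - q.
  rewrite -[RHS](poly_take_drop n.+1) [take_poly _ _](_ : _ = 0) ?add0r //.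
  apply/polyP => k; rewrite coef_take_poly coef0; case: ltnP => // kn.
  by rewrite coefB E ?subrr.
by rewrite addrC subrK.
Qed.

Lemma comp_poly_sub_dvd p q q' : exists r,
  (p \Po q) - (p \Po q') = (q - q') * r.
Proof.
elim/poly_ind: p => [|p c [r E]].
  by exists 0; rewrite mulr0 !linear0 ?addr0.
exists (p \Po q + q' * r).
rewrite !comp_poly_MXaddC mulrDr mulrCA -E; ring.
Qed.

(** Changing p by a multiple of X^(n+1) changes the composite by a multiple of q^(n+1), which
    X^(n+1) divides since q has no constant term. *)
Lemma comp_poly_upto n p p' q q' : q`_0 = 0 ->
  (forall k, (k <= n)%N -> p`_k = p'`_k) -> (forall k,
    (k <= n)%N -> q`_k = q'`_k) ->
  forall k, (k <= n)%N -> (p \Po q)`_k = (p' \Po q')`_k.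
Proof.
move=> q0 /eq_coef_upto[r ->] Eq k kn.
have [s sE] := eq_coef_upto Eq.
have [q1 q1E] : exists q1, q = q1 * 'X.
  have [|u uE] := @eq_coef_upto 0 q 0; last by exists u; rewrite uE add0r expr1.
  by move=> [|//] _; rewrite q0 coef0.
have [t tE] := comp_poly_sub_dvd p' q q'.
have -> : (p' + r * 'X^(n.+1)) \Po q = (p' \Po q') + ((r \Po q) * q1 ^+ n.+1 + s
  * t) * 'X^(n.+1).
  have qn : q ^+ n.+1 = q1 ^+ n.+1 * 'X^(n.+1) by rewrite {1}q1E exprMn.
  rewrite comp_polyD comp_polyM comp_Xn_poly qn.
  rewrite -[p' \Po q](subrK (p' \Po q')) tE.
  have -> : q - q' = s * 'X^(n.+1) by rewrite sE addrC addKr.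
  ring.
by rewrite coefD coefMXn ltnS kn addr0.
Qed.

(* The identity when [h] has a constant term, so as to be a ring morphism for
   every [h]. *)
Definition compo h a : S :=
  if sc h 0 == 0 then Series (series_comp (sc a) (sc h)) else a.

Lemma agree_compo n p q a h : sc h 0 = 0 -> agree n p a -> agree n q h ->
  agree n (p \Po q) (compo h a).
Proof.
move=> h0 pa qh k kn; rewrite /compo h0 eqxx /= /series_comp.
apply: (@comp_poly_upto k); rewrite ?leqnn //.
- by rewrite qh.
- move=> l lk; rewrite pa ?(leq_trans lk) //.
  by rewrite coef_poly ltnS lk.
move=> l lk; rewrite qh ?(leq_trans lk) //.
by rewrite coef_poly ltnS lk.
Qed.

Fact compo_additive h : additive (compo h).
Proof.
move=> a b; rewrite /compo; case: eqP => // h0.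
have cE c : Series (series_comp (sc c) (sc h)) = compo h c by rewrite /compo h0
  eqxx.
rewrite !cE; apply: agree_eq => n.
exists ((trunc n a + - trunc n b) \Po trunc n h).
  apply: agree_compo => //; [apply: agree_add|]; try exact: agree_trunc.
  by move=> k kn; rewrite coefN agree_trunc.
rewrite comp_polyD; apply: agree_add; first by apply: agree_compo => //;
  apply: agree_trunc.
move=> k kn; rewrite raddfN coefN /=; congr (- _).
have H : agree n (trunc n b \Po trunc n h) (compo h b).
  by apply: agree_compo => //; apply: agree_trunc.
exact: H.
Qed.
HB.instance Definition _ h := GRing.isAdditive.Build S S (compo h)
  (compo_additive h).

Fact compo_multiplicative h : multiplicative (compo h).
Proof.
have [h0|h0] := eqVneq (sc h 0) 0; last by split; rewrite /compo (negbTE h0).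
split=> [a b|]; apply: agree_eq => n.
  exists ((trunc n a * trunc n b) \Po trunc n h).
    by apply: agree_compo => //; [apply: agree_mul|]; apply: agree_trunc.
  by rewrite comp_polyM; apply: agree_mul; apply: agree_compo => //;
    apply: agree_trunc.
exists (1 \Po trunc n h).
  apply: agree_compo => //; exact: agree_trunc.
rewrite comp_polyC; exact: agree_of_poly.
Qed.
HB.instance Definition _ h :=
  GRing.isMultiplicative.Build S S (compo h) (compo_multiplicative h).

Lemma compoD h : {morph compo h : a b / a + b}. Proof. exact: rmorphD. Qed.
Lemma compoB h : {morph compo h : a b / a - b}. Proof. exact: rmorphB. Qed.
Lemma compoM h : {morph compo h : a b / a * b}. Proof. exact: rmorphM. Qed.
Lemma compo1 h : compo h 1 = 1. Proof. exact: rmorph1. Qed.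

Lemma compo_cst h x : compo h (cst x) = cst x.
Proof.
have [h0|h0] := eqVneq (sc h 0) 0; last by rewrite /compo (negbTE h0).
apply: agree_eq => n; exists (x%:P \Po trunc n h).
  by apply: agree_compo => //; apply: agree_trunc.
rewrite comp_polyC; exact: agree_of_poly.
Qed.

Lemma compo_TT h : sc h 0 = 0 -> compo h (TT K) = h.
Proof.
move=> h0; apply: agree_eq => n; exists ('X \Po trunc n h).
  by apply: agree_compo => //; apply: agree_trunc.
rewrite comp_polyX; exact: agree_trunc.
Qed.

Lemma compo_id a : compo (TT K) a = a.
Proof.
have T0 : sc (TT K) 0 = 0 by rewrite /= coefX.
apply: agree_eq => n; exists (trunc n a \Po 'X); last by rewrite comp_polyXr;
  apply: agree_trunc.
by apply: agree_compo => //; apply: agree_trunc.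
Qed.

Lemma compo_sc0 h a : sc (compo h a) 0 = sc a 0.
Proof.
rewrite /compo; case: eqP => //= h0; rewrite /series_comp /series_trunc.
have E (c : nat -> K) : \poly_(k < 1) c k = (c 0%N)%:P.
  by apply/polyP => k; rewrite coef_poly coefC ltnS leqn0; case: eqP => // ->.
by rewrite !E comp_polyC coefC.
Qed.

Lemma compoA a h h' : sc h 0 = 0 -> sc h' 0 = 0 ->
  compo h' (compo h a) = compo (compo h' h) a.
Proof.
move=> h0 h'0; have hh0 : sc (compo h' h) 0 = 0 by rewrite compo_sc0.
apply: agree_eq => n; exists ((trunc n a \Po trunc n h) \Po trunc n h').
  apply: agree_compo => //; last exact: agree_trunc.
  by apply: agree_compo => //; apply: agree_trunc.
rewrite -comp_polyA; apply: agree_compo => //; first exact: agree_trunc.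
by apply: agree_compo => //; apply: agree_trunc.
Qed.

Lemma compo_sc1 h a : sc h 0 = 0 -> sc (compo h a) 1 = sc a 1 * sc h 1.
Proof.
move=> h0; rewrite -{1}(subrK (cst (sc a 0)) a).
have [|b bE] := @TT_dvd _ (a - cst (sc a 0)).
  by rewrite scD scN sc_cst /= subrr.
rewrite bE compoD compoM compo_TT // compo_cst scD sc_cst addr0.
rewrite scM big_ord_recl big_ord1 h0 mul0r add0r subnn compo_sc0.
have -> : sc a 1 = sc (TT K * b) 1 by rewrite -bE scD scN sc_cst /= subr0.
by rewrite sc_TTM mulrC.
Qed.

(** The geometric series 1 / (1 - T) is composed with 1 - a / a(0), which has no constant term. *)
Lemma series_inv a : sc a 0 != 0 -> exists b, a * b = 1.
Proof.
move=> a0; pose G : S := Series (fun=> 1).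
have GE : (1 - TT K) * G = 1.
  apply: seriesP => n; rewrite mulrBl mul1r scD scN sc_TTM sc1.
  by case: n => [|n] /=; rewrite ?subr0 // subrr.
pose h := 1 - cst (sc a 0)^-1 * a.
have h0 : sc h 0 = 0 by rewrite scD scN scM0 sc_cst sc1 /= mulVf // subrr.
have := congr1 (compo h) GE; rewrite compoM compoB compo1 compo_TT //.
rewrite /h opprB addrC subrK -/h => E.
by exists (cst (sc a 0)^-1 * compo h G); rewrite mulrCA mulrA.
Qed.

Lemma compo_inj h : h != 0 -> sc h 0 = 0 -> injective (compo h).
Proof.
move=> hn0 h0 a b E; apply/eqP; rewrite -subr_eq0; apply: contraT => ab.
have [k [u [u0 uE]]] := series_order ab.
have : compo h (a - b) = 0 by rewrite compoB E subrr.
rewrite uE compoM (rmorphXn (compo h)) /= compo_TT // =>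
  /series_mul_eq0[|/(congr1 (fun s => sc s 0))].
  elim: k {uE} => [/eqP|k IH]; first by rewrite expr0 oner_eq0.
  by rewrite exprS => /series_mul_eq0[/eqP|//]; rewrite (negbTE hn0).
by rewrite compo_sc0 sc0 => /eqP; rewrite (negbTE u0).
Qed.

Lemma compo_mmap n h (s : 'I_n -> S) (G : {mpoly K[n]}) :
  compo h (mmap (@cst K) s G) = mmap (@cst K) (fun i => compo h (s i)) G.
Proof. by rewrite rmorph_mmap; apply: eq_mmap => // c /=;
  rewrite compo_cst. Qed.

End Composition.

Section SeriesPoints.
Variable K : fieldType.
Notation S := (series K).
Implicit Types (a h : S) (o : option K).

Fact cst_additive : additive (@cst K).
Proof. by move=> x y; rewrite /cst !rmorphB. Qed.
HB.instance Definition _ := GRing.isAdditive.Build K S (@cst K) cst_additive.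
Fact cst_multiplicative : multiplicative (@cst K).
Proof. by split=> [x y|]; rewrite /cst ?rmorph1 // !rmorphM. Qed.
HB.instance Definition _ :=
  GRing.isMultiplicative.Build K S (@cst K) cst_multiplicative.

Definition pev n (s : 'I_n -> S) (G : {mpoly K[n]}) : S := mmap (@cst K) s G.

Lemma pevD n (s : 'I_n -> S) : {morph pev s : G H / G + H}.
Proof. exact: rmorphD. Qed.
Lemma pevB n (s : 'I_n -> S) : {morph pev s : G H / G - H}.
Proof. exact: rmorphB. Qed.
Lemma pevM n (s : 'I_n -> S) : {morph pev s : G H / G * H}.
Proof. exact: rmorphM. Qed.
Lemma pevXn n (s : 'I_n -> S) k : {morph pev s : G / G ^+ k}.
Proof. exact: rmorphXn. Qed.
Lemma pev0 n (s : 'I_n -> S) : pev s 0 = 0.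
Proof. exact: rmorph0. Qed.
Lemma pevC n (s : 'I_n -> S) c : pev s c%:MP = cst c.
Proof. exact: mmapC. Qed.
Lemma pevZ n (s : 'I_n -> S) c G : pev s (c *: G) = cst c * pev s G.
Proof. by rewrite -mul_mpolyC pevM pevC. Qed.
Lemma pevX n (s : 'I_n -> S) i : pev s 'X_i = s i.
Proof. by rewrite /pev mmapX mmap1U. Qed.
Lemma pev_sum n (s : 'I_n -> S) (I : Type) (r : seq I) (F : I -> {mpoly K[n]}) :
  pev s (\sum_(i <- r) F i) = \sum_(i <- r) pev s (F i).
Proof. exact: rmorph_sum. Qed.

Lemma eq_pev n (s s' : 'I_n -> S) G : s =1 s' -> pev s G = pev s' G.
Proof. by move=> E; apply: eq_mmap. Qed.

Lemma pev_sc0 n (s : 'I_n -> S) G : sc (pev s G) 0 = G.@[fun i => sc (s i) 0].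
Proof.
elim/mpoly_alg_ind: G => [c|i|u w Hu Hw|u w Hu Hw].
- by rewrite pevC mevalC sc_cst.
- by rewrite pevX mevalXU.
- by rewrite pevD scD Hu Hw mevalD.
by rewrite pevM scM0 Hu Hw mevalM.
Qed.

Lemma pev_homog n e (G : {mpoly K[n]}) (s : 'I_n -> S) l : G \is e.-homog ->
  pev (fun i => l * s i) G = l ^+ e * pev s G.
Proof.
move=> Gh; rewrite /pev /mmap big_distrr /=; apply: eq_big_seq => m mG.
rewrite mulrCA; congr (_ * _); rewrite /mmap1; under eq_bigr do rewrite exprMn.
rewrite big_split /=; congr (_ * _).
by rewrite prodrXr -mdegE (dhomog_mf Gh mG).
Qed.

Lemma pev_mmap n m (s : 'I_n -> S) (g : 'I_m -> {mpoly K[n]}) G :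
  pev s (mmap (@mpolyC n K) g G) = pev (fun i => pev s (g i)) G.
Proof.
by rewrite /pev (rmorph_mmap (mmap (@cst K) s)); apply: eq_mmap => c //=;
  rewrite mmapC.
Qed.

Lemma compo_pev n h (s : 'I_n -> S) G :
  compo h (pev s G) = pev (fun i => compo h (s i)) G.
Proof. exact: compo_mmap. Qed.

Lemma on_germE (g : {mpoly K[2]}) (c : 'I_2 -> nat -> K) :
  on_germ g c <-> (forall i, c i 0%N = 0) /\ pev (fun i => Series (c i)) g = 0.
Proof.
have E n : (mmap polyC (fun i => series_trunc (c i) n) g)`_n =
    sc (pev (fun i => Series (c i)) g) n.
  apply: (@agree_mmap _ n 2 _ (fun i => Series (c i)) g) => // i.
  exact: (@agree_trunc _ n (Series (c i))).
split=> -[c0 H]; split=> //.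
  by apply: seriesP => n; rewrite sc0 -E.
by move=> n; rewrite E H sc0.
Qed.

Lemma reparamE (c c' : 'I_2 -> nat -> K) (h : nat -> K) : h 0%N = 0 ->
  (forall i n, c i n = reparam c' h i n) <->
  (forall i, Series (c i) = compo (Series h) (Series (c' i))).
Proof.
move=> h0; have E i : compo (Series h) (Series (c' i)) = Series (reparam c' h
  i).
  by rewrite /compo /= h0 eqxx.
split=> H i; first by rewrite E; apply: seriesP => n; rewrite /= H.
by move=> n; have := congr1 (fun s => sc s n) (H i); rewrite E.
Qed.

Lemma branch_equiv_trans (c1 c2 c3 : 'I_2 -> nat -> K) :
  branch_equiv c1 c2 -> branch_equiv c2 c3 -> branch_equiv c1 c3.
Proof.
move=> [h [h0 h1 /(reparamE _ _ h0) E]] [h' [h'0 h'1 /(reparamE _ _ h'0) E']].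
exists (sc (compo (Series h) (Series h'))); split; first by rewrite compo_sc0.
  by rewrite compo_sc1 //= mulf_neq0.
apply/reparamE => [|i]; first by rewrite /= compo_sc0.
rewrite E E' compoA //; congr (compo _ _).
Qed.

Lemma germ_nb_branches_leq (g : {mpoly K[2]}) r r' :
  germ_nb_branches g r -> germ_nb_branches g r' -> (r <= r')%N.
Proof.
move=> [b [bb binj ball]] [b' [bb' _ ball']].
have [l lP] := choice (fun k => ball' _ (bb k)).
have [m mP] := choice (fun k => ball _ (bb' k)).
have linj : injective l.
  move=> k k' E; have H j : j = m (l j).
    by apply: binj; apply: branch_equiv_trans (lP j) (mP _).
  by rewrite (H k) E -H.
by rewrite -(card_ord r) -(card_ord r'); apply: leq_card linj.
Qed.

Lemma germ_nb_branches_uniq (g : {mpoly K[2]}) r r' :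
  germ_nb_branches g r -> germ_nb_branches g r' -> r = r'.
Proof. by move=> H H'; apply/eqP; rewrite eqn_leq !(@germ_nb_branches_leq g).
  Qed.

End SeriesPoints.

(** * Branches *)

Section Arcs.
Variable K : numClosedFieldType.
Notation S := (series K).
Implicit Types (a h : S) (o : option K).

(* The germ at [o] of the identity of the projective line. *)
Definition arc o : 'I_2 -> S :=
  if o is Some t then pt2 1 (cst t + TT K) else pt2 (TT K) 1.

Lemma arc_sc0 o i : sc (arc o i) 0 = pt2 (px o) (py o) i.
Proof.
case: o => [t|]; case: (i) => -[|[|//]] ip /=; rewrite /pt2 /= ?scD ?sc_cst /=.
- by rewrite coef1.
- by rewrite coefX coefC addr0.
- by rewrite coefX.
by rewrite coef1.
Qed.

Lemma pev_arc_sc0 o G : sc (pev (arc o) G) 0 = evo G o.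
Proof.
rewrite pev_sc0; apply: meval_eq => i; exact: arc_sc0.
Qed.

(** The arc is polynomial and reaches every point of the projective line but one, so the form
    vanishes at all these points. *)
Lemma pev_arc_eq0 n o G : G \is n.-homog -> pev (arc o) G = 0 -> G = 0.
Proof.
move=> Gh; pose A : 'I_2 -> {poly K} :=
  if o is Some t then pt2 1 (t%:P + 'X) else pt2 'X 1.
have -> : pev (arc o) G = of_poly (mmap polyC A G).
  rewrite /pev rmorph_mmap; apply: eq_mmap => // i.
  rewrite /A /arc; case: (o) => [t|]; rewrite /pt2 /=; case: eqP => _ //.
  by rewrite rmorphD.
move=> A0; have {A0} H : mmap polyC A G = 0.
  by apply/polyP => k; rewrite coef0 -[RHS](sc0 K k) -A0.
have E x : bev G (A 0).[x] (A 1).[x] = 0.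
  have := congr1 (fun p => p.[x]) H.
  rewrite -[(mmap _ _ _).[x]]/(horner_eval x _) (rmorph_mmap (horner_eval x))
    hornerC => E.
  rewrite -[RHS]E /bev; apply: eq_mmap => [c|i] /=;
    first by rewrite /horner_eval hornerC.
  by rewrite /horner_eval /pt2; case: (i) => -[|[|//]] ip; congr (_).[_];
    congr A; apply: val_inj.
apply: (@form_vanish _ _ _ (if o is Some _ then [:: None] else [:: Some 0]) Gh)
  => w.
move: E; rewrite /A; case: o {A H} => [t|] E; case: w => [w|];
  rewrite ?inE // => nw.
  have := E (w - t); rewrite /pt2 /= !(hornerD, hornerX, hornerC).
  by rewrite addrC subrK.
  have w0 : w != 0 by apply: contra nw => /eqP->.
  have := E w^-1; rewrite /pt2 /= !(hornerX, hornerC) => Ew.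
  rewrite -[RHS](mulr0 (w ^+ n)) -Ew -bev_scale // mulfV // mulr1.
  by rewrite /evo /=.
have := E 0; rewrite /pt2 /= !(hornerX, hornerC) => <-.
by rewrite /evo /=.
Qed.

Definition series_unit_inv a : S :=
  if pselect (exists b, a * b = 1) is left H then sval (cid H) else 0.

Lemma series_mulV a : sc a 0 != 0 -> a * series_unit_inv a = 1.
Proof.
move=> /series_inv H; rewrite /series_unit_inv; case: pselect => // H'.
by case: (cid H').
Qed.

Lemma series_neq0 a : sc a 0 != 0 -> a != 0.
Proof. by apply: contra => /eqP->; rewrite sc0. Qed.

Lemma series_expf_neq0 a n : a != 0 -> a ^+ n != 0.
Proof.
move=> a0; elim: n => [|n IH]; first by rewrite expr0 oner_eq0.
rewrite exprS; apply/eqP => /series_mul_eq0[/eqP|/eqP].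
  by rewrite (negbTE a0).
by rewrite (negbTE IH).
Qed.

Definition chart_curve (q : 'I_3 -> K) i (c : 'I_2 -> S) (j : 'I_3) : S :=
  cst (q j) + (if unlift i j is Some k then c k else 0).

Lemma chart_curve_id q i c : chart_curve q i c i = cst (q i).
Proof. by rewrite /chart_curve unlift_none addr0. Qed.

Lemma chart_curve_lift q i c k :
  chart_curve q i c (fintype.lift i k) = cst (q (fintype.lift i k)) + c k.
Proof. by rewrite /chart_curve liftK. Qed.

Lemma chart_curve_sc0 q i c j : (forall k, sc (c k) 0 = 0) ->
  sc (chart_curve q i c j) 0 = q j.
Proof.
by move=> c0; rewrite /chart_curve scD sc_cst; case: unlift => [k|];
  rewrite ?c0 ?sc0 addr0.
Qed.

Lemma compo_chart_curve h q i c j :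
  compo h (chart_curve q i c j) = chart_curve q i (fun k => compo h (c k)) j.
Proof.
by rewrite /chart_curve compoD compo_cst; case: unlift => // ; rewrite raddf0.
Qed.

Lemma pev_germ_chart (F : {mpoly K[3]}) (P : 'rV[K]_3) i c :
  pev c (germ_chart F P i) = pev (chart_curve (fun j => P 0 j / P 0 i) i c) F.
Proof.
rewrite /germ_chart /comp_mpoly pev_mmap; apply: eq_pev => j.
rewrite tnth_mktuple pevD pevC /chart_curve; congr (_ + _).
by case: unlift => [k|]; rewrite ?pevX ?pev0.
Qed.

(** Of x and y, the one of larger order is the other times a power series g. Its constant term gives
    the point o, and h = g - g(0) the parameter. If y has strictly smaller order then g(0) = 0 and o
    is the point at infinity. *)
Lemma arc_lift (x y : series K) : x != 0 \/ y != 0 ->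
  exists o h al, [/\ sc h 0 = 0, al != 0, x = al * compo h (arc o 0)
                   & y = al * compo h (arc o 1)].
Proof.
have affine (a g : series K) : a != 0 -> exists o h al, [/\ sc h 0 = 0, al != 0,
    a = al * compo h (arc o 0) & a * g = al * compo h (arc o 1)].
  move=> a0; have h0 : sc (g - cst (sc g 0)) 0 = 0 by rewrite scD scN sc_cst
    subrr.
  exists (Some (sc g 0)), (g - cst (sc g 0)), a; split=> //.
    by rewrite /arc /pt2 /= compo1 mulr1.
  by rewrite /arc /pt2 /= compoD compo_cst compo_TT // addrC subrK.
have infinite (a g : series K) : a != 0 -> sc g 0 = 0 -> exists o h al,
  [/\ sc h 0 = 0,
    al != 0, a * g = al * compo h (arc o 0) & a = al * compo h (arc o 1)].
  move=> a0 g0; exists None, g, a; split=> //.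
    by rewrite /arc /pt2 /= compo_TT.
  by rewrite /arc /pt2 /= compo1 mulr1.
have [-> [//|y0]|x0 _] := eqVneq x 0.
  by have := infinite y 0 y0 (sc0 K 0); rewrite mulr0.
have [->|y0] := eqVneq y 0; first by have := affine x 0 x0; rewrite mulr0.
have [k [a [a0 aE]]] := series_order x0;
  have [m [b [b0 bE]]] := series_order y0.
have [km|mk] := leqP k m.
  have -> : y = x * (TT K ^+ (m - k) * b * series_unit_inv a).
    rewrite bE aE -{1}(subnKC km) exprD -[LHS]mulr1 -(series_mulV a0); ring.
  exact: affine.
have -> : x = y * (TT K ^+ (k - m) * a * series_unit_inv b).
  rewrite bE aE -{1}(subnKC (ltnW mk)) exprD -[LHS]mulr1 -(series_mulV b0);
    ring.
apply: infinite => //; rewrite -mulrA scM0 -(subnSK mk) exprS scM0 /= coefX.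
by rewrite !mul0r.
Qed.

End Arcs.

Section Branches.
Variables (K : numClosedFieldType) (d : nat) (f : 'I_3 -> {mpoly K[2]}).
Variables (B : seq (option K)) (F : {mpoly K[3]}) (Nf : nat).
Hypothesis d2 : (1 < d)%N.
Hypothesis fh : forall i, f i \is d.-homog.
Hypothesis nc : nocommon f.
Hypothesis inj : inj_off f B.
Hypothesis Fh : F \is Nf.-homog.
Hypothesis Firr : irreducible_elt F.
Hypothesis Ff : forall o, F.@[fo f o] = 0.
Variables (q : 'I_3 -> K) (i : 'I_3) (X : seq (option K)).
Hypothesis qi : q i = 1.
Hypothesis XP : is_fiber f q X.

Notation S := (series K).
Notation chart := (chart_curve q i).
Implicit Types (a h : S) (o : option K) (c : 'I_2 -> S).

Definition arc_image o (j : 'I_3) : S := pev (arc o) (f j).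

Lemma arc_image_sc0 o j : sc (arc_image o j) 0 = fo f o j.
Proof. exact: pev_arc_sc0. Qed.

Lemma fiber_coord o : o \in X -> fo f o i != 0 /\ forall j,
  fo f o j = fo f o i * q j.
Proof.
move=> /XP.2 po; have [|k E] := parP _ po; first by exists i;
  rewrite qi oner_eq0.
have Ei : fo f o i = k by rewrite E qi mulr1.
split=> [|j]; last by rewrite Ei E.
apply/eqP => z; have [j] := nc o; rewrite E -Ei z mul0r.
by rewrite eqxx.
Qed.

(** The image arc divided by its i-th coordinate and centred at [q]: the germ of the parametrization
    at o in the affine chart. *)
Definition branch o (k : 'I_2) : S :=
  arc_image o (fintype.lift i k) * series_unit_inv (arc_image o i)
  - cst (q (fintype.lift i k)).

Lemma arc_image_unit o : o \in X -> arc_image o i * series_unit_inv (arc_image o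
  i) = 1.
Proof. by move=> /fiber_coord[oi _]; apply: series_mulV;
  rewrite arc_image_sc0. Qed.

Lemma arc_image_neq0 o : o \in X -> arc_image o i != 0.
Proof. by move=> /fiber_coord[oi _]; apply: series_neq0;
  rewrite arc_image_sc0. Qed.

Lemma chart_branch o j : o \in X -> arc_image o j = chart (branch o) j *
  arc_image o i.
Proof.
move=> oX; case: (unliftP i j) => [k|] ->; last first.
  by rewrite chart_curve_id qi rmorph1 mul1r.
rewrite chart_curve_lift /branch addrC subrK -mulrA mulrC.
by rewrite (mulrC (series_unit_inv _)) arc_image_unit // mul1r.
Qed.

Lemma branch_sc0 o k : o \in X -> sc (branch o k) 0 = 0.
Proof.
move=> oX; have [oi E] := fiber_coord oX.
have := congr1 (fun a => sc a 0) (chart_branch (fintype.lift i k) oX).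
rewrite scM0 !arc_image_sc0 chart_curve_lift scD sc_cst /= E mulrC =>
  /(mulIf oi) /eqP.
by rewrite -subr_eq0 opprD addrA subrr sub0r oppr_eq0 => /eqP.
Qed.

Lemma pull_F : pull f F = 0.
Proof. exact: pull_vanish fh Fh Ff. Qed.

Lemma pev_pull o (G : {mpoly K[3]}) : pev (arc o) (pull f G) = pev (arc_image o)
  G.
Proof. exact: pev_mmap. Qed.

Lemma F_branch o : o \in X -> pev (chart (branch o)) F = 0.
Proof.
move=> oX; have := pev_pull o F; rewrite pull_F pev0.
rewrite (@eq_pev _ _ _ (fun j => arc_image o i * chart (branch o) j)) => [|j];
  last first.
  by rewrite mulrC; apply: chart_branch.
rewrite (pev_homog _ _ Fh) => /esym/series_mul_eq0[|//].
by move/eqP; rewrite (negbTE (series_expf_neq0 _ (arc_image_neq0 oX))).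
Qed.

(** Were it zero, the image arc would stay proportional to q, and any line through q would contain
    the curve. *)
Lemma branch_neq0 o : o \in X -> exists k, branch o k != 0.
Proof.
move=> oX; have [//|H] := pselect (exists k, branch o k != 0).
have b0 k : branch o k = 0 by apply/eqP/negPn/negP => ne; apply: H; exists k.
have nq : nz q by exists i; rewrite qi oner_eq0.
have [u [nu uq]] := exists_orth nq.
have := section_neq0 d2 fh nc inj nu; rewrite (@pev_arc_eq0 K d o (dotf u f))
  ?eqxx //.
  exact: dotf_homog.
have E j : pev (arc o) (f j) = cst (q j) * arc_image o i.
  rewrite -/(arc_image o j) chart_branch //; congr (_ * _).
  by rewrite /chart_curve; case: unlift => [k|]; rewrite ?b0 addr0.
rewrite /dotf pev_sum; under eq_bigr do rewrite pevZ E mulrA -rmorphM.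
rewrite -big_distrl -rmorph_sum /=.
by rewrite -[\sum_(_ < _) _]/(dot u q) uq rmorph0 mul0r.
Qed.

(** The rational inverse applied to the common arc returns the reparametrized arcs at o and at o',
    each up to a nonzero factor, so these are proportional. At T = 0 this gives o = o', and the
    affine coordinate then gives h = h'. *)
Lemma branch_inj o o' h h' : o \in X -> o' \in X ->
  sc h 0 = 0 -> sc h' 0 = 0 -> h != 0 -> h' != 0 ->
  (forall k, compo h (branch o k) = compo h' (branch o' k)) -> o = o' /\ h = h'.
Proof.
move=> oX o'X h0 h'0 hn0 h'n0 bb.
have [n [m [k [G0 [G1 [[G0h G1h kh k0] [E0 E1]]]]]]] := rational_inverse d2 fh
  nc inj Fh Firr Ff.
pose C := chart (fun k => compo h (branch o k)).
have key w (g : S) : w \in X -> sc g 0 = 0 -> g != 0 ->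
    (forall j, compo g (chart (branch w) j) = C j) ->
    exists ka u, [/\ ka != 0, pev C G0 * u = compo g (arc w 0) * ka
                          & pev C G1 * u = compo g (arc w 1) * ka].
  move=> wX g0 gn0 wC; exists (compo g (pev (arc w) k)),
    (compo g (arc_image w i) ^+ n).
  have ev (G : {mpoly K[3]}) (r : 'I_2) : G \is n.-homog -> pull f G = 'X_r * k
    ->
      pev C G * compo g (arc_image w i) ^+ n = compo g (arc w r) * compo g (pev
        (arc w) k).
    move=> Gh GE; rewrite -compoM -[arc w r](pevX (arc w)) -pevM -GE pev_pull.
    rewrite compo_pev mulrC -(pev_homog _ _ Gh); apply: eq_pev => j.
    by rewrite -wC -compoM [arc_image w j]chart_branch // mulrC.
  split; try exact: ev.
  apply: contra k0 => /eqP E; apply/eqP; apply: (pev_arc_eq0 kh (o := w)).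
  by apply: (compo_inj gn0 g0); rewrite E raddf0.
have [ka [u [ka0 e0 e1]]] : exists ka u, [/\ ka != 0,
  pev C G0 * u = compo h (arc o 0) * ka
                          & pev C G1 * u = compo h (arc o 1) * ka].
  by apply: key => // j; rewrite compo_chart_curve.
have [ka' [u' [ka'0 e0' e1']]] : exists ka u, [/\ ka != 0,
  pev C G0 * u = compo h' (arc o' 0) * ka
                          & pev C G1 * u = compo h' (arc o' 1) * ka].
  apply: key => // j; rewrite compo_chart_curve /C /chart_curve.
  by case: unlift => [l|//]; rewrite bb.
have cross : compo h (arc o 0) * compo h' (arc o' 1) = compo h (arc o 1) * compo
  h' (arc o' 0).
  apply: (series_lreg ka0); apply: (series_lreg ka'0).
  transitivity (pev C G0 * u * (pev C G1 * u')); first by rewrite e0 e1'; ring.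
  transitivity (pev C G1 * u * (pev C G0 * u')); first by ring.
  by rewrite e1 e0'; ring.
have oo' : o = o'.
  apply/eqP; rewrite -evo_lf_eq0 evo_lf subr_eq0; apply/eqP.
  have := congr1 (fun a => sc a 0) cross.
  by rewrite !scM0 !compo_sc0 !arc_sc0.
split=> //; move: cross; rewrite -{}oo' /arc; case: (o) => [t|];
  rewrite /pt2 /=.
  rewrite !compo1 mul1r mulr1 !compoD !compo_cst !compo_TT //.
  by move=> /addrI ->.
by rewrite !compo1 mul1r mulr1 !compo_TT.
Qed.

Lemma homog_mmap n m (g : 'I_2 -> {mpoly K[3]}) (G : {mpoly K[2]}) :
  (forall k, g k \is n.-homog) -> G \is m.-homog ->
  mmap (@mpolyC 3 K) g G \is (n * m).-homog.
Proof.
move=> gh Gh; apply: homog_of_scale => l v.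
rewrite !(rmorph_mmap (meval _)) exprM.
rewrite (@eq_mmap _ _ _ _ id _ (fun k => l ^+ n * (g k).@[v])) => [|c|k] /=.
- have -> : mmap (meval v \o @mpolyC 3 K) (meval v \o g) G = G.@[fun k =>
  (g k).@[v]].
    by apply: eq_mmap => // c /=; rewrite mevalC.
  exact: meval_homog.
- by rewrite mevalC.
exact: meval_homog.
Qed.

(** The rational inverse sends the arc C to a pair of series, which [arc_lift] writes as the germ of
    the projective line at some o, reparametrized by h. Modulo F, the inverse followed by f is
    proportional to the identity; as F vanishes on C, applying f gives C back. *)
Lemma branch_lift c : (forall k, sc (c k) 0 = 0) -> (exists k, c k != 0) ->
  pev (chart c) F = 0 ->
  exists o h, [/\ o \in X, sc h 0 = 0 & forall k, c k = compo h (branch o k)].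
Proof.
move=> c0 [k0 ck0] FC; pose C := chart c.
have [n [m [k [G0 [G1 [[G0h G1h kh kn0] [E0 E1]]]]]]] := rational_inverse d2 fh
  nc inj Fh Firr Ff.
pose G r := if r == 0 :> 'I_2 then G0 else G1.
have Gh r : G r \is n.-homog by rewrite /G; case: ifP.
have GE r : pull f (G r) = 'X_r * k.
  by case: r => -[|[|//]] ip; rewrite /G /=; rewrite ?E0 ?E1; congr ('X_ _ * _);
    apply: val_inj.
have C1 : C i = 1 by rewrite /C chart_curve_id qi rmorph1.
(* If G0 vanished on C, [elimination] would give a nonzero polynomial over K with the coordinate of
   index [k0] of C as a root. Since it splits over K, that coordinate would be constant, against the
   choice of [k0]. *)
have G0C : pev C G0 != 0.
  apply/eqP => G0C; have := elimination d2 fh nc inj Fh Firr Ff i (fintype.lift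
    i k0) G0h.
  case; first by rewrite E0 mulf_neq0 // -msupp_eq0 msuppX.
  move=> a [r [H [Q [[b rb] rE]]]].
  have := congr1 (pev C) rE; rewrite pevD !pevM G0C FC mul0r mulr0 addr0
    pev_sum.
  under eq_bigr do rewrite pevZ pevM !pevXn !pevX C1 expr1n mul1r.
  pose p := \poly_(t < a.+1) (if insub t is Some t' then r t' else 0).
  have p0 : p != 0.
    apply/eqP => /(congr1 (fun p : {poly K} => p`_b));
      rewrite coef_poly ltn_ord valK coef0.
    by apply/eqP.
  have -> : \sum_(t < a.+1) cst (r t) * C (fintype.lift i k0) ^+ t =
      (map_poly (@cst K) p).[C (fintype.lift i k0)].
    have sz : (size (map_poly (@cst K) p) <= a.+1)%N by apply: leq_trans
      (size_poly _ _) _; apply: size_poly.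
    rewrite (horner_coef_wide _ sz).
    by apply: eq_bigr => t _; rewrite coef_map coef_poly ltn_ord valK.
  have [rs pE] := closed_field_poly_normal p.
  rewrite pE map_polyZ rmorph_prod hornerZ horner_prod => /series_mul_eq0[].
    move/(congr1 (fun s => sc s 0)); rewrite sc0 sc_cst /= => /eqP.
    by rewrite lead_coef_eq0 (negbTE p0).
  elim: rs {pE} => [|z rs IH].
    by rewrite big_nil => /eqP; rewrite oner_eq0.
  rewrite big_cons => /series_mul_eq0[|//].
  rewrite rmorphB /= map_polyX map_polyC hornerXsubC => /eqP.
  rewrite subr_eq0 /C chart_curve_lift addrC -(inj_eq (addIr (- cst (q
    (fintype.lift i k0))))) addrK.
  rewrite -rmorphB => /eqP ckE; case/eqP: ck0.
  rewrite ckE; have := congr1 (fun s => sc s 0) ckE; rewrite c0 sc_cst /= => <-.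
  by rewrite rmorph0.
have [o [h [al [h0 al0 hx hy]]]] := arc_lift (or_introl (pev C G1 != 0) G0C).
have hG r : pev C (G r) = al * compo h (arc o r).
  by case: r => -[|[|//]] ip; rewrite /G /= ?hx ?hy;
    congr (_ * compo _ (arc _ _)); apply: val_inj.
(* f_l(G0, G1) pulls back to k^d f_l. Hence X_i f_j(G0, G1) - X_j f_i(G0, G1) vanishes on the curve,
   so it is a multiple of F and vanishes on C. *)
have rel j : compo h (arc_image o j) = C j * compo h (arc_image o i).
  pose sG l := mmap (@mpolyC 3 K) G (f l).
  have sGh l : sG l \is (n * d).-homog by apply: homog_mmap.
  have pl l : pull f (sG l) = k ^+ d * f l.
    apply/eqP; rewrite -subr_eq0; apply/eqP; apply: bev_vanish => s t.
    rewrite bevB bevM bevXn bev_pull /sG (rmorph_mmap (meval _)).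
    rewrite (@eq_mmap _ _ _ _ id _ (fun r => bev k s t * pt2 s t r)) =>
      [|x|r] /=.
    - by rewrite -[mmap _ _ _]/((f l).@[fun r =>
      bev k s t * pt2 s t r]) (meval_homog _ _ (fh l)) subrr.
    - by rewrite mevalC.
    by rewrite -bev_pull GE bevM mulrC; congr (_ * _); rewrite /bev mevalXU.
  have [||Q QE] := @curve_ideal _ _ _ _ _ _ d2 fh nc inj Fh Firr Ff (1 + n * d)
    ('X_i * sG j - 'X_j * sG i).
  - by rewrite rpredB // dhomogM // dhomogX /= mdeg1.
  - rewrite /pull rmorphB !rmorphM /= !mmapX !mmap1U -!/(pull f _) !pl; ring.
  have sGC l : pev C (sG l) = al ^+ d * compo h (arc_image o l).
    rewrite /sG pev_mmap (@eq_pev _ _ _ (fun r => al * compo h (arc o r)) _ hG).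
    by rewrite (pev_homog _ _ (fh l)) /arc_image compo_pev.
  have := congr1 (pev C) QE; rewrite pevB !pevM FC mulr0 !pevX !sGC C1 mul1r.
  rewrite mulrCA -mulrBr => /series_mul_eq0[/eqP|/eqP].
    by rewrite (negbTE (series_expf_neq0 _ al0)).
  by rewrite subr_eq0 => /eqP.
have oX : o \in X.
  apply/XP.2; apply: (par_of_scale (k := fo f o i)) => j.
  have := congr1 (fun s => sc s 0) (rel j).
  by rewrite scM0 !compo_sc0 !arc_image_sc0 chart_curve_sc0 // mulrC.
exists o, h; split=> // r; have := rel (fintype.lift i r).
rewrite (chart_branch _ oX) compoM.
have nz0 : compo h (arc_image o i) != 0.
  by apply: series_neq0; rewrite compo_sc0 arc_image_sc0;
    case: (fiber_coord oX).
rewrite ![_ * compo h (arc_image o i)]mulrC => /(series_lreg nz0).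
by rewrite compo_chart_curve /C !chart_curve_lift => /addrI.
Qed.

Lemma compo_eq0 h a : sc h 0 = 0 -> sc a 0 = 0 -> h = 0 -> compo h a = 0.
Proof. by move=> h0 /TT_dvd[b ->] hz; rewrite compoM compo_TT // hz mul0r. Qed.

Lemma compo_branch_neq0 o h : sc h 0 = 0 -> (exists k,
  compo h (branch o k) != 0) ->
  o \in X -> h != 0.
Proof.
move=> h0 [k bk] oX; apply: contra bk => /eqP hz.
by rewrite compo_eq0 // branch_sc0.
Qed.

Definition branch_coef o (k : 'I_2) : nat -> K := sc (branch o k).

Lemma series_eta a : Series (sc a) = a. Proof. by case: a. Qed.

Variable g : {mpoly K[2]}.
Hypothesis gP : forall c, pev c g = pev (chart c) F.

(** For primitivity: if the branch at o is c' composed with h, then c' also lies on the germ and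
    lifts to a branch at some o' composed with h'. By [branch_inj], h' composed with h is T, so the
    product of the linear coefficients of h and h' is 1. *)
Lemma branch_on_germ o : o \in X -> is_branch g (branch_coef o).
Proof.
move=> oX; split.
  apply/on_germE; split=> [k|]; first exact: branch_sc0.
  by rewrite (@eq_pev _ _ _ (branch o)) ?gP ?F_branch // => k;
    apply: series_eta.
move=> c' h h0 /(reparamE _ _ h0) E.
pose cs k := Series (c' k); have {}E k : branch o k = compo (Series h) (cs k).
  by rewrite -E series_eta.
have [k bk] := branch_neq0 oX.
have cs0 l : sc (cs l) 0 = 0 by rewrite -(compo_sc0 (Series h)) -E branch_sc0.
have hn0 : Series h != 0 by apply: contra bk => /eqP hz; rewrite E compo_eq0.
have [||o' [h' [o'X h'0 E']]] := branch_lift cs0.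
- by exists k; apply: contra bk => /eqP cz; rewrite E cz raddf0.
- apply: (compo_inj hn0 h0); rewrite raddf0 compo_pev -[RHS](F_branch oX).
  by apply: eq_pev => j; rewrite compo_chart_curve /chart_curve; case: unlift =>
    [l|//]; rewrite E.
have hh0 : sc (compo (Series h) h') 0 = 0 by rewrite compo_sc0.
have bE l : branch o l = compo (compo (Series h) h') (branch o' l) by rewrite E
  E' compoA.
have T0 : sc (TT K) 0 = 0 by rewrite /= coefX.
have [||l|_ TE] := branch_inj oX o'X T0 hh0.
- by apply/eqP => /(congr1 (fun s => sc s 1)) /eqP;
  rewrite sc0 /= coefX oner_eq0.
- by apply: (compo_branch_neq0 hh0 _ o'X); exists k; rewrite -bE.
- by rewrite compo_id.
have := congr1 (fun s => sc s 1) TE; rewrite compo_sc1 //= coefX /= => /esym H.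
by apply/eqP => h1; move: H => /eqP; rewrite h1 mulr0 eq_sym oner_eq0.
Qed.

Lemma branch_coef_inj o o' : o \in X -> o' \in X ->
  branch_equiv (branch_coef o) (branch_coef o') -> o = o'.
Proof.
move=> oX o'X [h [h0 h1 /(reparamE _ _ h0) E]].
have T0 : sc (TT K) 0 = 0 by rewrite /= coefX.
have [||l|//] := branch_inj oX o'X T0 (h0 : sc (Series h) 0 = 0).
- by apply/eqP => /(congr1 (fun s => sc s 1)) /eqP;
  rewrite sc0 /= coefX oner_eq0.
- by apply: contra h1 => /eqP hz; rewrite -[h 1%N]/(sc (Series h) 1) hz sc0.
by rewrite compo_id -[LHS]series_eta E series_eta.
Qed.

Lemma branch_coef_surj (c : 'I_2 -> nat -> K) : is_branch g c ->
  exists2 o, o \in X & branch_equiv c (branch_coef o).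
Proof.
move=> [/on_germE[c0 gc] prim]; pose cs k := Series (c k).
have [||o [h [oX h0 E]]] := @branch_lift cs c0.
(* The zero arc is not primitive: it is the zero series composed with h = 0, whose linear
   coefficient is zero. *)
- have [//|H] := pselect (exists k, cs k != 0).
  have cz k : cs k = 0 by apply/eqP/negPn/negP => ne; apply: H; exists k.
  have := prim (fun _ _ => 0) (fun=> 0) erefl; rewrite eqxx; case/(_ _)/negP =>
    // k n.
  have -> : c k n = 0 by have := congr1 (fun s => sc s n) (cz k); rewrite sc0.
  by rewrite /reparam /series_comp /series_trunc (_ : \poly_(_ < _) _ = 0)
    ?comp_poly0 ?coef0 //; apply/polyP => l; rewrite coef_poly coef0 if_same.
- by rewrite -gP.
have E' k m : c k m = reparam (branch_coef o) (sc h) k m.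
  by move: k m; apply/reparamE => // k; rewrite !series_eta -E.
by exists o => //; exists (sc h); split=> //; apply: prim E'.
Qed.

Lemma germ_nb_branchesP r : germ_nb_branches g r <-> r = size X.
Proof.
have sX : germ_nb_branches g (size X).
  exists (fun k : 'I_(size X) => branch_coef (tnth (in_tuple X) k)); split.
  - by move=> k; apply: branch_on_germ; apply: mem_tnth.
  - move=> k l /branch_coef_inj; rewrite !mem_tnth => /(_ isT isT) E.
    apply/val_inj/eqP; rewrite -(nth_uniq None (ltn_ord k) (ltn_ord l) XP.1).
    by rewrite -!(tnth_nth None (in_tuple X)) E.
  move=> c /branch_coef_surj[o oX co].
  by have /tnthP[k oE] : o \in in_tuple X by []; exists k; rewrite -oE.
by split=> [|->//] /germ_nb_branches_uniq; apply.
Qed.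

End Branches.

Lemma representatives (T : eqType) (R : T -> T -> Prop) (s : seq T) :
  (forall x, R x x) -> (forall x y, R x y -> R y x) ->
  exists S, [/\ uniq S, {subset S <= s}, {in S &, forall x y, R x y -> x = y}
              & forall x, x \in s -> exists2 y, y \in S & R x y].
Proof.
move=> Rr Rs; elim: s => [|x s [S [uS sS SS cS]]]; first by exists [::].
have [[y yS Rxy]|H] := pselect (exists2 y, y \in S & R x y).
  exists S; split=> // [y' /sS|x']; first by rewrite inE orbC => ->.
  by rewrite inE => /predU1P[->|/cS//]; exists y.
have Sx y : y \in S -> ~ R x y by move=> yS Rxy; apply: H; exists y.
exists (x :: S); split=> [|y|y z|y].
- by rewrite /= uS andbT; apply/negP => /Sx; apply.
- by rewrite !inE => /predU1P[->|/sS->]; rewrite ?eqxx ?orbT.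
- rewrite !inE => /predU1P[->|yS] /predU1P[->|zS] Ryz //; last exact: SS.
    by case: (Sx z).
  by case: (Sx y) => //; apply: Rs.
rewrite inE => /predU1P[->|/cS[z zS Ryz]]; first by exists x;
  rewrite ?inE ?eqxx.
by exists z => //; rewrite inE zS orbT.
Qed.

Lemma proj_eq_refl (K : fieldType) n (x : 'rV[K]_n) : proj_eq x x.
Proof. by exists 1; rewrite ?oner_eq0 ?scale1r. Qed.

Lemma proj_eq_sym (K : fieldType) n (x y : 'rV[K]_n) : proj_eq x y -> proj_eq y
  x.
Proof. by case=> k k0 ->; exists k^-1; rewrite ?invr_eq0 // scalerA mulVf //
  scale1r. Qed.

(** * Projective points *)

Section Vectors.
Variable K : numClosedFieldType.
Implicit Types (P Q : 'rV[K]_3) (f : 'I_3 -> {mpoly K[2]}) (o w : option K).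

Lemma vec_nz P : P != 0 <-> nz (vec P).
Proof.
split=> [P0|[j]]; last by apply: contra => /eqP->; rewrite /vec mxE.
have [//|H] := pselect (nz (vec P)); case/eqP: P0; apply/rowP => i.
by rewrite mxE; apply: nzPn H i.
Qed.

Lemma proj_eqP P Q : P != 0 -> Q != 0 -> proj_eq P Q <-> par (vec P) (vec Q).
Proof.
move=> /vec_nz nP /vec_nz nQ; split=> [[k _ ->]|pPQ].
  by apply: (par_of_scale (k := k)) => j; rewrite /vec mxE.
have [k kE] := parP nP pPQ; exists k; last by apply/rowP => j; rewrite mxE;
  apply: kE.
apply/eqP => k0; have [j] := nQ; rewrite kE k0 mul0r; by rewrite eqxx.
Qed.

Definition row_of n (v : 'I_n -> K) : 'rV[K]_n := \row_i v i.

Lemma vec_row_of v j : vec (row_of v) j = v j.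
Proof. by rewrite /vec mxE. Qed.

Lemma row_of_neq0 v : nz v -> row_of v != 0.
Proof. by case=> i vi; apply/vec_nz; exists i; rewrite vec_row_of. Qed.

Lemma par_row_of u v : par u (vec (row_of v)) <-> par u v.
Proof. by split=> H i; have := H i; rewrite /crs !vec_row_of. Qed.

Definition row_pt o : 'rV[K]_2 := row_of (pt2 (px o) (py o)).

Lemma param_row_pt f o : param f (row_pt o) = row_of (fo f o).
Proof.
apply/rowP => i; rewrite !mxE /evalv; apply: meval_eq => j.
by rewrite mxE.
Qed.

Lemma row_pt_neq0 o : row_pt o != 0.
Proof.
apply/eqP => /rowP E; have := px_py_neq0 o.
by have := E 0; have := E 1; rewrite !mxE /pt2 /= => -> ->; rewrite eqxx.
Qed.

Lemma row_pt_inj o w : proj_eq (row_pt o) (row_pt w) -> o = w.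
Proof.
case=> k _ /rowP E; apply/eqP; rewrite -evo_lf_eq0 evo_lf.
have := E 0; have := E 1; rewrite !mxE /pt2 /= => -> ->.
by apply/eqP; ring.
Qed.

Lemma image_curveP d f P : (forall i, f i \is d.-homog) -> nocommon f -> P != 0
  ->
  image_curve f P <-> exists o, par (vec P) (fo f o).
Proof.
move=> fh nc P0; split=> [[_ [x [x0 xP]]]|[o Po]]; last first.
  split=> //; exists (row_pt o); split; first exact: row_pt_neq0.
  rewrite param_row_pt; apply/proj_eqP => //; first exact/row_of_neq0/nc.
  by apply: par_sym; apply/par_row_of.
have xE i : x 0 i = pt2 (x 0 0) (x 0 1) i.
  by case: i => -[|[|//]] ip; rewrite /pt2 /=; congr (x 0 _); apply: val_inj.
have [|o [l [l0 xs xt]]] := @point_of K (x 0 0) (x 0 1).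
  apply: contraNT x0; rewrite negb_or !negbK => /andP[/eqP a /eqP b].
  by apply/eqP/rowP => i; rewrite mxE xE a b /pt2 if_same.
exists o; case: xP => k k0 PE.
apply: par_sym; apply: (par_of_scale (k := k * l ^+ d)) => j.
rewrite /vec PE !mxE -mulrA -bev_scale // -xs -xt; congr (k * _);
  apply: meval_eq => i.
exact: xE.
Qed.

End Vectors.

Section Hypotheses.
Variables (K : numClosedFieldType) (d : nat) (f : 'I_3 -> {mpoly K[2]}).
Hypothesis fh : forall i, f i \is d.-homog.
Implicit Types (P Q : 'rV[K]_3) (o w : option K).

(** A common zero o makes [lf o] a common divisor, and a linear form is not a unit. *)
Lemma coprime_nocommon : coprime_family f -> nocommon f.
Proof.
move=> cop o; have [//|H] := pselect (nz (fo f o)).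
have /mpoly_unitP[c c0 E] : lf o \is a GRing.unit.
  apply: cop => i; have [Q QE _] := form_dvd_lf (fh i) (nzPn H i).
  by exists Q; rewrite QE mulrC.
have : evo (lf o) o == 0 by rewrite evo_lf_eq0.
by rewrite E /evo /bev mevalC (negbTE c0).
Qed.

(** The form G that cuts out the exceptional points pulls back to a nonzero binary form, whose
    finitely many roots are taken for [B]. *)
Lemma generic_inj_off : nocommon f -> generically_one_to_one f -> exists B,
  inj_off f B.
Proof.
move=> nc [e [G [Gh [P imP GP] H]]].
have P0 := imP.1; have [o0 Po0] := (image_curveP fh nc P0).1 imP.
have pG : pull f G != 0.
  apply: contra GP => /eqP E.
  have [k kE] := parP (nc o0) (par_sym Po0).
  by rewrite /evalv (meval_eq _ kE) (meval_homog _ _ Gh) -evo_pull E evo0 mulr0.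
have [B BP] := roots_form (pull_homog fh Gh) pG.
exists B => o w; rewrite -!BP !evo_pull => Go Gw pow.
have no := row_of_neq0 (nc o).
apply: row_pt_inj; apply: (H (row_of (fo f o))).
- apply/(image_curveP fh nc) => //; exists o.
  by apply: par_sym; apply/par_row_of => i; rewrite crs_self.
- by rewrite /evalv (meval_eq _ (vec_row_of _)).
- by split; rewrite ?row_pt_neq0 // param_row_pt; apply: proj_eq_refl.
split; rewrite ?row_pt_neq0 // param_row_pt; apply/proj_eqP => //;
  first exact/row_of_neq0/nc.
by apply/par_row_of; apply: par_sym; apply/par_row_of.
Qed.

End Hypotheses.

Lemma linf_irreducible (K : numClosedFieldType) n (a : 'I_n -> K) i :
  a i != 0 -> irreducible_elt (linf a).
Proof.
move=> ai; have L0 := linf_neq0 ai; split=> //.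
  apply/mpoly_unitP => -[c c0 /(congr1 (meval (fun=> 0)))].
  rewrite meval_linf mevalC big1 => [/esym/eqP|j _]; last by rewrite mulr0.
  by rewrite (negbTE c0).
have key (p q : {mpoly K[n]}) : linf a = p * q -> (exists r, p = linf a * r) ->
    q \is a GRing.unit.
  move=> E [r rE]; apply/unitrPr; exists r; apply: (mulfI L0).
  by rewrite mulr1 {2}E rE; ring.
move=> p q E; case: (linf_prime (G := p) (H := q) (Q := 1) ai) => [|H|H].
- by rewrite mulr1.
- by right; apply: key E H.
by left; apply: key H; rewrite mulrC.
Qed.

(** * Singular points, their branches, and the product over them *)

Section Assembly.
Variables (K : numClosedFieldType) (d : nat) (f psi : 'I_3 -> {mpoly K[2]}).
Variables (B xs : seq (option K)) (F : {mpoly K[3]}) (Nf e : nat).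
Hypothesis d2 : (1 < d)%N.
Hypothesis fh : forall i, f i \is d.-homog.
Hypothesis nc : nocommon f.
Hypothesis inj : inj_off f B.
Hypothesis psih : forall i, psi i \is e.-homog.
Hypothesis psinc : nocommon psi.
Hypothesis gE : forall i, gf f i = (\prod_(x <- xs) lf x) * psi i.
Hypothesis Fh : F \is Nf.-homog.
Hypothesis Firr : irreducible_elt F.
Hypothesis Ff : forall o, F.@[fo f o] = 0.
Hypothesis F_image : forall P, P != 0 -> evalv F P = 0 -> exists o,
  par (vec P) (fo f o).
Implicit Types (P Q : 'rV[K]_3) (o w : option K) (X : seq (option K)).

Lemma singular_point_fiber P X : P != 0 -> is_fiber f (vec P) X ->
  singular_point F P <-> (1 < fiber_mult xs X)%N.
Proof.
move=> P0 XP; have nP := (vec_nz P).1 P0.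
have gradE : gradv F P = 0 <-> forall i, (mderiv i F).@[vec P] = 0.
  split=> [/rowP H i|H]; first by have := H i; rewrite !mxE.
  by apply/rowP => i; rewrite !mxE; apply: H.
split=> [[_ FP gP]|m].
  have [o Po] := F_image P0 FP.
  by apply/(grad_fiber d2 fh nc inj psinc gE Fh Firr Ff nP XP Po)/gradE.
have [o oX] : exists o, o \in X.
  by case: X XP m => [|o X] _; rewrite /fiber_mult ?big_nil // => _; exists o;
    rewrite inE eqxx.
have Po := (XP.2 o).1 oX; split=> //.
  have [k kE] := parP (nc o) (par_sym Po).
  by rewrite /evalv (meval_eq _ kE) (meval_homog _ _ Fh) Ff mulr0.
by apply/gradE; apply/(grad_fiber d2 fh nc inj psinc gE Fh Firr Ff nP XP Po).
Qed.

Lemma nb_branches_fiber P X r : P != 0 -> is_fiber f (vec P) X ->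
  nb_branches F P r <-> r = size X.
Proof.
move=> P0 XP; have nP := (vec_nz P).1 P0; rewrite /nb_branches /germ.
case: pickP => [i Pi|none]; last first.
  by case: nP => i; rewrite -[vec P i]/(P 0 i) none.
pose q j := P 0 j / P 0 i; have qi : q i = 1 by rewrite /q divff.
have XQ : is_fiber f q X.
  apply: fiber_par XP => //; first by exists i; rewrite qi oner_eq0.
  by apply: (par_of_scale (k := (P 0 i)^-1)) => j; rewrite mulrC.
apply: (germ_nb_branchesP d2 fh nc inj Fh Firr Ff qi XQ) => c.
exact: pev_germ_chart.
Qed.

(** Singular points are images of [xs ++ B]: if [fiber_mult] exceeds 1, either some parameter over P
    is a root of h, or there are two of them and injectivity puts one in [B]. *)
Lemma singular_points_exist : exists S, singular_points F S.
Proof.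
have [S [uS sS SS cS]] := @representatives _ (@proj_eq K 3)
  [seq P <- [seq row_of (fo f o) | o <- xs ++ B] | `[< singular_point F P >] ]
  (@proj_eq_refl _ _) (@proj_eq_sym _ _).
exists S; split=> // [P /sS|P sP].
  by rewrite mem_filter => /andP[/asboolP].
have P0 : P != 0 by case: sP.
have nP := (vec_nz P).1 P0; have [X XP] := fiber_list d2 fh nc inj nP.
have m1 := (singular_point_fiber P0 XP).1 sP.
have [o oX oxB] : exists2 o, o \in X & o \in xs ++ B.
  have [//|H] := pselect (exists2 o, o \in X & o \in xs ++ B).
  have no o : o \in X -> (o \notin xs) /\ (o \notin B).
    move=> oX; apply/andP; rewrite -negb_or -mem_cat; apply/negP => oxB.
    by apply: H; exists o.
  move: m1; rewrite /fiber_mult (@eq_big_seq _ _ _ _ _ _ (fun=> 1%N)) =>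
    [|o /no[ox _]].
    rewrite sum1_size; case: X XP no {H} => [|o [|w X]] // [uX XP] no _.
    have oX : o \in [:: o, w & X] by rewrite !inE eqxx.
    have wX : w \in [:: o, w & X] by rewrite !inE eqxx orbT.
    have ow : o = w.
      apply: inj; [exact: (no _ oX).2|exact: (no _ wX).2|].
      by apply: (par_trans nP) (par_sym _) _; apply/XP.
    by move: uX; rewrite ow /= inE eqxx.
  by rewrite (count_memPn ox).
pose Q := row_of (fo f o).
have Q0 : Q != 0 by apply/row_of_neq0/nc.
have PQ : par (vec P) (vec Q) by apply/par_row_of/XP.2.
have sQ : singular_point F Q.
  apply/(singular_point_fiber Q0 (X := X)) => //.
  by apply: fiber_par XP => //; apply/vec_nz.
have [|R RS QR] := cS Q.
  by rewrite mem_filter (introT (asboolP _) sQ); apply/mapP; exists o.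
exists R => //; have R0 : R != 0 by case: QR => k k0 ->;
  rewrite scaler_eq0 negb_or k0.
apply/proj_eqP => //; apply: par_trans PQ _; first exact/vec_nz.
by apply/proj_eqP.
Qed.

(** At all but finitely many w the point f(w) is smooth, and its gradient, orthogonal to f_s(w) and
    f_t(w), is proportional to psi(w). A form vanishing on the tangent lines therefore has a
    pullback by psi with infinitely many zeros, so it vanishes at every psi(o). *)
Lemma dual_curve_psi o : dual_curve F (row_of (fo psi o)).
Proof.
have Q0 w : row_of (fo psi w) != 0 by apply/row_of_neq0/psinc.
split=> // a G Gh GZ.
have [i pi0] := grad_pull_neq0 d2 fh nc inj Fh Firr Ff.
have [s sP] := roots_form (pull_homog fh (dhomog_mderiv i Fh)) pi0.
suff: pull psi G = 0.
  by move/(congr1 (fun H => evo H o)); rewrite evo_pull evo0 /evalv (meval_eq _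
    (vec_row_of _)).
apply: (form_vanish (s := s ++ xs) (pull_homog psih Gh)) => w.
rewrite mem_cat negb_or => /andP[ws wx]; rewrite evo_pull.
rewrite -(meval_eq _ (vec_row_of (fo psi w))); apply: GZ.
pose P := row_of (fo f w); have P0 : P != 0 by apply/row_of_neq0/nc.
have gvE j : gradv F P 0 j = grad F (fo f w) j.
  by rewrite mxE /evalv (meval_eq _ (vec_row_of _)).
have ng : nz (grad F (fo f w)) by exists i; rewrite /grad -evo_pull sP.
have gv0 : gradv F P != 0.
  by case: ng => j; rewrite -gvE; apply: contra => /eqP->; rewrite mxE.
exists P; first by split=> //; rewrite /evalv (meval_eq _ (vec_row_of _)).
have gw j : fo (gf f) w j = evo (\prod_(x <- xs) lf x) w * fo psi w j.
  by rewrite /fo gE evoM.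
have px0 : evo (\prod_(x <- xs) lf x) w != 0 by rewrite evo_prod_lf.
apply/proj_eqP => //; apply: par_sym.
have E0 j : dot (grad F (fo f w)) (fo (fd j f) w) = 0.
  by rewrite -chain_rule (pull_vanish fh Fh Ff) raddf0 evo0.
have H : par (fo (gf f) w) (grad F (fo f w)).
  have := orth_par _ (E0 0) (E0 1) => H j.
  have -> : crs (fo (gf f) w) (grad F (fo f w)) j =
      crs (crs (fo (fd 0 f) w) (fo (fd 1 f) w)) (grad F (fo f w)) j.
    by rewrite /crs !fo_gf.
  apply: H; have [l pl] := psinc w; exists l.
  by rewrite -fo_gf gw mulf_neq0.
have ngf : nz (fo (gf f) w).
  by have [l pl] := psinc w; exists l; rewrite gw mulf_neq0.
have H1 : par (vec (row_of (fo psi w))) (fo (gf f) w).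
  by apply: (par_of_scale (k := evo (\prod_(x <- xs) lf x) w)) => j;
    rewrite vec_row_of gw.
apply: (par_trans ngf H1) => j.
have -> : crs (fo (gf f) w) (vec (gradv F P)) j = crs (fo (gf f) w) (grad F (fo
  f w)) j.
  by rewrite /crs /vec !gvE.
exact: H.
Qed.

(** Each root x of h gives a point f(x) with [fiber_mult] at least 2, so x lies over exactly one
    point of [S], and its point line is a scalar multiple of the [dual_line] of that point. *)
Lemma prod_point_line (S : seq 'rV[K]_3) (X : 'rV[K]_3 -> seq (option K)) :
  singular_points F S -> (forall P, P != 0 -> is_fiber f (vec P) (X P)) ->
  exists2 c, c != 0 & \prod_(x <- xs) point_line f x =
    c *: \prod_(P <- S) dual_line P ^+ (\sum_(o <- X P) count_mem o xs).
Proof.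
move=> [uS Ssing SS Scov] XP.
have S0 P : P \in S -> P != 0 by case/Ssing.
have Sx x : x \in xs -> exists2 P, P \in S & x \in X P.
  move=> xxs; pose Q := row_of (fo f x);
    have Q0 : Q != 0 by apply/row_of_neq0/nc.
  have xQ : x \in X Q by apply/(XP _ Q0).2/par_sym/par_row_of => j;
    rewrite crs_self.
  have [|P PS QP] := Scov Q.
    apply/(singular_point_fiber Q0 (XP _ Q0)); rewrite /fiber_mult.
    rewrite (bigD1_seq x) ?(XP _ Q0).1 //= ltn_addr // ltnS -has_count.
    by apply/hasP; exists x => //=.
  exists P => //; apply/(XP _ (S0 _ PS)).2.
  have nQ := (vec_nz Q).1 Q0; apply: (par_trans nQ); last exact/(XP _ Q0).2.
  by apply: par_sym; apply/proj_eqP => //; apply: S0.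
move: (xs) Sx; elim=> [|y ys IH] Sx.
  exists 1; rewrite ?oner_eq0 // big_nil scale1r big1 // => P _.
  by rewrite big1 // expr0.
have [x xys|c c0 cE] := IH; first by apply: Sx; rewrite inE xys orbT.
have [P PS yP] := Sx y (mem_head _ _).
have P0 := S0 _ PS; have [k kE] := parP ((vec_nz P).1 P0) (((XP _ P0).2 y).1
  yP).
have k0 : k != 0.
  by apply/eqP => k0; have [j] := nc y; rewrite kE k0 mul0r eqxx.
exists (k * c); first by rewrite mulf_neq0.
rewrite big_cons cE.
have -> : point_line f y = k *: dual_line P.
  rewrite /point_line /linf /dual_line scaler_sumr; apply: eq_bigr => j _.
  by rewrite kE scalerA.
have -> : \prod_(Q <- S) dual_line Q ^+ (\sum_(o <- X Q) count_mem o (y :: ys))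
  =
    (\prod_(Q <- S) dual_line Q ^+ (y \in X Q)) *
    \prod_(Q <- S) dual_line Q ^+ (\sum_(o <- X Q) count_mem o ys).
  rewrite -big_split; apply: eq_big_seq => Q QS; rewrite /= -exprD;
    congr (_ ^+ _).
  by have uX := (XP _ (S0 _ QS)).1; rewrite -(count_mem_sum (y :: ys) uX)
    -(count_mem_sum ys uX).
have -> : \prod_(Q <- S) dual_line Q ^+ (y \in X Q) = dual_line P.
  rewrite (bigD1_seq P PS uS) /= yP expr1 big1_seq ?mulr1 // => Q /andP[QP QS].
  case yQ: (y \in X Q); rewrite ?expr0 //.
  have Q0 := S0 _ QS; case/eqP: QP; apply: SS => //; apply/proj_eqP => //.
  apply: (par_trans (nc y)); first exact/(XP _ Q0).2.
  by apply: par_sym; apply/(XP _ P0).2.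
by rewrite -!mul_mpolyC mpolyCM; ring.
Qed.

End Assembly.

Theorem theorem3p3 (R : realType) (d : nat) (f : 'I_3 -> {mpoly R[i][2]})
    (F Fd : {mpoly R[i][3]}) :
  (2 <= d)%N ->
  (forall i, f i \is d.-homog) ->
  coprime_family f ->
  generically_one_to_one f ->
  irreducible_equation (image_curve f) F ->
  irreducible_equation (dual_curve F) Fd ->
  [/\ exists S, singular_points F S,
      forall P, singular_point F P -> exists r, nb_branches F P r
    & forall (S : seq 'rV[R[i]]_3) (r : 'rV[R[i]]_3 -> nat),
        singular_points F S ->
        (forall P, P \in S -> nb_branches F P (r P)) ->
        (forall P, P \in S ->
           irreducible_elt (dual_line P) /\ (r P <= multiplicity F P)%N) /\
        exists2 c : R[i], c != 0 &
          form_disc d (generic_combination f) =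
          c *: (Fd * \prod_(P <- S) dual_line P ^+ (multiplicity F P - r P))].
Proof.
move=> d2 fh cop gen [[Nf Fh] Firr Fz] [[Nd Fdh] Fdirr Fdz].
have nc := coprime_nocommon fh cop; have [B inj] := generic_inj_off fh nc gen.
have Ff o : F.@[fo f o] = 0.
  have Q0 := row_of_neq0 (nc o); rewrite -(meval_eq _ (vec_row_of (fo f o))).
  apply/(Fz _ Q0)/(image_curveP fh nc Q0); exists o.
  by apply: par_sym; apply/par_row_of => j; rewrite crs_self.
have Fim (P : 'rV[R[i]]_3) : P != 0 -> evalv F P = 0 -> exists o,
  par (vec P) (fo f o).
  by move=> P0 /(Fz _ P0)/(image_curveP fh nc P0).
have [i gi] : exists i, gf f i != 0.
  apply: (gf_neq0 (ltnW d2) fh nc); have nz1 : nz (fun=> 1 : R[i]).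
    by exists 0; rewrite oner_eq0.
  by exists (fun=> 1); apply: (section_neq0 d2 fh nc inj nz1).
have [xs [psi [sz psih psinc gE]]] := family_gcd (fun i =>
  gf_homog i fh) (ex_intro _ i gi).
have Fdpsi o : Fd.@[fo psi o] = 0.
  have Q0 := row_of_neq0 (psinc o); rewrite -(meval_eq _ (vec_row_of (fo psi
    o))).
  exact/(Fdz _ Q0)/(dual_curve_psi d2 fh nc inj psih psinc gE Fh Firr Ff).
(* One fibre is chosen for each point; the default list concerns the zero vector only. *)
pose X P := if pselect (exists X, is_fiber f (vec P) X) is left H then sval (cid
  H) else [::].
have XP (P : 'rV[R[i]]_3) : P != 0 -> is_fiber f (vec P) (X P).
  move=> /vec_nz nP; rewrite /X; case: pselect => [H|[]];
    first by case: (cid H).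
  exact: (fiber_list d2 fh nc inj nP).
have nbP P r (P0 : P != 0) : nb_branches F P r <-> r = size (X P) :=
  nb_branches_fiber d2 fh nc inj Fh Firr Ff r P0 (XP P P0).
split; first exact: (singular_points_exist d2 fh nc inj psinc gE Fh Firr Ff
  Fim).
  by move=> P [P0 _ _]; exists (size (X P)); apply/nbP.
move=> S r SS rS; have S0 P : P \in S -> P != 0 by case: SS => _ H _ _ /H[].
have multE P : P \in S -> multiplicity F P = (\sum_(o <- X P) count_mem o xs + r
  P)%N.
  move=> PS; have P0 := S0 _ PS.
  rewrite (multiplicity_fiber d2 fh nc inj psinc gE Fh Firr Ff P0 (XP _ P0)).
  rewrite ((nbP _ _ P0).1 (rS _ PS)) -sum1_size -big_split.
  by apply: eq_bigr => o _; rewrite /= addn1.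
split=> [P PS|].
  split; last by rewrite multE // leq_addl.
  by have [j Pj] := (vec_nz P).1 (S0 _ PS);
    apply: (linf_irreducible (a := vec P) Pj).
have [c c0 cE] := disc_factorization d2 fh nc inj psih psinc gE Fdh Fdirr Fdpsi
  (subnKC sz).
have [c' c'0 c'E] := prod_point_line d2 fh nc inj psinc gE Fh Firr Ff Fim SS XP.
exists (c * c'); first by rewrite mulf_neq0.
rewrite [LHS]cE c'E -scalerAr scalerA; congr (_ *: (_ * _)).
by apply: eq_big_seq => P PS; rewrite multE // addnK.
Qed.
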